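(* Let $W_1,W_2,\dots$ be i.i.d. with law $\lambda_0\in\mathcal{P}(\mathcal{W})$, let $\hat x^n_i$ be measurable functions such that $(\hat x^n_1(\vec w),\dots,\hat x^n_n(\vec w))$ is a Nash equilibrium with type vector $\vec w$ for every $\vec w\in\mathcal{W}^n$, and $\mu_n=\frac1n\sum_{i=1}^n\delta_{(W_i,\hat x^n_i(W_1,\dots,W_n))}$. Let $A\subset\mathcal{P}(\mathcal{W}\times\mathcal{X})$ be measurable and define $$I(A):=\inf\{H(\lambda|\lambda_0):\lambda\ll\lambda_0,\ \overline{A}\cap\mathcal{M}(\lambda)\ne\emptyset\},\qquad S(A):=\{m\in\overline{A}\cap\mathcal{M}:H(m^w|\lambda_0)=I(A)\}.$$ Suppose $I(A)<\infty$. Then $S(A)$ is nonempty and compact. Assume moreover that $$I(A)=\inf\{H(\lambda|\lambda_0):\lambda\ll\lambda_0,\ \mathcal{M}(\lambda)\subset A^\circ\}$$ and that $\mathbb{P}(\mu_n\in A)>0$ for all sufficiently large $n$. Then, for any metric $d$ on $\mathcal{P}(\mathcal{W}\times\mathcal{X})$ compatible with weak convergence and every $\epsilon>0$, there exists $c>0$ such that for all sufficiently large $n$, $$\mathbb{P}(d(\mu_n,S(A))\ge\epsilon\mid\mu_n\in A)\le e^{-cn}.$$ In particular, every limit point of the conditional laws of $\mu_n$ given $\{\mu_n\in A\}$ is supported on $S(A)$, and if $S(A)=\{\nu\}$ is a singleton these conditional laws converge to the point mass at $\nu$. Finally, if $\mathcal{M}(\lambda)$ is a singleton for every $\lambda\ll\lambda_0$,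 then the displayed assumption on $I(A)$ is equivalent to $$I(A)=\inf_{m\in\overline{A}\cap\mathcal{M}}H(m^w|\lambda_0)=\inf_{m\in A^\circ\cap\mathcal{M}}H(m^w|\lambda_0).$$
   Context: Standing assumptions: $\mathcal{X}$ compact metric space, $\mathcal{W}$ complete separable metric space; $\mathcal{P}(S)$ = Borel probability measures on $S$ with the weak topology. $\mathcal{C}$ maps $w$ to a nonempty closed $\mathcal{C}(w)\subset\mathcal{X}$, continuous in the sense that $\mathrm{Gr}(\mathcal{C})=\{(w,x):x\in\mathcal{C}(w)\}$ is closed and whenever $w_n\to w$, $x\in\mathcal{C}(w)$ there exist $n_k$ and $x_{n_k}\in\mathcal{C}(w_{n_k})$ with $x_{n_k}\to x$. $F:\mathcal{P}(\mathcal{W}\times\mathcal{X})\times\mathcal{W}\times\mathcal{X}\to\mathbb{R}$ bounded continuous. A Nash equilibrium with type vector $(w_1,\dots,w_n)$ is $(x_1,\dots,x_n)$ with $x_i\in\mathcal{C}(w_i)$ and $F(\frac1n\sum_k\delta_{(w_k,x_k)},w_i,x_i)=\inf_{y\in\mathcal{C}(w_i)}F(\frac1n\sum_{k\ne i}\delta_{(w_k,x_k)}+\frac1n\delta_{(w_i,y)},w_i,y)$ for all $i$; such equilibria are assumed to exist for all $n$ and type vectors. $m^w$ = first marginal. $\mathcal{M}(\lambda)$ = set of $m$ with $m^w=\lambda$ and, for $m$-a.e. $(w,x)$, $x\in\mathcal{C}(w)$ and $F(m,w,x)=\inf_{y\in\mathcal{C}(w)}F(m,w,y)$; $\mathcal{M}=\bigcup_\lambda\mathcal{M}(\lambda)$.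 $H$ is relative entropy ($+\infty$ unless absolutely continuous). $d(\mu,S)=\inf_{m\in S}d(\mu,m)$. $\inf\emptyset=\infty$. *)

(* Defs.v *)
From mathcomp Require Import all_boot all_order all_algebra.
From mathcomp Require Import all_classical all_reals all_analysis.
Import Order.TTheory GRing.Theory Num.Theory.
Import numFieldNormedType.Exports.

Set Implicit Arguments.
Unset Strict Implicit.
Unset Printing Implicit Defensive.

Local Open Scope classical_set_scope.
Local Open Scope ring_scope.

Definition borel (T : ptopologicalType) : Type := g_sigma_algebraType (@open T).

Section mfg.
Variables (R : realType) (W X : pseudoPMetricType R).

Definition WX : Type := (borel W * borel X)%type.
Definition PM : Type := probability WX R.

Definition bcont (f : W * X -> R) : Prop :=
  continuous f /\ exists M : R, forall p, `|f p| <= M.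

Definition integ (m : PM) (f : W * X -> R) : \bar R := (\int[m]_p (f p)%:E)%E.

Definition wnbhd (m : PM) (k : nat) (fs : 'I_k -> W * X -> R) (e : R) : set PM :=
  [set m' | forall i, (`|integ m' (fs i) - integ m (fs i)| < e%:E)%E].

Definition weak_open (U : set PM) : Prop :=
  forall m, U m -> exists k (fs : 'I_k -> W * X -> R),
    (forall i, bcont (fs i)) /\ exists2 e : R, 0 < e & wnbhd m fs e `<=` U.

Definition weak_interior (A : set PM) : set PM :=
  [set m | exists U, [/\ weak_open U, U m & U `<=` A]].

Definition weak_closure (A : set PM) : set PM :=
  [set m | forall U, weak_open U -> U m -> U `&` A !=set0].

Definition weak_compact (S : set PM) : Prop :=
  forall G : set (set PM), (forall U, G U -> weak_open U) ->
    S `<=` \bigcup_(U in G) U ->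
    exists k (g : 'I_k -> set PM), (forall j, G (g j)) /\ S `<=` \bigcup_j g j.

Definition weak_borel (A : set PM) : Prop := <<s weak_open >> A.

Definition PMb : Type := g_sigma_algebraType weak_open.

Definition weak_cont (G : PM -> R) : Prop :=
  forall m (e : R), 0 < e -> exists k (fs : 'I_k -> W * X -> R),
    (forall i, bcont (fs i)) /\ exists2 dl : R, 0 < dl &
      forall m', wnbhd m fs dl m' -> `|G m' - G m| < e.

Definition meq (m m' : PM) : Prop :=
  forall B : set WX, measurable B -> m B = m' B.

(** [d] is a metric on P(W x X) (i.e. on measures modulo equality on Borel
    sets) compatible with (= generating) the weak topology. *)
Definition metrizes (d : PM -> PM -> R) : Prop :=
  [/\ forall m, d m m = 0,
      forall m m', d m m' = d m' m,
      forall m1 m2 m3, d m1 m3 <= d m1 m2 + d m2 m3,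
      forall m m', d m m' = 0 -> meq m m' &
      forall U, weak_open U <->
        (forall m, U m -> exists2 r : R, 0 < r & [set m' | d m m' < r] `<=` U)].

Definition dist (d : PM -> PM -> R) (m : PM) (S : set PM) : \bar R :=
  ereal_inf [set (d m m')%:E | m' in S].

Definition F_bcont (F : PM -> W -> X -> R) : Prop :=
  (exists M : R, forall m w x, `|F m w x| <= M) /\
  forall m w x (e : R), 0 < e -> exists k (fs : 'I_k -> W * X -> R),
    (forall i, bcont (fs i)) /\ exists2 dl : R, 0 < dl &
      forall m' w' x', wnbhd m fs dl m' -> ball w dl w' -> ball x dl x' ->
        `|F m' w' x' - F m w x| < e.

Definition corr_cont (C : W -> set X) : Prop :=
  [/\ forall w, C w !=set0 /\ closed (C w),
      closed [set p : W * X | C p.1 p.2] &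
      forall (ws : nat -> W) (w : W) (x : X),
        ws @ \oo --> w -> C w x ->
        exists (phi : nat -> nat) (xs : nat -> X),
          [/\ {homo phi : a b / (a < b)%N},
              forall k, C (ws (phi k)) (xs k) &
              xs @ \oo --> x]].

(** Empirical measure (1/n) sum_k delta_{v k}  (for n > 0). *)
Definition emp (n : nat) (v : 'I_n -> WX) : PM :=
  mnormalize (msum (fun k : nat =>
     (\d_(if insub k is Some i then v i else point) : measure WX R)) n)
    (point : PM).

Definition prof (n : nat) (w : 'I_n -> W) (x : 'I_n -> X) : 'I_n -> WX :=
  fun k => (w k, x k).

Definition upd (n : nat) (x : 'I_n -> X) (i : 'I_n) (y : X) : 'I_n -> X :=
  fun k => if k == i then y else x k.

Definition nash (F : PM -> W -> X -> R) (C : W -> set X) (n : nat)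
    (w : 'I_n -> W) (x : 'I_n -> X) : Prop :=
  forall i, C (w i) (x i) /\
    (F (emp (prof w x)) (w i) (x i))%:E =
    ereal_inf [set (F (emp (prof w (upd x i y))) (w i) y)%:E | y in C (w i)].

Definition marg_is (m : PM) (l : probability (borel W) R) : Prop :=
  forall B : set (borel W), measurable B -> m (B `*` [set: borel X]) = l B.

Definition Mset (F : PM -> W -> X -> R) (C : W -> set X)
    (l : probability (borel W) R) (m : PM) : Prop :=
  marg_is m l /\
  {ae m, forall p : WX, C p.1 p.2 /\
     (F m p.1 p.2)%:E = ereal_inf [set (F m p.1 y)%:E | y in C p.1]}.

Definition density (l l0 : probability (borel W) R) (f : borel W -> R) : Prop :=
  [/\ measurable_fun [set: borel W] f, forall w, 0 <= f w &
      forall B, measurable B -> l B = (\int[l0]_(w in B) (f w)%:E)%E].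

Definition relent (l l0 : probability (borel W) R) : \bar R :=
  match pselect (exists f, density l l0 f) with
  | left h => let f := projT1 (cid h) in (\int[l0]_w (f w * ln (f w))%:E)%E
  | right _ => +oo%E
  end.

Section rates.
Variables (F : PM -> W -> X -> R) (C : W -> set X)
  (l0 : probability (borel W) R) (A : set PM).

Definition Irate : \bar R :=
  ereal_inf [set relent l l0 | l in
    [set l : probability (borel W) R | l `<< l0 /\ exists m, weak_closure A m /\ Mset F C l m]].

Definition Irate_int : \bar R :=
  ereal_inf [set relent l l0 | l in
    [set l : probability (borel W) R | l `<< l0 /\ forall m, Mset F C l m -> weak_interior A m]].

Definition Sset : set PM :=
  [set m | weak_closure A m /\ exists l, Mset F C l m /\ relent l l0 = Irate].

Definition inf_closure : \bar R :=
  ereal_inf [set z | exists m l, [/\ weak_closure A m, Mset F C l m & z = relent l l0]].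
Definition inf_interior : \bar R :=
  ereal_inf [set z | exists m l, [/\ weak_interior A m, Mset F C l m & z = relent l l0]].
End rates.

Definition prodn_sigma (n : nat) : set (set ('I_n -> borel W)) :=
  <<s \bigcup_(i in [set: 'I_n])
        preimage_set_system [set: 'I_n -> borel W] (fun v => v i) measurable >>.

Section random.
Variables (dO : measure_display) (Om : measurableType dO) (P : probability Om R).

Definition iid (Ws : nat -> Om -> borel W) (l0 : probability (borel W) R) : Prop :=
  [/\ forall i, measurable_fun [set: Om] (Ws i),
      forall i B, measurable B -> P (Ws i @^-1` B) = l0 B &
      forall k (idx : 'I_k -> nat) (B : 'I_k -> set (borel W)),
        injective idx -> (forall j, measurable (B j)) ->
        P (\bigcap_j (Ws (idx j) @^-1` B j)) =
        (\prod_(j < k) P (Ws (idx j) @^-1` B j))%E].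

Definition mu_n (Ws : nat -> Om -> borel W)
    (xhat : forall n, ('I_n -> W) -> 'I_n -> X) (n : nat) (o : Om) : PM :=
  emp (prof (fun i : 'I_n => Ws i o) (xhat n (fun j : 'I_n => Ws j o))).

Definition condE (mu : nat -> Om -> PM) (A : set PM) (n : nat) (G : PM -> R) : R :=
  fine (\int[P]_(o in [set o | A (mu n o)]) (G (mu n o))%:E)%E /
  fine (P [set o | A (mu n o)]).
End random.

End mfg.

(* Main.v *)
(** The upper bound is Chernoff's: if the rate of a limit point m exceeds r, the
    Donsker-Varadhan formula for the relative entropy of its first marginal provides a bounded
    continuous g witnessing this, and the exponential moment of the sum of the g(W_i) bounds the
    probability that mu_n is near m. Measures m outside M have neighbourhoods that mu_n avoids for
    large n, because empirical measures of equilibria are 2/n-quasi-equilibria and limits of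
    d-quasi-equilibria as d -> 0 are in M. Finitely many such neighbourhoods cover a tight set, and
    the complement of that set is handled by a function of w alone, X being compact; covering is
    done with ultrafilters, a limit of a tight ultrafilter being a measure by Riesz representation.

    For the lower bound, let Q_n be the law making the W_i i.i.d. with law l. The upper bound with
    r = 0 under Q_n shows that mu_n approaches M(l), so Q_n(mu_n in U) -> 1 for every open U
    containing M(l), and the Gibbs inequality H(Q_n | P) = n H(l | l0) gives
    P(mu_n in U) >= exp(- n (H(l | l0) + d)).

    Dividing, P(mu_n outside U | mu_n in A) decays exponentially for each open U containing S(A).
    Compactness of S(A) comes from tightness and lower semicontinuity of the entropy. *)
From HB Require Import structures.
Require Import Defs.
From mathcomp Require Import all_boot all_order all_algebra.
From mathcomp Require Import all_classical all_reals all_analysis.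
Import Order.TTheory GRing.Theory Num.Theory.
Import numFieldNormedType.Exports.
From mathcomp Require Import measurable_realfun ring lra.
Local Open Scope classical_set_scope.
Local Open Scope ring_scope.
Set Implicit Arguments.
Unset Strict Implicit.
Unset Printing Implicit Defensive.

(** * Bump functions and countable bases *)

(** [PM] carries no topological structure: the weak topology exists only through [weak_open], and
    two measures may agree on every Borel set without being the same term, so openness and
    compactness are proved by hand and equality is [meq]. The metric d of the statement enters only
    through the openness of {dist < eps}. A neighbourhood of a measure outside M is avoided by mu_n
    for every outcome, not just almost surely, since the equilibrium property is known for every
    type vector. The probabilistic estimates therefore concern functions of the types alone. The
    upper bound holds for the law tilted by any density and gives a rate strictly better than r.
    With density 1 and r = I(A), the excess is what survives the division by P(mu_n in A). With r =
    0 it is a law of large numbers under Q_n, whose only input is that two different marginals are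
    separated by the Donsker-Varadhan functional. A limit point of the conditional laws is a measure
    on [PMb]; its support is located with countably many weakly continuous functions, each vanishing
    near S(A). *)

Section bump.
Context {R : realType} {T : pseudoMetricType R}.
Implicit Types (U : set T) (x y : T).

(** The cap at 1 keeps the value finite where the distance to the complement is infinite, in
    particular when U is the whole space. *)
Definition dcut U x : R := fine (mine 1%E (edist_inf (~` U) x)).

Lemma dcutE U x : (dcut U x)%:E = mine 1%E (edist_inf (~` U) x).
Proof.
rewrite /dcut fineK// fin_real// (lt_le_trans (ltNyr 0))/=; last first.
  by rewrite le_min lee01 edist_inf_ge0.
by apply: (@le_lt_trans _ _ 1%E); rewrite ?ge_min ?lexx// ltry.
Qed.

Lemma dcut_ge0 U x : 0 <= dcut U x.
Proof. by rewrite -lee_fin dcutE le_min lee01 edist_inf_ge0. Qed.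

Lemma dcut_lip U x y e : 0 < e -> ball x e y -> dcut U x <= dcut U y + e.
Proof.
move=> e0 xy; rewrite -lee_fin EFinD !dcutE.
have h := edist_inf_triangle (~` U) x y.
have exy : (edist (x, y) <= e%:E)%E by exact: (@edist_fin _ _ e (x,y)).
have [h1|h1] := leP 1%E (edist_inf (~` U) y).
  by rewrite ge_min (le_trans (_ : (1 <= 1 + e%:E)%E))// leeDl// lee_fin ltW.
rewrite ge_min; apply/orP; right; apply: (le_trans h).
by rewrite [leLHS]addeC leeD2l.
Qed.

Lemma dcut_continuous U : continuous (dcut U).
Proof.
move=> x; apply/cvgrPdist_le => e e0.
near=> y; have xy : ball x e y by near: y; exact: nbhsx_ballx.
rewrite ler_norml; apply/andP; split.
  by rewrite lerBrDr addrC lerBlDr; apply: dcut_lip => //; exact: ball_sym.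
by rewrite lerBlDr addrC; exact: dcut_lip.
Unshelve. all: by end_near. Qed.

Lemma dcut_out U x : ~ U x -> dcut U x = 0.
Proof.
move=> nUx; apply/eqP; rewrite -eqe dcutE edist_inf0//.
by rewrite min_r.
Qed.

Lemma dcut_in U x : open U -> U x -> 0 < dcut U x.
Proof.
move=> oU Ux; have /nbhs_ballP[e /= e0 eU] : nbhs x U by exact: open_nbhs_nbhs.
rewrite -lte_fin dcutE lt_min lte01/= (@lt_le_trans _ _ e%:E)//.
apply: le_ereal_inf_tmp => _ [y nUy <-]; rewrite leNgt; apply/negP => h.
by apply: nUy; apply: eU; have := edist_lt_ball h.
Qed.

(** For open U these increase to the indicator of U; every passage from integrals of continuous
    functions to measures of open sets goes through them. *)
Definition bump U (k : nat) x : R := Num.min 1 (k%:R * dcut U x).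

Lemma bump_ge0 U k x : 0 <= bump U k x.
Proof. by rewrite le_min ler01 mulr_ge0// dcut_ge0. Qed.

Lemma bump_le1 U k x : bump U k x <= 1.
Proof. by rewrite ge_min lexx. Qed.

Lemma bump_continuous U k : continuous (bump U k).
Proof.
move=> x; apply: (@continuous_min _ _ (cst 1) (fun x => k%:R * dcut U x)); first exact: cvg_cst.
by apply: cvgM; [exact: cvg_cst|exact: dcut_continuous].
Qed.

Lemma bump_out U k x : ~ U x -> bump U k x = 0.
Proof. by move=> nUx; rewrite /bump dcut_out// mulr0 min_r. Qed.

Lemma bump_homo U x : {homo bump U ^~ x : j k / (j <= k)%N >-> j <= k}.
Proof.
move=> j k jk; rewrite /bump le_min ge_min lexx/= ge_min.
by rewrite ler_wpM2r ?orbT ?dcut_ge0// ler_nat.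
Qed.

Lemma bump_in U x : open U -> U x ->
  exists k0, forall k, (k0 <= k)%N -> bump U k x = 1.
Proof.
move=> oU Ux; have d0 := dcut_in oU Ux.
exists (Num.truncn (dcut U x)^-1).+1 => k hk.
rewrite /bump min_l// -ler_pdivrMr// div1r ltW//.
by rewrite (lt_le_trans (truncnS_gt _))// ler_nat.
Qed.

Lemma bump_cvg U x : open U -> bump U k x @[k --> \oo] --> (\1_U x : R).
Proof.
move=> oU; rewrite indicE; have [Ux|nUx] := boolP (x \in U).
  have [k0 hk0] := bump_in oU (set_mem Ux).
  apply: cvg_near_cst; near=> k; apply/hk0; near: k; exact: nbhs_infty_ge.
apply: cvg_near_cst; near=> k; rewrite bump_out// => Ux.
by rewrite mem_set in nUx.
Unshelve. all: by end_near. Qed.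

Lemma bump_le_indic U k x : bump U k x <= \1_U x.
Proof.
rewrite indicE; have [Ux|nUx] := boolP (x \in U); first exact: bump_le1.
by rewrite bump_out// => Ux; rewrite mem_set in nUx.
Qed.

End bump.

Section countable_base.

Definition cbase (T : topologicalType) (b : nat -> set T) :=
  (forall i, open (b i)) /\
  forall (U : set T) x, open U -> U x -> exists2 i, b i x & b i `<=` U.

Lemma countable_seq (T : pointedType) (A : set T) : countable A -> A !=set0 ->
  exists u : nat -> T, (forall n, A (u n)) /\ forall x, A x -> exists n, u n = x.
Proof.
move=> /pcard_surjP[g gA] [a Aa].
exists (fun n => if pselect (A (g n)) then g n else a); split => [n|x Ax].
  by case: pselect.
by have [n _ gnx] := gA x Ax; exists n; case: pselect; rewrite gnx.
Qed.

Lemma cbase_second_countable (T : ptopologicalType) :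
  @second_countable T -> exists b, @cbase T b.
Proof.
move=> [B cB [oB bB]].
have B0 : B !=set0.
  by have [C [BC _] _] := bB point setT (filter_nbhsT _); exists C.
have [b [Bb bs]] := countable_seq cB B0; exists b; split => [i|U x oU Ux].
  exact: oB.
have [C [BC Cx] CU] := bB x U (open_nbhs_nbhs (conj oU Ux)).
by have [i biC] := bs _ BC; exists i; rewrite biC.
Qed.

Lemma cbase_separable (R : realType) (T : pseudoPMetricType R) (D : set T) :
  countable D -> closure D = setT -> exists b, @cbase T b.
Proof.
move=> cD clD.
have D0 : D !=set0.
  have : closure D point by rewrite clD.
  by move=> /(_ setT (filter_nbhsT _))[x [Dx _]]; exists x.
have [u [Du us]] := countable_seq cD D0.
(* A ball of a pseudometric type need not be open, hence the interior. *)
pose b0 (p : nat * nat) := (ball (u p.1) (p.2.+1%:R^-1 : R))°.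
exists (fun n => if unpickle n is Some p then b0 p else set0).
split => [i|U x oU Ux].
  by case: unpickle => [p|]; [exact: open_interior|exact: open0].
have /nbhs_ballP[e /= e0 eU] : nbhs x U by exact: open_nbhs_nbhs.
have [n ne] : exists n : nat, n.+1%:R^-1 < e / 2 :> R.
  have e20 : 0 < e / 2 by rewrite divr_gt0.
  by have [n] := ltr_add_invr e20; rewrite add0r; exists n.
have n0 : 0 < (n.+1%:R^-1 : R) by [].
have : closure D x by rewrite clD.
move=> /(_ (ball x (n.+1%:R^-1 / 2 : R))).
case; first by apply: nbhsx_ballx; rewrite divr_gt0.
move=> y [Dy xy]; have [m umy] := us _ Dy.
exists (pickle (m, n)); rewrite pickleK /b0/= umy.
  apply/nbhs_ballP; exists (n.+1%:R^-1 / 2) => /=; first by rewrite divr_gt0.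
  move=> z xz; rewrite [_^-1]splitr; exact: ball_triangle (ball_sym xy) xz.
move=> z /interior_subset yz; apply: eU; rewrite [e]splitr.
apply: ball_triangle (le_ball _ xy) (le_ball (ltW ne) yz).
by rewrite (le_trans _ (ltW ne))// ler_pdivrMr// ler_peMr ?ler1n// ltW.
Qed.

Lemma cbase_prod (S T : topologicalType) bS bT :
  @cbase S bS -> @cbase T bT ->
  @cbase (S * T)%type (fun n => if unpickle n is Some (i, j) then bS i `*` bT j else set0).
Proof.
move=> [oS hS] [oT hT]; split => [i|U x oU Ux].
  case: unpickle => [[j k]|]; last exact: open0.
  rewrite openE => -[x y] [/= bx by_]; exists (bS j, bT k) => //=.
  by split; apply: open_nbhs_nbhs.
have /= [[A B] [/= nA nB] ABU] : nbhs x U by exact: open_nbhs_nbhs.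
have := nA; rewrite nbhsE => -[A' [oA' A'x] A'A].
have := nB; rewrite nbhsE => -[B' [oB' B'x] B'B].
have [i bix biA] := hS _ _ oA' A'x; have [j bjx bjB] := hT _ _ oB' B'x.
exists (pickle (i, j)); rewrite pickleK// => -[y z] [/= by_ bz].
by apply: ABU; split => /=; [apply/A'A/biA|apply/B'B/bjB].
Qed.

Lemma cbase_bigcup (T : topologicalType) b (U : set T) : cbase b -> open U ->
  U = \bigcup_(i in [set i | b i `<=` U]) b i.
Proof.
move=> [ob hb] oU; apply/seteqP; split => [x Ux|x [i /=]]; last exact.
by have [i bix biU] := hb _ _ oU Ux; exists i.
Qed.

Lemma open_measurable_fun (R : realType) d (M : measurableType d) (f : M -> R) :
  (forall U : set R, open U -> measurable (f @^-1` U)) ->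
  measurable_fun setT f.
Proof.
move=> h; apply: (measurability _ (@RGenOpens.measurableE R)) => /= _ [_ [x [y ->]] <-].
by rewrite setTI; apply: h; exact: interval_open.
Qed.

Lemma open_measurable_borel (T : ptopologicalType) (U : set T) :
  open U -> measurable (U : set (borel T)).
Proof. exact: sub_sigma_algebra. Qed.

Lemma cont_measurable_borel (R : realType) (T : ptopologicalType) (f : T -> R) :
  continuous f -> measurable_fun [set: borel T] f.
Proof.
move=> cf; apply: open_measurable_fun => U oU; apply: open_measurable_borel.
by apply: open_comp => // x _; exact: cf.
Qed.

(** [WX] carries the product of the two Borel sigma-algebras; an open set belongs to it as a
    countable union of open rectangles. *)
Lemma open_measurable_prod (S T : ptopologicalType) bS bT (U : set (S * T)) :
  @cbase S bS -> @cbase T bT -> open U ->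
  measurable (U : set (borel S * borel T)).
Proof.
move=> hS hT oU.
rewrite (cbase_bigcup (cbase_prod hS hT) oU).
apply: bigcup_measurable => n _; case: unpickle => [[i j]|//].
by apply: measurableX; apply: open_measurable_borel; [case: hS|case: hT].
Qed.

Lemma continuous_measurable_borel (S T : ptopologicalType) (f : S -> T) :
  continuous f -> measurable_fun [set: borel S] (f : borel S -> borel T).
Proof.
move=> cf; apply: (@measurability _ _ (borel S) (borel T) setT f (@open T)) => //= _ [U oU <-].
rewrite setTI; apply: open_measurable_borel.
by apply: open_comp => // x _; exact: cf.
Qed.

End countable_base.

(** An alias that carries both the product pseudometric and a point, so that Riesz representation
    applies to it. The resulting measure lives on the Borel sets of the product topology and is
    moved to [WX] by [pprod_id_measurable]. *)
Definition pprod (S T : Type) : Type := (S * T)%type.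
HB.instance Definition _ (R : realType) (S T : pseudoPMetricType R) :=
  PseudoMetric.copy (pprod S T) (S * T)%type.
HB.instance Definition _ (R : realType) (S T : pseudoPMetricType R) :=
  Pointed.copy (pprod S T) (S * T)%type.

Lemma pprod_id_measurable (R : realType) (S T : pseudoPMetricType R) :
  measurable_fun [set: borel (pprod S T)]
    (id : borel (pprod S T) -> borel S * borel T).
Proof.
apply/measurable_fun_pairP; split.
  apply: (@continuous_measurable_borel (pprod S T) S fst) => x.
  by case: x => x y; exact: (@cvg_fst _ _ (nbhs x) (nbhs y)).
apply: (@continuous_measurable_borel (pprod S T) T snd) => x.
by case: x => x y; exact: (@cvg_snd _ _ (nbhs x) (nbhs y)).
Qed.

(** * Riesz representation of tight functionals *)

Definition bcf (R : realType) (T : topologicalType) (f : T -> R) : Prop :=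
  continuous f /\ exists M : R, forall x, `|f x| <= M.

Section bcf_lemmas.
Context {R : realType} {T : topologicalType}.
Implicit Types f g : T -> R.

Lemma bcfD f g : bcf f -> bcf g -> bcf (fun x => f x + g x).
Proof.
move=> [cf [M hM]] [cg [N hN]]; split => [x|]; first by apply: cvgD; [exact: cf|exact: cg].
by exists (M + N) => x; rewrite (le_trans (ler_normD _ _))// lerD.
Qed.

Lemma bcfZ c f : bcf f -> bcf (fun x => c * f x).
Proof.
move=> [cf [M hM]]; split => [x|]; first by apply: cvgM; [exact: cvg_cst|exact: cf].
by exists (`|c| * M) => x; rewrite normrM ler_wpM2l.
Qed.

Lemma bcf_cst c : bcf (fun _ : T => c : R).
Proof. by split => [x|]; [exact: cvg_cst|exists `|c|]. Qed.

Lemma bcfB f g : bcf f -> bcf g -> bcf (fun x => f x - g x).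
Proof.
move=> bf bg; have := bcfD bf (bcfZ (-1) bg).
by congr bcf; apply/funext => x; rewrite mulN1r.
Qed.

Lemma bcf_sum n (F : 'I_n -> T -> R) : (forall i, bcf (F i)) ->
  bcf (fun x => \sum_(i < n) F i x).
Proof.
elim: n F => [|n ih] F hF.
  by under eq_fun do rewrite big_ord0; exact: bcf_cst.
under eq_fun do rewrite big_ord_recr/=.
by apply: bcfD => //; apply: ih.
Qed.

Lemma bcf_min f g : bcf f -> bcf g -> bcf (fun x => Num.min (f x) (g x)).
Proof.
move=> [cf [M hM]] [cg [N hN]]; split => [x|].
  by apply: (@continuous_min R T f g x); [exact: cf|exact: cg].
exists (Num.max M N) => x; rewrite /Num.min; case: ifP => _.
  by rewrite le_max hM.
by rewrite le_max hN orbT.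
Qed.

Lemma bcf_max f g : bcf f -> bcf g -> bcf (fun x => Num.max (f x) (g x)).
Proof.
move=> [cf [M hM]] [cg [N hN]]; split => [x|].
  by apply: (@continuous_max R T f g x); [exact: cf|exact: cg].
exists (Num.max M N) => x; rewrite /Num.max; case: ifP => _.
  by rewrite le_max hN orbT.
by rewrite le_max hM.
Qed.

End bcf_lemmas.

Lemma bcf_bump (R : realType) (T : pseudoMetricType R) (U : set T) k : bcf (bump U k : T -> R).
Proof.
split; first exact: bump_continuous.
by exists 1 => x; rewrite ger0_norm ?bump_le1// bump_ge0.
Qed.

Lemma bounded_integrable (R : realType) d (M : measurableType d) (mu : probability M R) (f : M -> R) :
  measurable_fun setT f -> (exists K : R, forall x, `|f x| <= K) ->
  mu.-integrable setT (EFin \o f).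
Proof.
move=> mf [K hK]; apply: measurable_bounded_integrable => //.
  by rewrite ltey_eq fin_num_measure.
by exists K; split; rewrite ?num_real// => M' KM' x _ /=; rewrite (le_trans (hK x))// ltW.
Qed.

Lemma Rintegral_prob_cst (R : realType) d (M : measurableType d) (mu : probability M R) (c : R) :
  \int[mu]_(x in setT) c = c.
Proof.
by rewrite Rintegral_cst// (_ : fine _ = 1) ?mulr1//; have /= -> := @probability_setT _ _ _ mu.
Qed.

Lemma bcf_integrable (R : realType) (T : pseudoPMetricType R) (mu : probability (borel T) R)
  (f : T -> R) : bcf f -> mu.-integrable [set: borel T] (EFin \o f).
Proof. by move=> [cf bf]; apply: bounded_integrable => //; exact: cont_measurable_borel. Qed.

Lemma bcf_Rintegral_sum (R : realType) (T : pseudoPMetricType R) (mu : probability (borel T) R)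
  n (F : 'I_n -> T -> R) : (forall i, bcf (F i)) ->
  \int[mu]_x (\sum_(i < n) F i x) = \sum_(i < n) \int[mu]_x F i x.
Proof.
elim: n F => [|n ih] F bF.
  by under eq_Rintegral do rewrite big_ord0; rewrite Rintegral_cst// mul0r big_ord0.
under eq_Rintegral do rewrite big_ord_recr/=.
rewrite RintegralD//; [|exact: (bcf_integrable _ (bcf_sum _))|exact: bcf_integrable].
by rewrite ih// big_ord_recr.
Qed.

Section riesz.
Context {R : realType} {T : pseudoPMetricType R}.
Variable L : (T -> R) -> R.
Hypothesis LD : forall f g, bcf f -> bcf g -> L (fun x => f x + g x) = L f + L g.
Hypothesis LZ : forall c f, bcf f -> L (fun x => c * f x) = c * L f.
Hypothesis L1 : L (fun=> 1) = 1.
(** Says that the functional puts mass at most e outside K. Countable subadditivity of the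
    representing measure rests on it. *)
Hypothesis Ltight : forall e, 0 < e -> exists2 K, compact K &
  forall f, bcf f -> (forall x, K x -> 0 <= f x) -> (forall x, -1 <= f x) -> - e <= L f.

Let L_ge0 f : bcf f -> (forall x, 0 <= f x) -> 0 <= L f.
Proof.
move=> bf f0; apply/ler_addgt0Pr => e e0; rewrite -lerBlDr sub0r.
have [K _ h] := Ltight e0; apply: h => // x.
by rewrite (le_trans _ (f0 x))// lerN10.
Qed.

Let L_B f g : bcf f -> bcf g -> L (fun x => f x - g x) = L f - L g.
Proof.
move=> bf bg; have -> : (fun x => f x - g x) = (fun x => f x + (-1) * g x).
  by apply/funext => x; rewrite mulN1r.
by rewrite LD ?LZ ?mulN1r//; exact: bcfZ.
Qed.

Let L_le f g : bcf f -> bcf g -> (forall x, f x <= g x) -> L f <= L g.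
Proof.
move=> bf bg fg; rewrite -subr_ge0 -L_B//; apply: L_ge0; first exact: bcfB.
by move=> x; rewrite subr_ge0.
Qed.

Let L_cst c : L (fun=> c) = c.
Proof.
have -> : (fun _ : T => c) = (fun=> c * 1) by apply/funext => x; rewrite mulr1.
by rewrite LZ ?L1 ?mulr1//; exact: bcf_cst.
Qed.

Let L_sum n (F : 'I_n -> T -> R) : (forall i, bcf (F i)) ->
  L (fun x => \sum_(i < n) F i x) = \sum_(i < n) L (F i).
Proof.
elim: n F => [|n ih] F hF.
  by under eq_fun do rewrite big_ord0; rewrite L_cst big_ord0.
under eq_fun do rewrite big_ord_recr/=.
by rewrite LD ?ih ?big_ord_recr//; exact: bcf_sum.
Qed.

Let below (U : set T) (f : T -> R) := bcf f /\ forall x, 0 <= f x <= \1_U x.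

(** The content of the Riesz construction on open sets; [mus] extends it to all sets from outside,
    and Caratheodory's theorem makes it a measure. *)
Let rho (U : set T) : \bar R := ereal_sup [set (L f)%:E | f in below U].

Let rho_ub U f : below U f -> ((L f)%:E <= rho U)%E.
Proof. by move=> h; apply: ereal_sup_ubound; exists f. Qed.

Let rho_ge0 U : (0 <= rho U)%E.
Proof.
rewrite -[leLHS]/((0:R)%:E) -{1}(L_cst 0); apply: rho_ub; split; first exact: bcf_cst.
by move=> x; rewrite lexx/= indicE.
Qed.

Let rho_le1 U : (rho U <= 1)%E.
Proof.
apply: ge_ereal_sup => _ [f [bf hf] <-]; rewrite lee_fin -(L_cst 1).
apply: L_le => // [|x]; first exact: bcf_cst.
by have /andP[_ /le_trans] := hf x; apply; rewrite indicE; case: (_ \in _).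
Qed.

Let rhoT : rho setT = 1%E.
Proof.
apply/eqP; rewrite eq_le rho_le1/=.
rewrite -[leLHS]/((1:R)%:E) -{1}(L_cst 1); apply: rho_ub; split; first exact: bcf_cst.
by move=> x; rewrite indicT ler01 lexx.
Qed.

Let rho_mono U V : U `<=` V -> (rho U <= rho V)%E.
Proof.
move=> UV; apply: ge_ereal_sup => _ [f [bf hf] <-]; apply: rho_ub; split => // x.
have /andP[-> /le_trans] := hf x; apply; rewrite !indicE.
have [xU|] := boolP (x \in U) => //; by rewrite (mem_set (UV _ (set_mem xU))).
Qed.

Let rho0 : rho set0 = 0%E.
Proof.
apply/eqP; rewrite eq_le rho_ge0 andbT.
apply: ge_ereal_sup => _ [f [bf hf] <-].
rewrite (_ : f = fun=> 0) ?L_cst//; apply/funext => x.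
by apply/eqP; rewrite eq_le andbC; have := hf x; rewrite indic0.
Qed.

(** A Dini argument: on the compact K, f lies below a finite sum of bumps plus e / 2. Off K the
    difference is at least -1 because f <= 1, and tightness charges another e / 2 for it. *)
Let rho_sigma_subadd (F : nat -> set T) : (forall i, open (F i)) ->
  (rho (\bigcup_i F i) <= \sum_(i <oo) rho (F i))%E.
Proof.
move=> oF; apply: ge_ereal_sup => _ [f [bf hf] <-].
apply/lee_addgt0Pr => e e0; have e20 : 0 < e / 2 by rewrite divr_gt0.
have [K cK hK] := Ltight e20.
pose g n x := \sum_(i < n) bump (F i) n x.
have bg n : bcf (g n) by apply: bcf_sum => i; exact: bcf_bump.
have gmono N n x : (N <= n)%N -> g N x <= g n x.
  move=> Nn; rewrite /g -!(big_mkord predT (fun i => bump (F i) _ x)).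
  rewrite [leRHS](@big_cat_nat _ _ _ N)//= ler_wpDr//.
    by apply: sumr_ge0 => i _; exact: bump_ge0.
  by apply: ler_sum => i _; exact: bump_homo.
have oV n : open [set x | f x < g n x + e / 2].
  have [ch _] := bcfB bf (bcfD (bg n) (bcf_cst (e / 2))).
  rewrite (_ : mkset _ = (fun x => f x - (g n x + e / 2)) @^-1` [set r | r < 0]).
    by apply: open_comp => [x _|]; [exact: ch|exact: open_lt].
  by apply/seteqP; split => x /=; rewrite subr_lt0.
have : \forall n \near \oo, K `<=` (fun x => f x < g n x + e / 2).
  have/compact_near_coveringP := cK => /(_ nat \oo); apply => x Kx.
  have [N hN] : exists N, f x < g N x + e / 2.
    have [[i _ Fix]|nF] := pselect ((\bigcup_i F i) x).
      have [k0 hk0] := bump_in (oF i) Fix.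
      pose N := maxn k0 i.+1; exists N.
      have /andP[_ fx1] := hf x; rewrite (@le_lt_trans _ _ 1)//.
        by rewrite (le_trans fx1)// indicE; case: (_ \in _).
      rewrite -[ltLHS]addr0 ler_ltD// /g.
      have iN : (i < N)%N by rewrite /N leq_max leqnn orbT.
      rewrite (bigD1 (Ordinal iN))//= hk0 ?leq_maxl// lerDl.
      by apply: sumr_ge0 => j _; exact: bump_ge0.
    exists 0%N; have /andP[_ fx1] := hf x.
    rewrite (le_lt_trans fx1)// indicE memNset// /g big_ord0 add0r//.
  near=> y n => /=; apply: (@lt_le_trans _ _ (g N y + e / 2)).
    near: y; exact: open_nbhs_nbhs (conj (oV N) hN).
  by rewrite lerD2r; apply: gmono; near: n; exact: nbhs_infty_ge.
move=> [n _ /(_ n (leqnn n)) hn].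
have bh : bcf (fun x => g n x + e / 2 - f x).
  by apply: bcfB => //; apply: bcfD => //; exact: bcf_cst.
have g0 x : 0 <= g n x by apply: sumr_ge0 => i _; exact: bump_ge0.
have : - (e / 2) <= L (fun x => g n x + e / 2 - f x).
  apply: hK => // x; first by move=> /hn /ltW; rewrite subr_ge0.
  have /andP[_ fx1] := hf x.
  have : f x <= 1 by rewrite (le_trans fx1)// indicE; case: (_ \in _).
  by have := g0 x; move: e20; lra.
rewrite L_B//; last by apply: bcfD => //; exact: bcf_cst.
rewrite LD ?L_cst//; last exact: bcf_cst.
rewrite L_sum; last by move=> i; exact: bcf_bump.
move=> h.
apply: (@le_trans _ _ (\sum_(i < n) L (bump (F i) n) + e)%:E).
  by rewrite lee_fin; move: h; lra.
rewrite EFinD leeD2r//.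
apply: le_trans (nneseries_lim_ge n _); last by move=> *; exact: rho_ge0.
rewrite big_mkord -sumEFin; apply: lee_sum => i _; apply: rho_ub; split.
  exact: bcf_bump.
by move=> x; rewrite bump_ge0 bump_le_indic.
Unshelve. all: by end_near. Qed.

Let mus (A : set T) : \bar R := ereal_inf [set rho U | U in [set U | open U /\ A `<=` U]].

Let mus_lb A U : open U -> A `<=` U -> (mus A <= rho U)%E.
Proof. by move=> oU AU; apply: ereal_inf_lbound; exists U. Qed.

Let mus_ge0 A : (0 <= mus A)%E.
Proof. by apply: le_ereal_inf_tmp => _ [U _ <-]; exact: rho_ge0. Qed.

Let mus_open U : open U -> mus U = rho U.
Proof.
move=> oU; apply/eqP; rewrite eq_le mus_lb//=.
by apply: le_ereal_inf_tmp => _ [V [oV UV] <-]; exact: rho_mono.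
Qed.

Let mus0 : mus set0 = 0%E.
Proof. by rewrite mus_open ?rho0//; exact: open0. Qed.

Let mus_mono : {homo mus : A B / A `<=` B >-> (A <= B)%E}.
Proof.
move=> A B AB; apply: le_ereal_inf_tmp => _ [V [oV BV] <-].
by apply: mus_lb => //; exact: subset_trans BV.
Qed.

Let mus_fin A : mus A \is a fin_num.
Proof.
rewrite ge0_fin_numE// (@le_lt_trans _ _ 1%E) ?ltry//.
by rewrite -rhoT; apply: mus_lb => //; exact: openT.
Qed.

Let mus_adh A e : 0 < e -> exists U, [/\ open U, A `<=` U & (rho U <= mus A + e%:E)%E].
Proof.
move=> e0; have [_ [U [oU AU] <-] h] := lb_ereal_inf_adherent e0 (mus_fin A).
by exists U; split => //; exact: ltW.
Qed.

Let mus_sigma_subadd : sigma_subadditive mus.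
Proof.
move=> A; apply/lee_addgt0Pr => e e0.
have e2 n : 0 < e / (2 ^ n.+1)%:R by rewrite divr_gt0// ltr0n expn_gt0.
have [U hU] := choice (fun n => mus_adh (A n) (e2 n)).
apply: le_trans (epsilon_trick _ _ (ltW e0)); last by move=> n; exact: mus_ge0.
apply: (@le_trans _ _ (\sum_(i <oo) rho (U i))%E).
  apply: le_trans (rho_sigma_subadd _); last by move=> i; have [] := hU i.
  apply: mus_lb; first by apply: bigcup_open => i _; have [] := hU i.
  by apply: subset_bigcup => i _; have [] := hU i.
apply: lee_lim.
- by apply: is_cvg_nneseries => n *; exact: rho_ge0.
- by apply: is_cvg_nneseries => n *; rewrite adde_ge0 ?mus_ge0// lee_fin ltW.
- by near=> n; apply: lee_sum => i _; have [] := hU i.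
Unshelve. all: by end_near. Qed.

HB.instance Definition _ := isOuterMeasure.Build R T mus mus0 mus_ge0 mus_mono mus_sigma_subadd.

(** Take f below V and U. Since f vanishes off U, the open set V' where f < e inside V still
    contains the part of A outside U. For g below V' the sum f + g is at most 1 + e on V, so L f + L
    g <= (1 + e) rho V. *)
Let open_carath U : open U -> caratheodory_measurable mus U.
Proof.
move=> oU; apply: le_caratheodory_measurable => A.
apply: le_ereal_inf_tmp => _ [V [oV AV] <-].
apply: (@le_trans _ _ (rho (V `&` U) + mus (A `&` ~` U))%E).
  by rewrite leeD2r//; apply: mus_lb; [exact: openI|exact: setSI].
rewrite -leeBrDr//; apply: ge_ereal_sup => _ [f [bf hf] <-].
rewrite leeBrDr//; apply/lee_addgt0Pr => e e0.
pose V' := V `&` [set x | f x < e].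
have oV' : open V'.
  apply: openI => //; rewrite (_ : mkset _ = f @^-1` [set r | r < e])//.
  by apply: open_comp => [x _|]; [case: bf => + _; apply|exact: open_lt].
have f0 x : ~ U x -> f x = 0.
  move=> nUx; have := hf x; rewrite indicE memNset; last by case.
  by move=> h; apply/eqP; rewrite eq_le andbC.
have fV x : ~ V x -> f x = 0.
  move=> nUx; have := hf x; rewrite indicE memNset; last by case.
  by move=> h; apply/eqP; rewrite eq_le andbC.
apply: (@le_trans _ _ ((L f)%:E + rho V')%E).
  rewrite leeD2l//; apply: mus_lb => // x [Ax nUx]; split; first exact: AV.
  by rewrite /= f0.
rewrite addeC -leeBrDr//; apply: ge_ereal_sup => _ [g [bg hg] <-].
rewrite leeBrDr// -EFinD addrC -LD//.
have bh : bcf (fun x => f x + g x) by exact: bcfD.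
have e1 : 0 < 1 + e by rewrite addr_gt0.
have h : below V (fun x => (1 + e)^-1 * (f x + g x)).
  split; first exact: bcfZ.
  move=> x; have /andP[f0' f1] := hf x; have /andP[g0 g1] := hg x.
  rewrite mulr_ge0 ?invr_ge0 ?addr_ge0// ?(ltW e0)//=.
  rewrite mulrC ler_pdivrMr//.
  have [Vx|nVx] := pselect (V x); last first.
    rewrite fV//; move: g1; rewrite !indicE !memNset// ?mul0r ?add0r//.
    by case.
  rewrite [\1_V x]indicE mem_set// mul1r.
  have f1' : f x <= 1 by rewrite (le_trans f1)// indicE; case: (_ \in _).
  have [fe|fe] := ltP (f x) e.
    have : g x <= 1 by rewrite (le_trans g1)// indicE; case: (_ \in _).
    by move: fe; lra.
  have : g x <= 0 by rewrite (le_trans g1)// indicE memNset//= => -[_ /=]; rewrite ltNge fe.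
  by move: e0 f1'; lra.
have /rho_ub := h; rewrite LZ//.
have fV1 : rho V \is a fin_num by rewrite -mus_open.
have := rho_le1 V; rewrite -(fineK fV1) -EFinD !lee_fin => r1.
rewrite mulrC ler_pdivrMr// => h1; apply: (le_trans h1).
by rewrite mulrDr mulr1 lerD2l ler_piMl// ltW.
Qed.

Let borel_carath (A : set T) : <<s @open T >> A -> caratheodory_measurable mus A.
Proof.
apply: (@smallest_sub _ (sigma_algebra setT) (@open T) (caratheodory_measurable mus)).
  split; first exact: caratheodory_measurable_set0.
    by move=> B mB; rewrite setTD; exact: caratheodory_measurable_setC.
  by move=> F mF; exact: caratheodory_measurable_bigcup.
by move=> U; exact: open_carath.
Qed.

Let musb : set (borel T) -> \bar R := mus.

Let musb_sigma_additive : semi_sigma_additive musb.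
Proof.
move=> F mF tF mUF; apply: caratheodory_measure_sigma_additive => //.
  by move=> i; exact: (borel_carath (mF i)).
exact: (borel_carath mUF).
Qed.

Let musbT : musb setT = 1%E.
Proof. by rewrite /musb mus_open//; exact: openT. Qed.

HB.instance Definition _ := isMeasure.Build _ _ _ musb mus0 mus_ge0 musb_sigma_additive.

HB.instance Definition _ := Measure_isProbability.Build _ _ _ musb musbT.

Let P : probability (borel T) R := musb.

(** The slice of y between the levels k and k + 1. *)
Let clamp (y : R) k : R := Num.max 0 (Num.min 1 (y - k%:R)).

Let sum_clamp y n : 0 <= y -> \sum_(k < n) clamp y k = Num.min y n%:R.
Proof.
move=> y0; elim: n => [|n ih]; first by rewrite big_ord0 min_r.
rewrite big_ord_recr/= ih /clamp -natr1.
by rewrite /Num.max /Num.min; repeat case: ifPn; rewrite -?leNgt; lra.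
Qed.

(** Cut (N + 1) f into N + 1 slices. Slice k + 1 is supported in the open set where (N + 1) f > k +
    1, and slice k equals 1 there, so L of the former is at most the integral of the latter. After
    this shift only L of slice 0 is left over, which costs at most 1 / (N + 1). *)
Let int01 f : bcf f -> (forall x, 0 <= f x <= 1) -> L f <= \int[P]_x f x.
Proof.
move=> bf f01; apply/ler_addgt0Pr => e e0.
have [N Ne] : exists N : nat, N.+1%:R^-1 < e.
  by have [n] := ltr_add_invr e0; rewrite add0r; exists n.
pose c (k : nat) x := clamp (N.+1%:R * f x) k.
have bc k : bcf (c k).
  apply: bcf_max; first exact: bcf_cst.
  by apply: bcf_min; [exact: bcf_cst|apply: bcfB; [exact: bcfZ|exact: bcf_cst]].
have fE x : f x = N.+1%:R^-1 * \sum_(k < N.+1) c k x.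
  have /andP[f0 f1] := f01 x.
  rewrite sum_clamp ?mulr_ge0// min_l; first by rewrite mulKf.
  by rewrite -[leRHS]mulr1 ler_wpM2l.
have c01 k x : 0 <= c k x <= 1.
  by rewrite /c /clamp le_max lexx/= ge_max ler01 ge_min lexx.
have Lc k : L (c k.+1) <= \int[P]_x c k x.
  rewrite -lee_fin fineK//; last first.
    exact: (integrable_fin_num measurableT (bcf_integrable P (bc k))).
  pose V := [set x | k.+1%:R < N.+1%:R * f x].
  have oV : open V.
    rewrite (_ : V = (fun x => N.+1%:R * f x) @^-1` [set r | k.+1%:R < r])//.
    apply: open_comp => [x _|]; last exact: open_gt.
    by have [+ _] := bcfZ N.+1%:R bf; apply.
  have := @rho_ub V (c k.+1); rewrite -mus_open// => /(_ _)/le_trans; apply.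
    split => // x; have /andP[-> c1] := c01 k.+1 x; rewrite indicE.
    have [xV|xV] := boolP (x \in V); first by [].
    have h : N.+1%:R * f x <= k.+1%:R.
      by rewrite leNgt; apply/negP => h; move/negP: xV; apply; rewrite inE.
    by rewrite /= /c /clamp ge_max lexx/= ge_min subr_le0 h orbT.
  have mV : measurable (V : set (borel T)) by exact: open_measurable_borel.
  rewrite -[mus V]/(P V) -(setIT V) -integral_indic//; apply: ge0_le_integral => //.
  - by apply/measurable_EFinP; exact: measurable_indic.
  - by apply/measurable_EFinP; apply: cont_measurable_borel; case: (bc k).
  - move=> x _; rewrite lee_fin indicE; have [xV|_] := boolP (x \in V); last first.
      by have /andP[] := c01 k x.
    have /= : V x by rewrite inE in xV.
    rewrite /V /= /c /clamp -natr1 => h.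
    by rewrite min_l ?max_r// lerBrDr addrC ltW// -natr1.
rewrite (funext fE) LZ; last exact: bcf_sum.
rewrite L_sum// RintegralZl//; last exact: (bcf_integrable P (bcf_sum _)).
rewrite -(ler_pM2l (_ : 0 < N.+1%:R)) ?ltr0n// mulrDr !mulVKf//.
rewrite bcf_Rintegral_sum// big_ord_recl [in leRHS]big_ord_recr/=.
have Lc0 : L (c 0%N) <= N.+1%:R * e.
  apply: (@le_trans _ _ 1).
    rewrite -(L_cst 1); apply: L_le => // [|x]; first exact: bcf_cst.
    by have /andP[] := c01 0%N x.
  by rewrite -ler_pdivrMl// mulr1 ltW.
rewrite [leRHS]addrC; apply: lerD => //.
apply: ler_wpDr; last by apply: ler_sum => i _; exact: Lc.
by apply: Rintegral_ge0 => x _; have /andP[] := c01 N x.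
Qed.

Let int01E f : bcf f -> (forall x, 0 <= f x <= 1) -> \int[P]_x f x = L f.
Proof.
move=> bf f01; apply/eqP; rewrite eq_le int01// andbT.
(* The reverse inequality is [int01] for 1 - f. *)
have bf' := bcfB (bcf_cst 1) bf.
have := int01 bf' _; rewrite L_B//; last exact: bcf_cst.
rewrite RintegralB//; [|exact: (bcf_integrable _ (bcf_cst _))|exact: bcf_integrable].
rewrite Rintegral_prob_cst L_cst => h.
by have := h _; move=> /(_ _)/wrap[x|]; [have := f01 x|]; lra.
Qed.

Lemma riesz_probability : exists mu : probability (borel T) R,
  forall f, bcf f -> \int[mu]_x f x = L f.
Proof.
exists P => f bf; have [cf [M hM]] := bf.
pose K := 1 + `|M|; have K0 : 0 < K by rewrite ltr_pwDl.
(* Affine rescaling of f into [0, 1]. *)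
pose g x := (2 * K)^-1 * (f x + K).
have bfK := bcfD bf (bcf_cst K).
have bg : bcf g by apply: bcfZ.
have : \int[P]_x g x = L g.
  apply: int01E => // x.
  have : `|f x| <= K by rewrite (le_trans (hM x))// (le_trans (ler_norm M))// lerDr.
  rewrite ler_norml => /andP[h1 h2].
  rewrite /g mulr_ge0 ?invr_ge0 ?mulr_ge0 ?(ltW K0)//=; last by move: h1; lra.
  by rewrite mulrC ler_pdivrMr ?mulr_gt0//; move: h2; lra.
rewrite /g LZ// RintegralZl//; last exact: bcf_integrable.
rewrite LD// ?L_cst; last exact: bcf_cst.
rewrite RintegralD//; [|exact: bcf_integrable|exact: (bcf_integrable _ (bcf_cst _))].
rewrite Rintegral_prob_cst.
move=> /(mulfI (_ : (2 * K)^-1 != 0)) h; apply: (addIr K); apply: h.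
by rewrite invr_neq0// mulf_neq0// gt_eqF.
Qed.

End riesz.

(** * The weak topology *)

Section pushprob.
Context {R : realType} d d' {S : measurableType d} {T : measurableType d'}.
Variables (P : probability S R) (f : S -> T).

(** The measurability proof is an argument so that the probability structure can be attached to the
    term. *)
Definition pushprob (mf : measurable_fun setT f) : set T -> \bar R := pushforward P f.

Hypothesis mf : measurable_fun setT f.

Let pushprob0 : pushprob mf set0 = 0%E.
Proof. by rewrite /pushprob /pushforward preimage_set0 measure0. Qed.

Let pushprob_ge0 A : (0 <= pushprob mf A)%E.
Proof. by rewrite /pushprob /pushforward. Qed.

Let pushprob_sigma_additive : semi_sigma_additive (pushprob mf).
Proof. exact: (@measure_semi_sigma_additive _ _ _ (pushforward P f)). Qed.

HB.instance Definition _ := isMeasure.Build _ _ _ (pushprob mf) pushprob0 pushprob_ge0 pushprob_sigma_additive.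

Let pushprobT : pushprob mf setT = 1%E.
Proof. by rewrite /pushprob /pushforward preimage_setT probability_setT. Qed.

HB.instance Definition _ := Measure_isProbability.Build _ _ _ (pushprob mf) pushprobT.

Lemma Rintegral_pushprob (g : T -> R) : measurable_fun setT g -> (exists K : R, forall y, `|g y| <= K) ->
  \int[pushprob mf]_y g y = \int[P]_x g (f x).
Proof.
move=> mg [K hK]; congr fine.
have igf : P.-integrable setT (EFin \o (g \o f)).
  by apply: bounded_integrable; [exact: measurableT_comp|exists K => x; exact: hK].
have mg' : measurable_fun setT (EFin \o g) by exact/measurable_EFinP.
have := @integral_pushforward _ _ _ _ R _ mf P setT (EFin \o g) mg' igf measurableT.
by rewrite preimage_setT => <-; apply: eq_measure_integral.
Qed.

End pushprob.

Section weak_topology.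
Context {R : realType} {W X : pseudoPMetricType R}.
Notation PMs := (PM W X).
Variables (bW : nat -> set W) (bX : nat -> set X).
Hypotheses (hbW : cbase bW) (hbX : cbase bX).

Lemma open_measurable_WX (U : set (W * X)) : open U -> measurable (U : set (WX W X)).
Proof. exact: open_measurable_prod hbW hbX. Qed.

Lemma cont_measurable_WX (f : W * X -> R) : continuous f ->
  measurable_fun [set: WX W X] f.
Proof.
move=> cf; apply: open_measurable_fun => U oU; apply: open_measurable_WX.
by apply: open_comp => // x _; exact: cf.
Qed.

Lemma bcont_integrable (m : PMs) (f : W * X -> R) : bcont f ->
  m.-integrable [set: WX W X] (EFin \o f).
Proof. by move=> [cf bf]; apply: bounded_integrable => //; exact: cont_measurable_WX. Qed.

Definition rint (m : PMs) (f : W * X -> R) : R := \int[m]_p f p.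

Lemma integE (m : PMs) f : bcont f -> integ m f = (rint m f)%:E.
Proof.
by move=> bf; rewrite /rint /Rintegral fineK//; exact: (integrable_fin_num measurableT (bcont_integrable m bf)).
Qed.

Lemma wnbhdE (m : PMs) k (fs : 'I_k -> W * X -> R) e : (forall i, bcont (fs i)) ->
  wnbhd m fs e = [set m' | forall i, `|rint m' (fs i) - rint m (fs i)| < e].
Proof.
move=> bf; apply/seteqP; split => m' h i; have := h i; by rewrite !integE// -EFinB lte_fin.
Qed.

Lemma weak_open_wnbhd (m : PMs) k (fs : 'I_k -> W * X -> R) e :
  (forall i, bcont (fs i)) -> weak_open (wnbhd m fs e).
Proof.
move=> bf m'; rewrite wnbhdE// => h.
exists k, fs; split => //.
pose dl := \big[Num.min/1]_(i < k) (e - `|rint m' (fs i) - rint m (fs i)|).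
exists dl.
  apply: (big_ind (fun x => 0 < x)) => // [x y x0 y0|i _]; first by rewrite lt_min x0.
  by rewrite subr_gt0.
rewrite wnbhdE// => m'' h'' i.
have h1 := h'' i.
have : dl <= e - `|rint m' (fs i) - rint m (fs i)| by exact: bigmin_le.
have := ler_distD (rint m' (fs i)) (rint m'' (fs i)) (rint m (fs i)).
by move: h1; lra.
Qed.

Lemma weak_openT : weak_open [set: PMs].
Proof.
by move=> m _; exists 0%N, (fun _ => cst 0); split=> [[]//|]; exists 1.
Qed.

Lemma weak_open_bigcup I (D : set I) (U : I -> set PMs) :
  (forall i, D i -> weak_open (U i)) -> weak_open (\bigcup_(i in D) U i).
Proof.
move=> oU m [i Di Uim]; have [k [fs [bf [e e0 h]]]] := oU i Di m Uim.
exists k, fs; split => //; exists e => // m' /h Um'; by exists i.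
Qed.

Lemma weak_openI (U V : set PMs) : weak_open U -> weak_open V -> weak_open (U `&` V).
Proof.
move=> oU oV m [Um Vm].
have [k [fs [bf [e e0 h]]]] := oU m Um.
have [l [gs [bg [d d0 h']]]] := oV m Vm.
exists (k + l)%N, (fun i => match fintype.split i with inl a => fs a | inr b => gs b end).
split; first by move=> i; case: fintype.split.
exists (Num.min e d); first by rewrite lt_min e0 d0.
move=> m' hm'; split; [apply: h => i|apply: h' => i].
  have := hm' (lshift l i); rewrite (unsplitK (inl i)) => /lt_le_trans; apply.
  by rewrite lee_fin ge_min lexx.
have := hm' (rshift k i); rewrite (unsplitK (inr i)) => /lt_le_trans; apply.
by rewrite lee_fin ge_min lexx orbT.
Qed.

Lemma weak_cont_rint f : bcont f -> weak_cont (fun m : PMs => rint m f).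
Proof.
move=> bf m e e0; exists 1%N, (fun=> f); split => //; exists e => // m'.
by rewrite wnbhdE// => /(_ ord0).
Qed.

Lemma weak_cont_open (G : PMs -> R) (U : set R) : weak_cont G -> open U -> weak_open (G @^-1` U).
Proof.
move=> cG oU m /= Um.
have /nbhs_ballP[e /= e0 eU] : nbhs (G m) U by exact: open_nbhs_nbhs.
have [k [fs [bf [d d0 h]]]] := cG m e e0.
exists k, fs; split => //; exists d => // m' /h h'; apply: eU.
by rewrite /ball/= distrC.
Qed.

Lemma weak_open_rint_gt f (t : R) : bcont f -> weak_open [set m : PMs | t < rint m f].
Proof. by move=> /weak_cont_rint /(@weak_cont_open _ [set r | t < r]); apply; exact: open_gt. Qed.

Lemma rintD (m : PMs) f g : bcont f -> bcont g -> rint m (fun p => f p + g p) = rint m f + rint m g.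
Proof. by move=> bf bg; rewrite /rint RintegralD//; exact: bcont_integrable. Qed.

Lemma rintZ (m : PMs) c f : bcont f -> rint m (fun p => c * f p) = c * rint m f.
Proof. by move=> bf; rewrite /rint RintegralZl//; exact: bcont_integrable. Qed.

Lemma rint_cst (m : PMs) (c : R) : rint m (fun=> c) = c.
Proof. exact: Rintegral_prob_cst. Qed.

Lemma le_rint (m : PMs) f g : bcont f -> bcont g -> (forall p, f p <= g p) -> rint m f <= rint m g.
Proof. by move=> bf bg fg; apply: le_Rintegral => //; exact: bcont_integrable. Qed.

Lemma normr_rint (m : PMs) f (M : R) : bcont f -> (forall p, `|f p| <= M) -> `|rint m f| <= M.
Proof.
move=> bf hM; rewrite ler_norml -(rint_cst m (- M)) -{2}(rint_cst m M).
by apply/andP; split; apply: le_rint => //; (try exact: bcf_cst) => p;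
  have := hM p; rewrite ler_norml => /andP[].
Qed.

Lemma ultra_lim (U : set_system PMs) (phi : PMs -> R) (M : R) : UltraFilter U ->
  (forall m, `|phi m| <= M) -> exists l : R, phi @ U --> l.
Proof.
move=> UU hM; have PU : ProperFilter U by exact: ultra_proper.
have : (phi @ U) `[- M, M]%classic.
  by apply: (@filterE _ U) => m /=; rewrite in_itv/= -ler_norml; exact: hM.
move=> /(@segment_compact R (- M) M (phi @ U) _)[l [_ cl]]; exists l.
move=> B nB; have [//|nUB] := in_ultra_setVsetC (phi @^-1` B) UU.
have [r [nBr Br]] : (~` B) `&` B !=set0 by apply: cl.
by [].
Qed.

(* Tightness stated on bounded continuous functions rather than on measures of complements
   of compacts, so that it is inherited by pointwise limits of the functionals [rint m]. *)
Definition tight_set (T : set PMs) := forall e : R, 0 < e -> exists2 K : set (W * X), compact K &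
  forall m f, T m -> bcont f -> (forall p, K p -> 0 <= f p) -> (forall p, -1 <= f p) -> - e <= rint m f.

(** Prokhorov's theorem for ultrafilters: the integrals of a bounded continuous function are
    bounded, hence converge along U; the limits form a positive linear functional that inherits the
    bound of [tight_set], and Riesz representation turns it into a measure. *)
Lemma tight_ultra_cvg (T : set PMs) (U : set_system PMs) : tight_set T -> UltraFilter U -> U T ->
  exists m : PMs, forall V, weak_open V -> V m -> U V.
Proof.
move=> tT UU UT; have PU : ProperFilter U by exact: ultra_proper.
(* [choice] needs a value for every f; off the bounded continuous functions it is arbitrary. *)
have hL : forall f : W * X -> R, exists l : R, bcont f -> (fun m => rint m f) @ U --> l.
  move=> f; have [bf|nbf] := pselect (bcont f); last by exists 0.
  have [_ [M hM]] := bf.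
  have [l hl] := @ultra_lim U (fun m => rint m f) M UU (fun m => normr_rint m bf hM).
  by exists l.
have [L cL] := choice hL.
have Lu f l : bcont f -> (fun m => rint m f) @ U --> l -> L f = l.
  by move=> bf cl; apply: (cvg_unique _ (cL f bf) cl).
have LD f g : bcf f -> bcf g -> L (fun p => f p + g p) = L f + L g.
  move=> bf bg; apply: Lu; first exact: bcfD.
  under eq_fun do rewrite rintD//.
  by apply: cvgD; exact: cL.
have LZ c f : bcf f -> L (fun p => c * f p) = c * L f.
  move=> bf; apply: Lu; first exact: bcfZ.
  under eq_fun do rewrite rintZ//.
  by apply: cvgM; [exact: cvg_cst|exact: cL].
have L1 : L (fun=> 1) = 1.
  apply: Lu; first exact: bcf_cst.
  under eq_fun do rewrite rint_cst.
  exact: cvg_cst.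
have Ltight e : 0 < e -> exists2 K : set (W * X), compact K & forall f, bcf f ->
    (forall p, K p -> 0 <= f p) -> (forall p, -1 <= f p) -> - e <= L f.
  move=> e0; have [K cK hK] := tT e e0; exists K => // f bf f0 f1.
  apply: (@closed_cvg _ _ U _ (rint ^~ f) [set r | - e <= r] (@closed_ge _ _) _ _ (cL f bf)).
  by apply: filterS UT => m Tm; exact: hK.
have [mu hmu] := @riesz_probability R (pprod W X) L LD LZ L1 Ltight.
have mid := @pprod_id_measurable R W X.
pose m : PMs := pushprob mu mid.
have hm f : bcont f -> rint m f = L f.
  move=> bf; rewrite -hmu// /rint Rintegral_pushprob//; last by have [] := bf.
  by apply: cont_measurable_WX; case: bf.
exists m => V oV Vm.
have [k [fs [bf [e e0 h]]]] := oV m Vm.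
apply: filterS h _; rewrite wnbhdE//.
apply: filter_forall => i.
have /cvgrPdist_lt/(_ e e0) := cL _ (bf i).
by apply: filterS => m' /=; rewrite hm// distrC.
Qed.

(** G has to cover all measures, not only T, because T need not be closed and the limit of an
    ultrafilter on T may lie outside it. If no finite subfamily covered T, the sets left over would
    generate a proper filter, and the limit of an ultrafilter above it would lie in a member of G
    that the ultrafilter avoids. *)
Lemma tight_cover (T : set PMs) (G : set (set PMs)) : tight_set T ->
  (forall U, G U -> weak_open U) -> (forall m, exists2 U, G U & U m) ->
  exists k (g : 'I_k -> set PMs), (forall j, G (g j)) /\ T `<=` \bigcup_j g j.
Proof.
move=> tT oG cG; apply: contrapT => ncov.
pose FF : set_system PMs := [set A | exists k (g : 'I_k -> set PMs),
  (forall j, G (g j)) /\ T `\` \bigcup_j g j `<=` A].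
have PFF : ProperFilter FF.
  split.
    move=> [k [g [Gg h]]]; apply: ncov; exists k, g; split => // m Tm.
    by apply: contrapT => nm; apply: (h m).
  split.
  - by exists 0%N, (fun=> set0); split => [[]|].
  - move=> A B [k [g [Gg h]]] [l [g' [Gg' h']]].
    exists (k + l)%N, (fun i => match fintype.split i with inl a => g a | inr b => g' b end).
    split; first by move=> i; case: fintype.split.
    move=> m [Tm nm]; split; [apply: h|apply: h']; split => // -[i _ gim]; apply: nm.
      by exists (lshift l i) => //; rewrite (unsplitK (inl i)).
    by exists (rshift k i) => //; rewrite (unsplitK (inr i)).
  - move=> A B AB [k [g [Gg h]]]; exists k, g; split => //; exact: subset_trans AB.
have [U [UU FU]] := ultraFilterLemma PFF; have PU : ProperFilter U by exact: ultra_proper.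
have UT : U T.
  by apply: FU; exists 0%N, (fun=> set0); split => [[]//|m []].
have [m hm] := tight_ultra_cvg tT UU UT.
have [V GV Vm] := cG m.
have UV : U V by apply: hm => //; exact: oG.
have UnV : U (T `\` V).
  apply: FU; exists 1%N, (fun=> V); split => // m' [Tm' nV]; split => // Vm'.
  by apply: nV; exists ord0.
have /filter_ex[m' [Vm' [_]]] : U (V `&` (T `\` V)) by exact: filterI.
exact.
Qed.

End weak_topology.

(** * Integrals of bounded functions and relative entropy *)

Section transfer.
Context {R : realType} d d' {S : measurableType d} {T : measurableType d'}.
Variables (mu : {measure set S -> \bar R}) (nu : {measure set T -> \bar R}).
Variables (V : S -> T) (Y : S -> R).
Hypotheses (mV : measurable_fun setT V) (mY : measurable_fun setT Y).
Hypothesis Y0 : forall x, 0 <= Y x.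
Hypothesis YV : forall B, measurable B ->
  (\int[mu]_x (Y x * \1_B (V x))%:E = nu B)%E.

Import HBNNSimple.
Local Open Scope ereal_scope.

(** Extends [YV] from indicators to nonnegative functions by simple approximation. It serves for
    densities, with V the identity, and for independence, with Y the product of the other
    factors. *)
Lemma integral_transfer (h : T -> R) : measurable_fun setT h -> (forall y, (0 <= h y)%R) ->
  \int[mu]_x (Y x * h (V x))%:E = \int[nu]_y (h y)%:E.
Proof.
move=> mh h0.
have mEh : measurable_fun setT (EFin \o h) by exact/measurable_EFinP.
pose h_ := nnsfun_approx measurableT mEh.
have cvgh y : (EFin \o h_ ^~ y) n @[n --> \oo] --> (h y)%:E.
  by apply: (@cvg_nnsfun_approx _ _ _ _ measurableT (EFin \o h) mEh) => // z _; rewrite lee_fin.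
have mh_ n : measurable_fun setT (fun x => (Y x * h_ n (V x))%:E).
  by apply/measurable_EFinP; apply: measurable_funM => //; apply: measurableT_comp.
have -> : \int[nu]_y (h y)%:E = limn (fun n => \int[nu]_y (h_ n y)%:E).
  rewrite -monotone_convergence//.
  - by apply: eq_integral => y _; apply/esym/cvg_lim => //; exact: cvgh.
  - by move=> n; exact/measurable_EFinP.
  - by move=> n y _; rewrite lee_fin.
  - by move=> y _ m n mn; rewrite lee_fin; exact/lefP/nd_nnsfun_approx.
have -> : \int[mu]_x (Y x * h (V x))%:E = limn (fun n => \int[mu]_x (Y x * h_ n (V x))%:E).
  rewrite -monotone_convergence//.
  - apply: eq_integral => x _; apply/esym/cvg_lim => //.
    under eq_fun do rewrite EFinM; rewrite EFinM.
    by apply: cvgeZl => //; exact: cvgh.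
  - by move=> n x _; rewrite lee_fin mulr_ge0.
  - move=> x _ m n mn; rewrite lee_fin ler_wpM2l//; exact/lefP/nd_nnsfun_approx.
congr (limn _); apply/funext => n.
transitivity (\sum_(k \in range (h_ n)) \int[mu]_x (Y x * (k * \1_(h_ n @^-1` [set k]) (V x)))%:E).
  rewrite -ge0_integral_fsum//; last 2 first.
  - move=> k; apply/measurable_EFinP; apply: measurable_funM => //.
    by apply: measurable_funM => //; apply: measurableT_comp.
  - by move=> k x _; rewrite EFinM; apply: mule_ge0; [rewrite lee_fin|rewrite EFinM nnfun_muleindic_ge0].
  apply: eq_integral => x _; under eq_fsbigr do rewrite EFinM.
  rewrite -ge0_mule_fsumr; last by move=> k; rewrite EFinM nnfun_muleindic_ge0.
  by rewrite fsumEFin// -fimfunE EFinM.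
transitivity (\sum_(k \in range (h_ n)) \int[nu]_y (k * \1_(h_ n @^-1` [set k]) y)%:E); last first.
  rewrite -ge0_integral_fsum//; last 2 first.
  - by move=> k; apply/measurable_EFinP; apply: measurable_funM.
  - by move=> k x _; rewrite EFinM nnfun_muleindic_ge0.
  by apply: eq_integral => x _; rewrite fsumEFin// -fimfunE.
apply: eq_fsbigr => k; rewrite inE => -[z _ <-].
have mk : measurable (h_ n @^-1` [set h_ n z]) by [].
under eq_integral do rewrite mulrCA EFinM.
have mYk : measurable_fun setT (fun x => (Y x * \1_(h_ n @^-1` [set h_ n z]) (V x))%:E).
  by apply/measurable_EFinP; apply: measurable_funM => //; apply: measurableT_comp.
have m1k : measurable_fun setT (fun x => (\1_(h_ n @^-1` [set h_ n z]) x)%:E : \bar R).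
  exact/measurable_EFinP.
have k0 : 0 <= (h_ n z)%:E by rewrite lee_fin.
rewrite ge0_integralZl//; last by move=> x _; rewrite lee_fin mulr_ge0.
rewrite YV//; under [RHS]eq_integral do rewrite EFinM.
by rewrite ge0_integralZl// integral_indic// setIT.
Qed.

End transfer.

Section bounded_measurable.
Context {R : realType} d {M : measurableType d}.
Implicit Types f g : M -> R.

Definition mbf f := measurable_fun setT f /\ exists K : R, forall x, `|f x| <= K.

Lemma mbf_cst c : mbf (fun=> c).
Proof. by split => //; exists `|c|. Qed.

Lemma mbf_indic A : measurable A -> mbf (\1_A).
Proof.
move=> mA; split; first exact: measurable_indic.
by exists 1 => x; rewrite indicE; case: (_ \in _); rewrite ?normr1 ?normr0.
Qed.

Lemma mbfD f g : mbf f -> mbf g -> mbf (fun x => f x + g x).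
Proof.
move=> [mf [K hK]] [mg [L hL]]; split; first exact: measurable_funD.
by exists (K + L) => x; rewrite (le_trans (ler_normD _ _))// lerD.
Qed.

Lemma mbfM f g : mbf f -> mbf g -> mbf (fun x => f x * g x).
Proof.
move=> [mf [K hK]] [mg [L hL]]; split; first exact: measurable_funM.
by exists (K * L) => x; rewrite normrM ler_pM.
Qed.

Lemma mbfZ c f : mbf f -> mbf (fun x => c * f x).
Proof. exact: mbfM (mbf_cst c). Qed.

Lemma mbfB f g : mbf f -> mbf g -> mbf (fun x => f x - g x).
Proof.
move=> [mf [K hK]] [mg [L hL]]; split; first exact: measurable_funB.
by exists (K + L) => x; rewrite (le_trans (ler_normB _ _))// lerD.
Qed.

Lemma mbf_norm f : mbf f -> mbf (fun x => `|f x|).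
Proof.
by move=> [mf [K hK]]; split; [exact: measurableT_comp|exists K => x; rewrite normr_id].
Qed.

Lemma mbf_exp f : mbf f -> mbf (fun x => expR (f x)).
Proof.
move=> [mf [K hK]]; split; first exact: measurableT_comp.
exists (expR K) => x; rewrite ger0_norm ?expR_ge0// ler_expR.
by rewrite (le_trans (ler_norm _)).
Qed.

Lemma mbf_sum n (f : 'I_n -> M -> R) : (forall i, mbf (f i)) -> mbf (fun x => \sum_(i < n) f i x).
Proof.
elim: n f => [|n ih] f mf; first by under eq_fun do rewrite big_ord0; exact: mbf_cst.
by under eq_fun do rewrite big_ord_recr/=; apply: mbfD => //; exact: ih.
Qed.

Variable mu : probability M R.

Lemma mbf_integrable f : mbf f -> mu.-integrable setT (EFin \o f).
Proof. by move=> [mf bf]; exact: bounded_integrable. Qed.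

Lemma mbf_integral f : mbf f -> (\int[mu]_x (f x)%:E)%E = (\int[mu]_x f x)%:E.
Proof.
by move=> mf; rewrite /Rintegral fineK//; exact: (integrable_fin_num measurableT (mbf_integrable mf)).
Qed.

Lemma mbf_intD f g : mbf f -> mbf g ->
  \int[mu]_x (f x + g x) = \int[mu]_x f x + \int[mu]_x g x.
Proof. by move=> mf mg; rewrite RintegralD//; exact: mbf_integrable. Qed.

Lemma mbf_intB f g : mbf f -> mbf g ->
  \int[mu]_x (f x - g x) = \int[mu]_x f x - \int[mu]_x g x.
Proof. by move=> mf mg; rewrite RintegralB//; exact: mbf_integrable. Qed.

Lemma mbf_intZ c f : mbf f -> \int[mu]_x (c * f x) = c * \int[mu]_x f x.
Proof. by move=> mf; rewrite RintegralZl//; exact: mbf_integrable. Qed.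

Lemma mbf_int_sum n (f : 'I_n -> M -> R) : (forall i, mbf (f i)) ->
  \int[mu]_x (\sum_(i < n) f i x) = \sum_(i < n) \int[mu]_x f i x.
Proof.
elim: n f => [|n ih] f mf.
  by under eq_Rintegral do rewrite big_ord0; rewrite Rintegral_prob_cst big_ord0.
under eq_Rintegral do rewrite big_ord_recr/=.
by rewrite mbf_intD//; [rewrite ih// big_ord_recr|exact: mbf_sum].
Qed.

Lemma mbf_int_le f g : mbf f -> mbf g -> (forall x, f x <= g x) ->
  \int[mu]_x f x <= \int[mu]_x g x.
Proof. by move=> mf mg fg; apply: le_Rintegral => //; exact: mbf_integrable. Qed.

Lemma mbf_int_indic A : measurable A -> \int[mu]_x (\1_A x) = fine (mu A).
Proof. by move=> mA; rewrite /Rintegral integral_indic// setIT. Qed.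

Lemma mbf_norm_int f : mbf f -> `|\int[mu]_x f x| <= \int[mu]_x `|f x|.
Proof. by move=> mf; apply: le_normr_Rintegral => //; exact: mbf_integrable. Qed.

Lemma bounded_cvg_int (f_ : nat -> M -> R) f (K : R) :
  (forall n, measurable_fun setT (f_ n)) -> (forall n x, `|f_ n x| <= K) ->
  measurable_fun setT f -> (forall x, f_ n x @[n --> \oo] --> f x) ->
  \int[mu]_x f_ n x @[n --> \oo] --> \int[mu]_x f x.
Proof.
move=> mf_ hK mf cf.
have hKf x : `|f x| <= K.
  apply: (@closed_cvg _ _ \oo _ (fun n => `|f_ n x|) [set r | r <= K] (@closed_le _ _)).
    by apply: nearW => n; exact: hK.
  by apply: cvg_norm; exact: cf.
have bf_ n : mbf (f_ n) by split => //; exists K.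
have bf : mbf f by split => //; exists K.
have [| | | | |_ _] := @dominated_convergence _ _ _ mu setT measurableT
    (fun k x => (f_ k x)%:E) (fun x => (f x)%:E) (cst K%:E).
- by move=> n; exact/measurable_EFinP.
- exact/measurable_EFinP.
- by apply: aeW => x _; apply: cvg_EFin; [exact: nearW|exact: cf].
- exact: (mbf_integrable (mbf_cst K)).
- by apply: aeW => x n _ /=; rewrite lee_fin.
move=> h.
have -> : (fun n => \int[mu]_x f_ n x) = fine \o (fun n => \int[mu]_x (f_ n x)%:E)%E by [].
apply/fine_cvg; rewrite -mbf_integral//.
Qed.

End bounded_measurable.

Lemma bcf_mbf (R : realType) (T : pseudoPMetricType R) (f : T -> R) :
  bcf f -> mbf (f : borel T -> R).
Proof. by move=> [cf bf]; split => //; exact: cont_measurable_borel. Qed.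

Lemma bcf_bigmax (R : realType) (T : topologicalType) n (f : 'I_n -> T -> R) :
  (forall i, bcf (f i)) -> bcf (fun x => \big[Num.max/0]_(i < n) f i x).
Proof.
elim: n f => [|n ih] f bf; first by under eq_fun do rewrite big_ord0; exact: bcf_cst.
under eq_fun do rewrite big_ord_recl.
by apply: bcf_max => //; exact: ih.
Qed.

(* The two measures are indexed by [bool] because one continuous function has to approximate
   an indicator in L1 for both of them simultaneously. *)
Section regularity.
Context {R : realType} {T : pseudoPMetricType R} (m : bool -> probability (borel T) R).
Notation B := (borel T).

Definition L1close (g h : T -> R) (e : R) := forall b, \int[m b]_(x in [set: B]) `|h x - g x| <= e.

(** The approximable sets contain the open sets and form a sigma-algebra, hence include all Borel
    sets. *)
Let good (A : set T) := measurable (A : set B) /\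
  forall e, 0 < e -> exists h, [/\ bcf h, forall x, 0 <= h x <= 1 & L1close \1_A h e].

Let indic01 (A : set T) x : 0 <= (\1_A x : R) <= 1.
Proof. by rewrite indicE; case: (_ \in _); rewrite lexx ler01. Qed.

Let good0 : good set0.
Proof.
split; first exact: measurable0.
move=> e e0; exists (fun=> 0); split; first exact: bcf_cst.
  by move=> x; rewrite lexx ler01.
move=> b; under eq_Rintegral do rewrite indic0 subrr normr0.
by rewrite Rintegral_prob_cst ltW.
Qed.

Let goodC A : good A -> good (~` A).
Proof.
move=> [mA gA]; split; first exact: measurableC.
move=> e e0; have [h [bh h01 hA]] := gA e e0; exists (fun x => 1 - h x); split.
- by apply: bcfB => //; exact: bcf_cst.
- by move=> x; have := h01 x; lra.
- move=> b; apply: le_trans (hA b); rewrite le_eqVlt; apply/orP; left; apply/eqP.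
  apply: eq_Rintegral => x _; rewrite !indicE in_setC -normrN; congr `|_|.
  by case: (_ \in _) => /=; lra.
Qed.

Let good_open U : open U -> good U.
Proof.
move=> oU; have mU : measurable (U : set B) by exact: open_measurable_borel.
split => // e e0.
have cvb b : \forall k \near \oo, \int[m b]_(x in [set: B]) `|bump U k x - \1_U x| <= e.
  have /cvgrPdist_le/(_ e e0) : \int[m b]_(x in [set: B]) `|bump U k x - \1_U x| @[k --> \oo]
      --> \int[m b]_(x in [set: B]) 0.
    apply: (@bounded_cvg_int _ _ B (m b) _ (fun=> 0) 1) => //.
    - move=> k; have [] // := mbf_norm (mbfB (bcf_mbf (bcf_bump U k)) (mbf_indic mU)).
    - move=> k x; rewrite normr_id ler_norml.
      by have := indic01 U x; have := bump_ge0 U k x; have := bump_le1 U k x; lra.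
    - move=> x; rewrite -(normr0 R) -[X in `|X|](subrr (\1_U x)).
      by apply: cvg_norm; apply: cvgB; [exact: bump_cvg|exact: cvg_cst].
  apply: filterS => k; rewrite Rintegral_prob_cst sub0r normrN; apply: le_trans.
  exact: ler_norm.
have : \forall k \near \oo, L1close \1_U (bump U k) e.
  have [cT cF] := (cvb true, cvb false).
  by near=> k; case; near: k.
case=> k _ /(_ k (leqnn k)) hk; exists (bump U k); split => //; first exact: bcf_bump.
by move=> x; rewrite bump_ge0 bump_le1.
Unshelve. all: by end_near. Qed.

Let good_bigcup (F : nat -> set T) : (forall n, good (F n)) -> good (\bigcup_n F n).
Proof.
move=> gF; have mF n : measurable (F n : set B) by have [] := gF n.
have mUF : measurable (\bigcup_n F n : set B) by exact: bigcup_measurable.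
split => // e e0.
pose G n : set B := \bigcup_(i < n) F i.
have mG n : measurable (G n) by apply: bigcup_measurable => i _.
have cvb b : \forall n \near \oo, \int[m b]_(x in [set: B]) `|\1_(G n) x - \1_(\bigcup_n F n) x| <= e / 2.
  have e20 : 0 < e / 2 by rewrite divr_gt0.
  have /cvgrPdist_le/(_ _ e20) : \int[m b]_(x in [set: B]) `|\1_(G n) x - \1_(\bigcup_n F n) x| @[n --> \oo]
      --> \int[m b]_(x in [set: B]) 0.
    apply: (@bounded_cvg_int _ _ B (m b) _ (fun=> 0) 1) => //.
    - by move=> k; have [] := mbf_norm (mbfB (mbf_indic (R := R) (mG k)) (mbf_indic mUF)).
    - move=> k x; rewrite normr_id ler_norml.
      by have := indic01 (G k) x; have := indic01 (\bigcup_n F n) x; lra.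
    - move=> x; apply: cvg_near_cst.
      have [[i _ Fix]|nF] := pselect ((\bigcup_n F n) x); last first.
        apply: nearW => n; rewrite !indicE !memNset ?subrr ?normr0// => -[j _ ?].
        by apply: nF; exists j.
      near=> n; rewrite !indicE !mem_set ?subrr ?normr0//; first by exists i.
      exists i => //=; near: n; exact: nbhs_infty_gt.
  apply: filterS => k; rewrite Rintegral_prob_cst sub0r normrN; apply: le_trans.
  exact: ler_norm.
have : \forall n \near \oo, L1close \1_(\bigcup_n F n) \1_(G n) (e / 2).
  have [cT cF] := (cvb true, cvb false).
  by near=> k; case; near: k.
case=> N _ /(_ N (leqnn N)) hN.
(* Half of e pays for truncating the union to N sets, the other half is shared by the N
   approximations; dividing by N + 1 also covers N = 0. *)
have eN : 0 < e / 2 / N.+1%:R by rewrite !divr_gt0.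
have [h hh] := choice (fun n => (gF n).2 _ eN).
pose H n x : R := \big[Num.max/0]_(i < n) h i x.
have bH n : bcf (H n).
  by apply: (bcf_bigmax (f := fun i : 'I_n => h i)) => i; have [] := hh i.
have H01 n x : 0 <= H n x <= 1.
  rewrite /H; elim/big_ind : _; first by rewrite lexx ler01.
    by move=> u v /andP[u0 u1] /andP[v0 v1]; rewrite le_max u0 ge_max u1 v1.
  by move=> i _; have [_ + _] := hh i; apply.
have GNS n x : `|H n x - \1_(G n) x| <= \sum_(i < n) `|h i x - \1_(F i) x|.
  have sge0 : 0 <= \sum_(i < n) `|h i x - \1_(F i) x| by apply: sumr_ge0.
  have [[i /= iN Fix]|nG] := pselect (G n x).
    rewrite [\1_(G n) x]indicE mem_set; last by exists i.
    rewrite (bigD1 (Ordinal iN))//= [\1_(F i) x]indicE mem_set//.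
    apply: ler_wpDr; first by apply: sumr_ge0.
    have hH : h i x <= H n x by exact: (@le_bigmax _ _ _ _ (fun i : 'I_n => h i x) (Ordinal iN)).
    have [_ /(_ x) h01 _] := hh i; have := H01 n x.
    have -> : true%:R = 1 :> R by [].
    by move=> H1; rewrite !ler0_norm; lra.
  rewrite [\1_(G n) x]indicE memNset// subr0 ger0_norm; last by have /andP[] := H01 n x.
  rewrite /H; apply: bigmax_le => // i _; rewrite (bigD1 i)//= indicE memNset.
    rewrite subr0 ler_wpDr ?ler_norm//; exact: sumr_ge0.
  by move=> Fix; apply: nG; exists i => /=.
exists (H N); split => // b.
have mbh i : mbf (fun x : B => `|h i x - \1_(F i) x|).
  by apply: mbf_norm; apply: mbfB; [apply: bcf_mbf; have [] := hh i|exact: mbf_indic].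
have mbs : mbf (fun x : B => \sum_(i < N) `|h i x - \1_(F i) x|) by apply: mbf_sum => i; exact: mbh.
have mbG : mbf (fun x : B => `|\1_(G N) x - \1_(\bigcup_n F n) x| : R).
  by apply: mbf_norm; apply: mbfB; exact: mbf_indic.
apply: (@le_trans _ _ (\int[m b]_(x in [set: B])
   (\sum_(i < N) `|h i x - \1_(F i) x| + `|\1_(G N) x - \1_(\bigcup_n F n) x|))).
  apply: mbf_int_le.
  - by apply: mbf_norm; apply: mbfB; [exact: bcf_mbf|exact: mbf_indic].
  - exact: mbfD.
  - by move=> x; rewrite (le_trans (ler_distD (\1_(G N) x) _ _))// lerD2r.
rewrite mbf_intD// [leRHS]splitr; apply: lerD; last exact: hN.
rewrite mbf_int_sum//; apply: (@le_trans _ _ (\sum_(i < N) (e / 2 / N.+1%:R))).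
  by apply: ler_sum => i _; have [_ _] := hh i; exact.
rewrite sumr_const card_ord -[leLHS]mulr_natr mulrAC ler_pdivrMr//.
by rewrite ler_wpM2l ?divr_ge0 ?(ltW e0)// ler_nat.
Unshelve. all: by end_near. Qed.

Lemma L1close_indic (A : set B) e : measurable A -> 0 < e ->
  exists h, [/\ bcf h, forall x, 0 <= h x <= 1 & L1close \1_A h e].
Proof.
move=> mA; suff [_] : good A by apply.
move: A mA; apply: (@smallest_sub _ (sigma_algebra setT) (@open T) good).
  split => //; first by move=> A; rewrite setTD; exact: goodC.
exact: good_open.
Qed.

(** The sum counts the naturals below y, so it is y rounded up. *)
Let step_approx n (y : R) : 0 <= y <= n%:R ->
  y <= \sum_(k < n) (k%:R < y)%R%:R <= y + 1.
Proof.
elim: n y => [|n ih] y; first by rewrite big_ord0; lra.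
rewrite big_ord_recr/= -natr1 => /andP[y0 yn].
have [ny|yn'] := ltP n%:R y; last first.
  by rewrite addr0; apply: ih; rewrite y0.
rewrite (eq_bigr (fun=> 1)); last first.
  by move=> i _; rewrite (lt_trans _ ny)// ltr_nat.
rewrite sumr_const card_ord /=; move: ny yn; lra.
Qed.

Lemma L1close_mbf01 (g : B -> R) e : measurable_fun setT g -> (forall x, 0 <= g x <= 1) -> 0 < e ->
  exists h, [/\ bcf h, forall x, 0 <= h x <= 1 & L1close g h e].
Proof.
move=> mg g01 e0; have e20 : 0 < e / 2 by rewrite divr_gt0.
have [N Ne] : exists N : nat, N.+1%:R^-1 < e / 2.
  by have [n] := ltr_add_invr e20; rewrite add0r; exists n.
pose A k : set B := [set x | k%:R < N.+1%:R * g x].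
have mA k : measurable (A k).
  have mNg : measurable_fun setT (fun x : B => N.+1%:R * g x) by exact: measurable_funM.
  have := mNg measurableT _ (measurable_itv `]k%:R, +oo[); rewrite setTI.
  by congr measurable; apply/seteqP; split => x; rewrite /A /= in_itv/= andbT.
have [h hh] := choice (fun k => L1close_indic (mA k) e20).
exists (fun x => N.+1%:R^-1 * \sum_(k < N.+1) h k x); split.
- by apply: bcfZ; apply: bcf_sum => k; have [] := hh k.
- move=> x; rewrite mulr_ge0 ?invr_ge0//=; last by apply: sumr_ge0 => k _; have [_ /(_ x)/andP[]] := hh k.
  rewrite mulrC ler_pdivrMr// mul1r.
  apply: (@le_trans _ _ (\sum_(k < N.+1) 1)); last by rewrite sumr_const card_ord.
  by apply: ler_sum => k _; have [_ /(_ x)/andP[]] := hh k.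
move=> b.
have bg : mbf g.
  by split => //; exists 1 => x; have := g01 x; rewrite ler_norml; lra.
have mbh k : mbf (fun x : B => `|h k x - \1_(A k) x|).
  by apply: mbf_norm; apply: mbfB; [apply: bcf_mbf; have [] := hh k|exact: mbf_indic].
have bs : mbf (fun x : B => N.+1%:R^-1 * \sum_(k < N.+1) `|h k x - \1_(A k) x|).
  by apply: mbfZ; apply: mbf_sum => k; exact: mbh.
apply: (@le_trans _ _ (\int[m b]_(x in [set: B])
   (N.+1%:R^-1 * \sum_(k < N.+1) `|h k x - \1_(A k) x| + N.+1%:R^-1))).
  apply: mbf_int_le.
  - apply: mbf_norm; apply: mbfB => //; apply: mbfZ; apply: mbf_sum => k.
    by apply: bcf_mbf; have [] := hh k.
  - by apply: mbfD => //; exact: mbf_cst.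
  move=> x; rewrite (le_trans (ler_distD (N.+1%:R^-1 * \sum_(k < N.+1) \1_(A k) x) _ _))// lerD//.
    rewrite -mulrBr normrM ger0_norm ?invr_ge0// ler_wpM2l ?invr_ge0//.
    by rewrite -sumrB; exact: ler_norm_sum.
  have : 0 <= N.+1%:R * g x <= N.+1%:R.
    by have /andP[g0 g1] := g01 x; rewrite mulr_ge0//= ler_piMr.
  move=> /step_approx.
  rewrite (_ : \sum_(k < N.+1) _ = \sum_(k < N.+1) \1_(A k) x); last first.
    apply: eq_bigr => k _; rewrite indicE.
    suff -> : (x \in A k) = (k%:R < N.+1%:R * g x) by [].
    by apply/idP/idP => [/set_mem//|h']; rewrite mem_set.
  move=> /andP[s1 s2].
  rewrite -[X in `|_ - X|](mulKf (_ : N.+1%:R != 0 :> R))// -mulrBr normrM.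
  rewrite ger0_norm ?invr_ge0// ler_piMr ?invr_ge0// ger0_norm ?subr_ge0//.
  by rewrite lerBlDr addrC.
rewrite mbf_intD//; last exact: mbf_cst.
rewrite Rintegral_prob_cst [leRHS]splitr; apply: lerD; last exact: ltW.
rewrite mbf_intZ; last by apply: mbf_sum => k; exact: mbh.
rewrite mbf_int_sum// mulrC ler_pdivrMr//.
apply: (@le_trans _ _ (\sum_(i < N.+1) (e / 2))).
  by apply: ler_sum => i _; have [_ _] := hh i; exact.
by rewrite sumr_const card_ord -[leLHS]mulr_natr.
Qed.

(** The approximant keeps the bound K because [DV_bcf_approx] needs its exponential bounded by that
    of K. *)
Lemma L1close_mbf (g : B -> R) (K e : R) : measurable_fun setT g -> (forall x, `|g x| <= K) -> 0 < e ->
  exists h, [/\ bcf h, forall x, `|h x| <= K & L1close g h e].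
Proof.
move=> mg gK e0.
have [K0|K0] := leP K 0.
  exists (fun=> 0); split; first exact: bcf_cst.
    by move=> x; rewrite normr0 (le_trans _ (gK point)).
  move=> b; rewrite (_ : Rintegral _ _ _ = \int[m b]_(x in [set: B]) 0).
    by rewrite Rintegral_prob_cst ltW.
  apply: eq_Rintegral => x _.
  by apply/eqP; rewrite eq_le normr_ge0 sub0r normrN (le_trans (gK x)).
pose g' x := (2 * K)^-1 * (g x + K).
have K20 : 0 < 2 * K by rewrite mulr_gt0.
have [|||h [bh h01 hc]] := @L1close_mbf01 g' (e / (2 * K)).
- by apply: measurable_funM => //; exact: measurable_funD.
- move=> x; rewrite /g'; have := gK x; rewrite ler_norml => /andP[g1 g2].
  rewrite mulr_ge0 ?invr_ge0 ?(ltW K20)//=; last by move: g1; lra.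
  by rewrite mulrC ler_pdivrMr//; move: g2; lra.
- by rewrite divr_gt0.
exists (fun x => 2 * K * h x - K); split.
- by apply: bcfB; [exact: bcfZ|exact: bcf_cst].
- move=> x; rewrite ler_norml; have /andP[h0 h1] := h01 x.
  have : 0 <= 2 * K * h x <= 2 * K by rewrite mulr_ge0 ?(ltW K20)//= ler_piMr// ltW.
  by lra.
move=> b; have := hc b; rewrite ler_pdivlMr// mulrC -mbf_intZ; last first.
  apply: mbf_norm; apply: mbfB; first exact: bcf_mbf.
  apply: mbfZ; apply: mbfD; last exact: mbf_cst.
  by split => //; exists K.
apply: le_trans; rewrite le_eqVlt; apply/orP; left; apply/eqP; apply: eq_Rintegral => x _.
rewrite -{2}(ger0_norm (ltW K20)) -normrM mulrBr /g' mulVKf ?gt_eqF//; congr `|_|; ring.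
Qed.

End regularity.

(** * The Donsker-Varadhan formula for relative entropy *)

Section entropy.
Context {R : realType} {T : pseudoPMetricType R}.
Notation B := (borel T).

(** Convex duality between a ln a - a and the exponential, read off from 1 + x <= exp x at x = g -
    ln a. At a = 0 the entropy term vanishes whatever the value of ln at 0. *)
Lemma young_entropy (a g : R) : 0 <= a -> a * g + a <= a * ln a + expR g.
Proof.
rewrite le_eqVlt => /predU1P[<-|a0]; first by rewrite !mul0r addr0 add0r expR_ge0.
have := expR_ge1Dx (g - ln a); rewrite expRD expRN lnK ?posrE//.
by rewrite ler_pdivlMr// => h; move: h; lra.
Qed.

Lemma xlnx_geN1 (a : R) : 0 <= a -> 0 <= a * ln a + 1.
Proof. by move=> a0; have := young_entropy 0 a0; rewrite expR0 mulr0 add0r; lra. Qed.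

Lemma relent_cases (l l0 : probability B R) :
  (exists2 f, density l l0 f & relent l l0 = (\int[l0]_w (f w * ln (f w))%:E)%E) \/
  (relent l l0 = +oo%E /\ ~ exists f, density l l0 f).
Proof.
rewrite /relent; case: pselect => [h|nh]; last by right.
by left; exists (projT1 (cid h)) => //; exact: (projT2 (cid h)).
Qed.

Lemma density_integral (l l0 : probability B R) f (g : B -> R) : density l l0 f ->
  measurable_fun setT g -> (forall x, 0 <= g x) ->
  (\int[l0]_x (f x * g x)%:E = \int[l]_x (g x)%:E)%E.
Proof.
move=> [mf f0 fE] mg g0.
apply: (@integral_transfer _ _ _ B B l0 l id f) => // A mA.
apply: (etrans _ (esym (fE A mA))); rewrite [RHS]integral_mkcond; apply: eq_integral => x _.
by rewrite patchE indicE; case: (_ \in _); rewrite ?mulr1 ?mulr0.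
Qed.

Lemma density_int1 (l l0 : probability B R) f : density l l0 f -> (\int[l0]_x (f x)%:E = 1)%E.
Proof.
by move=> [mf f0 fE]; rewrite -fE// probability_setT.
Qed.

Lemma density_mbf (l l0 : probability B R) f (g : B -> R) : density l l0 f -> mbf g -> (forall x, 0 <= g x) ->
  (\int[l0]_x (f x * g x)%:E = (\int[l]_x g x)%:E)%E.
Proof. by move=> df bg g0; rewrite (density_integral df)// ?mbf_integral//; case: bg. Qed.

Lemma density_dominates (l l0 : probability B R) f : density l l0 f -> l `<< l0.
Proof.
move=> [mf f0 fE]; apply/null_content_dominatesP => A mA l0A; rewrite fE//.
apply: null_set_integral => //; apply: measurable_funTS; exact/measurable_EFinP.
Qed.

Lemma dominates_density (l l0 : probability B R) : l `<< l0 -> exists f, density l l0 f.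
Proof.
move=> ll0; exists (fine \o Radon_Nikodym_SigmaFinite.f l l0); split.
- by apply: measurableT_comp => //; exact: (measurable_int l0 (Radon_Nikodym_SigmaFinite.f_integrable ll0)).
- by move=> w; rewrite fine_ge0//; exact: Radon_Nikodym_SigmaFinite.f_ge0.
- move=> A mA; rewrite (Radon_Nikodym_SigmaFinite.f_integral ll0)//.
  by apply: eq_integral => x _; rewrite fineK//; exact: Radon_Nikodym_SigmaFinite.f_fin_num.
Qed.

Lemma ge0_prob_intD d (M : measurableType d) (mu : probability M R) (f g : M -> R) :
  measurable_fun setT f -> measurable_fun setT g -> (forall x, 0 <= f x) -> (forall x, 0 <= g x) ->
  (\int[mu]_x (f x + g x)%:E = \int[mu]_x (f x)%:E + \int[mu]_x (g x)%:E)%E.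
Proof.
move=> mf mg f0 g0; under eq_integral do rewrite EFinD.
by rewrite ge0_integralD//; (try by move=> x _; rewrite lee_fin); exact/measurable_EFinP.
Qed.

Lemma prob_int_cst d (M : measurableType d) (mu : probability M R) (c : R) :
  (\int[mu]_x c%:E = c%:E)%E.
Proof. by rewrite integral_cst// (_ : _ setT = 1%E) ?mule1//; exact: probability_setT. Qed.

(** The entropy integrand f ln f is only bounded below, by -1, and its integral may be infinite. The
    shift makes the integrand nonnegative, so that integrals can be split and compared without
    integrability. *)
Lemma int_shift1 d (M : measurableType d) (mu : probability M R) (h : M -> R) :
  measurable_fun setT h -> (forall x, 0 <= h x + 1) ->
  (\int[mu]_x (h x + 1)%:E = \int[mu]_x (h x)%:E + 1)%E.
Proof.
move=> mh h1.
pose hp x := Num.max (h x) 0; pose hn x := Num.max (- h x) 0.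
have mhp : measurable_fun setT hp by exact: measurable_maxr.
have mhn : measurable_fun setT hn by apply: measurable_maxr => //; exact: measurableT_comp.
have hp0 x : 0 <= hp x by rewrite le_max lexx orbT.
have hn0 x : 0 <= hn x by rewrite le_max lexx orbT.
have hn1 x : hn x <= 1 by rewrite ge_max ler01 andbT; have := h1 x; lra.
have bhn : mbf hn by split => //; exists 1 => x; rewrite ger0_norm.
have -> : (\int[mu]_x (h x)%:E = \int[mu]_x (hp x)%:E - \int[mu]_x (hn x)%:E)%E.
  rewrite integralE; congr (_ - _)%E; apply: eq_integral => x _.
    by rewrite funeposE /hp EFin_max.
  by rewrite funenegE /hn -EFinN -EFin_max.
have := @ge0_prob_intD _ _ mu (fun x => h x + 1) hn _ mhn h1 hn0.
move=> /(_ (measurable_funD mh (measurable_cst _))).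
rewrite (_ : (\int[mu]_x (h x + 1 + hn x)%:E)%E = (\int[mu]_x (hp x + 1)%:E)%E); last first.
  apply: eq_integral => x _; congr EFin; rewrite /hp /hn /Num.max; case: ifPn; case: ifPn; rewrite -?leNgt; lra.
rewrite ge0_prob_intD//.
rewrite prob_int_cst (mbf_integral mu bhn).
case: (\int[mu]_x (hp x)%:E)%E => [r||] //=.
- case: (\int[mu]_x (h x + 1)%:E)%E => [s||] //=.
  rewrite -!EFinD => -[] ?; congr EFin; lra.
- by case: (\int[mu]_x (h x + 1)%:E)%E.
- by case: (\int[mu]_x (h x + 1)%:E)%E.
Qed.

Definition DV (l l0 : probability B R) (g : B -> R) : R := \int[l]_x g x - ln (\int[l0]_x expR (g x)).

Lemma int_exp_gt0 (l : probability B R) (g : B -> R) : mbf g -> 0 < \int[l]_x expR (g x).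
Proof.
move=> bg; have [mg [K hK]] := bg.
apply: (@lt_le_trans _ _ (expR (- K))); first exact: expR_gt0.
rewrite -[leLHS](Rintegral_prob_cst l); apply: mbf_int_le; [exact: mbf_cst|exact: mbf_exp|].
by move=> x; rewrite ler_expR; have := hK x; rewrite ler_norml => /andP[].
Qed.

(** Young's inequality at a = f with exponent g - ln Z, integrated under [l0]; the normalisation
    makes the exponential term integrate to 1. *)
Lemma relent_ge_DV (l l0 : probability B R) (g : B -> R) : mbf g -> ((DV l l0 g)%:E <= relent l l0)%E.
Proof.
move=> bg; have [[f df ->]|[-> _]] := relent_cases l l0; last by rewrite leey.
have [mf f0 _] := df; have [mg [K hK]] := bg.
set Z := \int[l0]_x expR (g x); have Z0 : 0 < Z by exact: int_exp_gt0.
(* A bound for |g - ln Z|: adding c makes the linear term nonnegative. *)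
pose c := `|ln Z| + `|K|.
have c0 : 0 <= c by rewrite addr_ge0.
have mfl : measurable_fun setT (fun x => f x * ln (f x)).
  by apply: measurable_funM => //; exact: measurableT_comp.
have gK x : 0 <= g x - ln Z + c.
  by have := hK x; have := ler_norm (ln Z); have := ler_norm K; rewrite /c ler_norml; lra.
have ptw x : f x * (g x - ln Z + c) + f x + 1 <= f x * ln (f x) + 1 + f x * c + expR (g x) / Z.
  have := @young_entropy (f x) (g x - ln Z) (f0 x).
  by rewrite expRD expRN lnK ?posrE//; lra.
have mgz : measurable_fun setT (fun x => g x - ln Z + c).
  by apply: measurable_funD => //; exact: measurable_funB.
have bgz : mbf (fun x => g x - ln Z + c).
  by apply: mbfD (mbf_cst _); apply: mbfB (mbf_cst _).
have meg : measurable_fun setT (fun x => expR (g x) / Z).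
  by apply: measurable_funM => //; case: (mbf_exp bg).
have mfc : measurable_fun setT (fun x => f x * c) by exact: measurable_funM.
have H : (\int[l0]_x (f x * (g x - ln Z + c) + f x + 1)%:E <=
   \int[l0]_x (f x * ln (f x) + 1 + f x * c + expR (g x) / Z)%:E)%E.
  apply: ge0_le_integral => //.
  - by move=> x _; rewrite lee_fin !addr_ge0// mulr_ge0.
  - by apply/measurable_EFinP; do 2 apply: measurable_funD => //; exact: measurable_funM.
  - by apply/measurable_EFinP; do 3 apply: measurable_funD => //.
  - by move=> x _; rewrite lee_fin.
have fg0 x : 0 <= f x * (g x - ln Z + c) by exact: mulr_ge0.
have fl0 x : 0 <= f x * ln (f x) + 1 by exact: xlnx_geN1.
move: H; rewrite ge0_prob_intD//; first last.
- by move=> x; rewrite addr_ge0.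
- by apply: measurable_funD => //; exact: measurable_funM.
rewrite ge0_prob_intD//; last exact: measurable_funM.
rewrite (density_mbf df bgz gK) (density_int1 df) prob_int_cst.
rewrite ge0_prob_intD//; first last.
- by move=> x; rewrite mulr_ge0 ?expR_ge0// invr_ge0 ltW.
- by move=> x; rewrite addr_ge0// mulr_ge0.
- by do 2 apply: measurable_funD => //.
rewrite ge0_prob_intD//; first last.
- by move=> x; rewrite mulr_ge0.
- by apply: measurable_funD.
rewrite int_shift1//.
have -> : (\int[l0]_x (f x * c)%:E)%E = c%:E.
  by rewrite (density_mbf df (mbf_cst c))// Rintegral_prob_cst.
have -> : (\int[l0]_x (expR (g x) / Z)%:E)%E = 1%:E.
  have bez : mbf (fun x => Z^-1 * expR (g x)) by apply: mbfZ; exact: mbf_exp.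
  under eq_integral do rewrite mulrC.
  rewrite (mbf_integral l0 bez) mbf_intZ; last exact: mbf_exp.
  by rewrite mulVf// gt_eqF.
have -> : \int[l]_x (g x - ln Z + c) = \int[l]_x g x - ln Z + c.
  rewrite mbf_intD; [|exact: mbfB (mbf_cst _)|exact: mbf_cst].
  by rewrite mbf_intB ?Rintegral_prob_cst//; exact: mbf_cst.
rewrite /DV -/Z.
case: (\int[l0]_x _)%E => [r||] //=; rewrite ?leey//.
by rewrite -!EFinD !lee_fin; lra.
Qed.

(** An L1 error of e in g lowers the linear term by at most e and raises the logarithmic one by at
    most e exp(K) / Z. The constant c is the sum of these two sensitivities, and e c is half the
    gap. *)
Lemma DV_bcf_approx (l l0 : probability B R) (g : B -> R) r : mbf g -> r < DV l l0 g ->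
  exists2 h, bcf h & r < DV l l0 h.
Proof.
move=> bg rg; have [mg [K hK]] := bg.
set Z := \int[l0]_x expR (g x); have Z0 : 0 < Z by exact: int_exp_gt0.
pose c := 1 + expR K / Z.
have c0 : 0 < c by rewrite ltr_pwDl// divr_ge0 ?expR_ge0// ltW.
pose e := (DV l l0 g - r) / (2 * c).
have e0 : 0 < e by rewrite divr_gt0 ?mulr_gt0// subr_gt0.
have [h [bh hhK hc]] := @L1close_mbf R T (fun b => if b then l else l0) g K e mg hK e0.
exists h; first exact: bh.
have bhm := bcf_mbf bh.
have b1 : mbf (fun x : B => `|h x - g x|) by apply: mbf_norm; exact: mbfB.
have h1 : \int[l]_x g x - \int[l]_x (h x : R) <= e.
  rewrite -mbf_intB//; apply: le_trans (hc true); apply: mbf_int_le => //; first exact: mbfB.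
  by move=> x; rewrite distrC ler_norm.
have h2 : \int[l0]_x expR (h x) <= Z + expR K * e.
  apply: (@le_trans _ _ (Z + expR K * \int[l0]_x `|h x - g x|)); last first.
    by rewrite lerD2l ler_wpM2l ?expR_ge0//; exact: (hc false).
  rewrite /Z -mbf_intZ// -mbf_intD; [|exact: mbf_exp|exact: mbfZ].
  apply: mbf_int_le; [exact: mbf_exp|by apply: mbfD; [exact: mbf_exp|exact: mbfZ]|].
  move=> x; have [hg|gh] := leP (h x) (g x).
    by rewrite (le_trans (_ : _ <= expR (g x))) ?ler_expR// lerDl mulr_ge0 ?expR_ge0.
  have := expR_ge1Dx (g x - h x); rewrite expRD expRN ler_pdivlMr ?expR_gt0// => H.
  have hK' : expR (h x) <= expR K by rewrite ler_expR (le_trans (ler_norm _)).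
  have gt0 : 0 <= h x - g x by rewrite subr_ge0 ltW.
  rewrite ger0_norm//.
  apply: (@le_trans _ _ (expR (g x) + expR (h x) * (h x - g x))).
    by move: H; lra.
  by rewrite lerD2l ler_wpM2r.
have h3 : ln (\int[l0]_x expR (h x)) <= ln Z + expR K / Z * e.
  apply: (@le_trans _ _ (ln (Z + expR K * e))).
    by rewrite ler_ln// posrE; [exact: int_exp_gt0|rewrite addr_gt0// mulr_gt0// expR_gt0].
  have -> : Z + expR K * e = Z * (1 + expR K / Z * e).
    by field; rewrite gt_eqF.
  have q0 : 0 < expR K / Z * e by rewrite mulr_gt0// divr_gt0// expR_gt0.
  rewrite lnM ?posrE//; last by rewrite addr_gt0.
  by rewrite lerD2l le_ln1Dx// (lt_trans _ q0)// ltrN10.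
have : e * c = (DV l l0 g - r) / 2.
  by rewrite /e invfM mulrA -mulrA mulVf ?gt_eqF// mulr1.
rewrite /c /DV mulrDr mulr1 [e * _]mulrC -/Z.
move: rg h1 h3; rewrite /DV -/Z.
set u := \int[l]_x g x; set v := \int[l]_x _; set z := ln _; set t := ln _.
by move: u v z t => u v z t; lra.
Qed.

(** Without a density, a multiple of the indicator of an [l0]-null set charged by l is a witness.
    With a density f, the optimal g would be ln f; it is truncated on both sides to be bounded. *)
Lemma DV_gt_relent (l l0 : probability B R) (r : R) : (r%:E < relent l l0)%E ->
  exists2 g, mbf g & r < DV l l0 g.
Proof.
have [[f df ->]|[-> nd] _] := relent_cases l l0; last first.
  have /(contra_not (@dominates_density l l0))/null_content_dominatesP := nd.
  move=> /existsNP[A /not_implyP[mA /not_implyP[l0A /eqP lA]]].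
  have lA0 : 0 < fine (l A).
    by rewrite fine_gt0// lt0e lA measure_ge0/= ltey_eq fin_num_measure.
  (* Makes [DV] equal to |r| + 1, the logarithmic term being ln 1. *)
  pose c := (`|r| + 1) / fine (l A).
  exists (fun x => c * \1_A x); first by apply: mbfZ; exact: mbf_indic.
  rewrite /DV mbf_intZ; last exact: mbf_indic.
  rewrite mbf_int_indic// divfK ?gt_eqF//.
  rewrite (_ : Rintegral _ _ _ = 1); last first.
    rewrite (_ : 1 = fine (1 : \bar R))//; congr fine.
    transitivity (\int[l0]_(x in setT `\` A) (expR (c * \1_A x))%:E)%E.
      apply: negligible_integral => //.
      by apply: (mbf_integrable l0); apply: mbf_exp; apply: mbfZ; exact: mbf_indic.
    rewrite (eq_integral (cst 1%E)); last first.
      by move=> x; rewrite inE => -[_ nAx]; rewrite indicE memNset// mulr0 expR0.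
    rewrite integral_cst; last exact: measurableD.
    rewrite mul1e measureD//; last by rewrite ltey_eq fin_num_measure.
    by rewrite setTI l0A sube0; exact: probability_setT.
  rewrite ln1 subr0 (le_lt_trans (ler_norm r))// ltrDl//.
move=> rH; have [mf f0 _] := df.
pose a (N : nat) x := f x * Num.min (ln (f x)) N%:R.
have mln : measurable_fun setT (fun x => ln (f x)) by exact: measurableT_comp.
have ma N : measurable_fun setT (a N) by apply: measurable_funM => //; exact: measurable_minr.
have a1 N x : 0 <= a N x + 1.
  rewrite /a; have := xlnx_geN1 (f0 x); have := f0 x; move=> fx0 ?.
  have [|_] := leP (ln (f x)) N%:R => //; by rewrite addr_ge0// mulr_ge0.
have amono x : {homo a ^~ x : n m / (n <= m)%N >-> n <= m}.
  move=> n m nm; rewrite /a ler_wpM2l// le_min ge_min lexx/= ge_min.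
  by rewrite ler_nat nm orbT.
have alim x : (a N x + 1)%:E @[N --> \oo] --> (f x * ln (f x) + 1)%:E.
  apply: cvg_near_cst; near=> N; rewrite /a min_l//.
  apply: (le_trans (ler_norm _)); apply: (@le_trans _ _ (Num.truncn `|ln (f x)|).+1%:R).
    by rewrite ltW// truncnS_gt.
  by rewrite ler_nat; near: N; exact: nbhs_infty_ge.
have cva : (\int[l0]_x (a N x + 1)%:E @[N --> \oo] --> \int[l0]_x (f x * ln (f x) + 1)%:E)%E.
  have -> : (\int[l0]_x (f x * ln (f x) + 1)%:E = \int[l0]_x (limn (fun N => (a N x + 1)%:E)))%E.
    by apply: eq_integral => x _; apply/esym/cvg_lim => //; exact: alim.
  apply: cvg_monotone_convergence => //.
  - by move=> n; apply/measurable_EFinP; exact: measurable_funD.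
  - by move=> n x _; rewrite lee_fin.
  - by move=> x _ n m nm; rewrite lee_fin lerD2r; exact: amono.
have mfl : measurable_fun setT (fun x => f x * ln (f x)) by exact: measurable_funM.
have [r' rr' r'H] : exists2 r' : R, r < r' & (r'%:E < \int[l0]_w (f w * ln (f w))%:E)%E.
  move: rH; case: (\int[l0]_w _)%E => [h||] // rh.
    exists ((r + h) / 2); rewrite ?lte_fin; move: rh; rewrite lte_fin; lra.
  by exists (r + 1); [lra|rewrite ltry].
rewrite int_shift1// in cva; last by move=> x; exact: xlnx_geN1.
have near1 : \forall N \near \oo, ((r' + 1)%:E < \int[l0]_x (a N x + 1)%:E)%E.
  apply: (cva [set y | ((r' + 1)%:E < y)%E]); apply: open_nbhs_nbhs; split; first exact: open_ereal_gt_ereal.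
  by rewrite /= EFinD; move: r'H; case: (\int[l0]_x _)%E => [h||] //=; rewrite ?ltry// -EFinD !lte_fin ltrD2r.
have near2 : \forall N \near \oo, expR (- N%:R) <= (r' - r) / 2.
  near=> N; rewrite expRN.
  have d0 : 0 < (r' - r) / 2 by rewrite divr_gt0// subr_gt0.
  rewrite -[leRHS]invrK lef_pV2 ?posrE ?invr_gt0 ?expR_gt0//.
  apply: (@le_trans _ _ N%:R); last by have := expR_ge1Dx (N%:R : R); lra.
  apply: (@le_trans _ _ (Num.truncn ((r' - r) / 2)^-1).+1%:R); first by rewrite ltW// truncnS_gt.
  by rewrite ler_nat; near: N; exact: nbhs_infty_ge.
have [N [hN1 hN2]] : exists N, ((r' + 1)%:E < \int[l0]_x (a N x + 1)%:E)%E /\ expR (- N%:R) <= (r' - r) / 2.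
  by near \oo => N; exists N; split; near: N.
(* Cutting from above loses little by monotone convergence of [a N]; raising small values to exp(-N)
   only increases ln q and adds at most exp(-N) to the integral of q. *)
pose q x := Num.max (expR (- N%:R)) (Num.min (f x) (expR N%:R)).
have q0 x : 0 < q x by rewrite lt_max expR_gt0.
have mq : measurable_fun setT q by apply: measurable_maxr => //; exact: measurable_minr.
have qlnK x : expR (ln (q x)) = q x by rewrite lnK// posrE.
have qN x : `|ln (q x)| <= N%:R.
  have q1 : expR (- N%:R) <= q x by rewrite le_max lexx.
  have q2 : q x <= expR N%:R.
    by rewrite ge_max ge_min lexx orbT andbT ler_expR; have := ler0n R N; lra.
  by rewrite ler_norml -ler_expR qlnK q1 -ler_expR qlnK.
have bq : mbf (fun x => ln (q x)).
  by split; [exact: measurableT_comp|exists N%:R].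
exists (fun x => ln (q x)) => //.
have afq x : a N x + 1 + f x * N%:R <= f x * (ln (q x) + N%:R) + 1.
  have := f0 x; rewrite le_eqVlt => /predU1P[fx0|fx0].
    by rewrite /a -fx0 !mul0r; lra.
  suff : Num.min (ln (f x)) N%:R <= ln (q x) by move=> /(ler_wpM2l (f0 x)); rewrite /a; lra.
  rewrite -ler_expR qlnK /q le_max; apply/orP; right.
  rewrite le_min; apply/andP; split.
    by rewrite -[leRHS]lnK ?posrE// ler_expR ge_min lexx.
  by rewrite ler_expR ge_min lexx orbT.
have lnqN0 x : 0 <= ln (q x) + N%:R by have := qN x; rewrite ler_norml; lra.
have H : (\int[l0]_x (a N x + 1 + f x * N%:R)%:E <= \int[l0]_x (f x * (ln (q x) + N%:R) + 1)%:E)%E.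
  apply: ge0_le_integral => //.
  - by move=> x _; rewrite lee_fin addr_ge0// mulr_ge0.
  - apply/measurable_EFinP; apply: measurable_funD; first exact: measurable_funD.
    exact: measurable_funM.
  - apply/measurable_EFinP; apply: measurable_funD => //; apply: measurable_funM => //.
    by apply: measurable_funD => //; case: bq.
  - by move=> x _; rewrite lee_fin.
have bqN : mbf (fun x => ln (q x) + N%:R) by apply: mbfD => //; exact: mbf_cst.
move: H; rewrite ge0_prob_intD//; first last.
- by move=> x; rewrite mulr_ge0.
- exact: measurable_funM.
- exact: measurable_funD.
rewrite [X in (_ <= X)%E]ge0_prob_intD//; first last.
- by move=> x; rewrite mulr_ge0.
- by apply: measurable_funM => //; case: bqN.
rewrite prob_int_cst (density_mbf df bqN lnqN0).
have -> : (\int[l0]_x (f x * N%:R)%:E)%E = N%:R%:E.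
  by rewrite (density_mbf df (mbf_cst N%:R))// Rintegral_prob_cst.
rewrite mbf_intD//; last exact: mbf_cst.
rewrite Rintegral_prob_cst => H.
have H1 : r' <= \int[l]_x ln (q x).
  have := lt_le_trans (lte_leD _ hN1 (lexx N%:R%:E)) H.
  by rewrite -!EFinD lte_fin => /(_ isT); lra.
have H2 : \int[l0]_x expR (ln (q x)) <= 1 + expR (- N%:R).
  rewrite -lee_fin -mbf_integral; last exact: mbf_exp.
  rewrite EFinD -(density_int1 df) -(prob_int_cst l0) -ge0_prob_intD//.
  apply: ge0_le_integral => //.
  - by apply/measurable_EFinP; case: (mbf_exp bq).
  - by apply/measurable_EFinP; exact: measurable_funD.
  move=> x _; rewrite lee_fin qlnK /q ge_max lerDr f0/=.
  by rewrite ge_min lerDl expR_ge0.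
have H3 : ln (\int[l0]_x expR (ln (q x))) <= expR (- N%:R).
  apply: (@le_trans _ _ (ln (1 + expR (- N%:R)))).
    by rewrite ler_ln// posrE; [exact: int_exp_gt0|rewrite addr_gt0// expR_gt0].
  by rewrite le_ln1Dx// (lt_trans _ (expR_gt0 _))// ltrN10.
by rewrite /DV; move: H1 H3 hN2 rr'; lra.
Unshelve. all: by end_near. Qed.

Lemma relent_gt_bcf (l l0 : probability B R) (r : R) : (r%:E < relent l l0)%E ->
  exists2 g, bcf g & r < DV l l0 g.
Proof. by move=> /DV_gt_relent[g bg rg]; exact: DV_bcf_approx rg. Qed.

Lemma relent_fin_dominates (l l0 : probability B R) : (relent l l0 < +oo)%E -> l `<< l0.
Proof.
by have [[f df _] _|[-> _]] := relent_cases l l0; [exact: density_dominates df|rewrite ltxx].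
Qed.

Lemma relent_ge0 (l l0 : probability B R) : (0 <= relent l l0)%E.
Proof.
have := relent_ge_DV l l0 (mbf_cst 0).
by rewrite /DV expR0 !Rintegral_prob_cst ln1 subr0.
Qed.

End entropy.

(** * Tightness and empirical measures *)

Lemma separable_seq (R : realType) (T : pseudoPMetricType R) (D : set T) :
  countable D -> closure D = setT -> exists u : nat -> T, forall x (e : R), 0 < e -> exists n, ball x e (u n).
Proof.
move=> cD clD.
have D0 : D !=set0.
  have : closure D point by rewrite clD.
  by move=> /(_ setT (filter_nbhsT _))[x [Dx _]]; exists x.
have [u [Du us]] := countable_seq cD D0; exists u => x e e0.
have : closure D x by rewrite clD.
move=> /(_ (ball x e) (nbhsx_ballx _ _ e0))[y [Dy xy]].
by have [n uny] := us _ Dy; exists n; rewrite uny.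
Qed.

Lemma ultra_bigsetU T (F : set_system T) (n : nat) (A : nat -> set T) : UltraFilter F ->
  F (\bigcup_(i < n) A i) -> exists i, F (A i).
Proof.
move=> UF; have PF : ProperFilter F by exact: ultra_proper.
elim: n => [|n ih] FA.
  by have /filter_ex[x [i]] := FA.
have [FAn|FnAn] := in_ultra_setVsetC (A n) UF; first by exists n.
apply: ih; apply: filterS (filterI FA FnAn) => x [[i /= ilt Aix] nAx].
exists i => //=; rewrite ltn_neqAle -ltnS ilt andbT; apply/eqP => ein.
by apply: nAx; rewrite -ein.
Qed.

(** Ulam's theorem: K is the intersection over k of closures of finite unions of balls of radius 1 /
    (k + 1), hence totally bounded and complete. The k-th union is taken large enough to miss mass
    at most e / 2^(k + 1). *)
Lemma ulam_tight (R : realType) (T : completePseudoMetricType R) (u : nat -> T)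
  (hu : forall x (e : R), 0 < e -> exists n, ball x e (u n)) (l : probability (borel T) R) (e : R) :
  0 < e -> exists2 K : set T, compact K & closed K /\ (l (~` K) <= e%:E)%E.
Proof.
move=> e0.
pose V (k i : nat) : set T := (ball (u i) (k.+1%:R^-1 : R))°.
have coverV k : \bigcup_i V k i = setT.
  rewrite -subTset => x _.
  have r0 : 0 < (k.+1%:R^-1 / 2 : R) by rewrite divr_gt0.
  have [n xn] := hu x _ r0; exists n => //.
  apply/nbhs_ballP; exists (k.+1%:R^-1 / 2) => //= y xy.
  by rewrite [_^-1]splitr; exact: ball_triangle (ball_sym xn) xy.
pose U k n : set (borel T) := \bigcup_(i < n) V k i.
have oU k n : open (U k n : set T) by apply: bigcup_open => i _; exact: open_interior.
have mU k n : measurable (U k n) by exact: open_measurable_borel.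
have hN k : exists n, (l (~` U k n) <= (e / (2 ^ k.+1)%:R)%:E)%E.
  have ek : 0 < e / (2 ^ k.+1)%:R by rewrite divr_gt0// ltr0n expn_gt0.
  have : l (~` U k n) @[n --> \oo] --> l (\bigcap_n ~` U k n).
    apply: nonincreasing_cvg_mu.
    - by rewrite ltey_eq fin_num_measure//; exact: measurableC.
    - by move=> n; exact: measurableC.
    - by apply: bigcap_measurable => // n _; exact: measurableC.
    - move=> m n mn; apply/subsetPset => x /= nUx [i /= im Vi]; apply: nUx.
      by exists i => //=; exact: leq_trans mn.
  have -> : \bigcap_n ~` U k n = set0.
    rewrite -subset0 => x /= hx; have : (\bigcup_i V k i) x by rewrite coverV.
    by move=> [i _ Vi]; apply: (hx i.+1 I); exists i => /=.
  rewrite measure0 => /(_ [set y | (y < (e / (2 ^ k.+1)%:R)%:E)%E])[].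
    by apply: open_nbhs_nbhs; split; [exact: open_ereal_lt_ereal|rewrite /= lte_fin].
  by move=> n _ /(_ n (leqnn n)) /= /ltW h; exists n.
have [N hN'] := choice hN.
pose K : set T := \bigcap_k closure (U k (N k)).
have cK : closed K by apply: closed_bigI => k _; exact: closed_closure.
have mclU k : measurable (closure (U k (N k) : set T) : set (borel T)).
  rewrite -[closure _]setCK; apply: measurableC; apply: open_measurable_borel.
  by rewrite openC; exact: closed_closure.
exists K; last split => //.
  rewrite compact_ultra => F UF FK.
  have PF : ProperFilter F by exact: ultra_proper.
  have cF : cauchy F.
    apply/cauchy_ballP => eps eps0.
    have e20 : 0 < eps / 2 / 2 by rewrite !divr_gt0.
    have [k ke] : exists n : nat, n.+1%:R^-1 < eps / 2 / 2.
      by have [n] := ltr_add_invr e20; rewrite add0r; exists n.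
    (* An ultrafilter containing a finite union of balls contains one of them, which makes it
       Cauchy. *)
    have [i Fi] : exists i, F (ball (u i) (eps / 2)).
      apply: (@ultra_bigsetU _ F (N k)) => //.
      apply: filterS FK => x /(_ k I) /(_ (ball x (eps / 2 / 2)) (nbhsx_ballx _ _ e20)).
      move=> [y [[i iN /interior_subset uiy] xy]]; exists i => //.
      by rewrite [eps / 2]splitr; exact: ball_triangle (le_ball (ltW ke) uiy) (ball_sym xy).
    exists (ball (u i) (eps / 2), ball (u i) (eps / 2)) => //= -[x y] /= [uix uiy].
    by rewrite [eps]splitr; exact: ball_triangle (ball_sym uix) uiy.
  have /cvg_ex[p Fp] := @cauchy_cvg T F PF cF.
  exists p; split => //.
  apply: (@closed_cvg _ _ F _ id K cK _ p) => //.
have -> : ~` K = \bigcup_k ~` closure (U k (N k) : set T) by rewrite setC_bigcap.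
apply: (@le_trans _ _ (\sum_(0 <= k <oo) l (~` closure (U k (N k) : set T)))%E).
  apply: measure_sigma_subadditive => //; last first.
    by apply: bigcup_measurable => k _; exact: measurableC.
  by move=> k; exact: measurableC.
apply: le_trans (epsilon_trick0 xpredT (ltW e0)).
apply: lee_nneseries => // k _.
apply: le_trans (hN' k); apply: le_measure; rewrite ?inE; [exact: measurableC|exact: measurableC|].
by apply: subsetC; exact: subset_closure.
Qed.

Lemma mnormalizeE d (T : measurableType d) (R : realType) (mu : {measure set T -> \bar R})
  (P : probability T R) (c : R) (B : set T) : mu setT = c%:E -> 0 < c ->
  mnormalize mu P B = (mu B * (c^-1)%:E)%E.
Proof. by move=> muT c0; rewrite /mnormalize/= muT eqe gt_eqF. Qed.

Section empirical.
Context {R : realType} {W X : pseudoPMetricType R}.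
Variable (n : nat).
Hypothesis n0 : (0 < n)%N.
Variable v : 'I_n -> WX W X.

Let dirs : nat -> {measure set (WX W X) -> \bar R} :=
  fun k => \d_(if insub k is Some i then v i else point).

Let dirsE (i : 'I_n) : dirs i = \d_(v i).
Proof. by rewrite /dirs valK. Qed.

Let dirsB (i : 'I_n) (B : set (WX W X)) : dirs i B = (\1_B (v i))%:E.
Proof. by rewrite dirsE indicE -diracE. Qed.

Let msum_dirsT : msum dirs n setT = n%:R%:E.
Proof.
rewrite /msum (eq_bigr (fun=> 1%E)); last by move=> i _; rewrite dirsB indicT.
by rewrite sumEFin sumr_const card_ord.
Qed.

Let nR0 : n%:R != 0 :> R. Proof. by rewrite pnatr_eq0 -lt0n. Qed.

Lemma emp_msum (B : set (WX W X)) : emp v B = (msum dirs n B * (n%:R^-1)%:E)%E.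
Proof.
apply: mnormalizeE; [exact: msum_dirsT|by rewrite ltr0n].
Qed.

Lemma empE (B : set (WX W X)) : emp v B = (n%:R^-1 * \sum_(i < n) \1_B (v i))%:E.
Proof.
rewrite emp_msum muleC EFinM; congr (_ * _)%E; rewrite /msum -sumEFin.
by apply: eq_bigr => i _; rewrite dirsB.
Qed.

Let ge0_int_emp (f : WX W X -> R) : measurable_fun setT f -> (forall p, 0 <= f p) ->
  (\int[emp v]_p (f p)%:E = (n%:R^-1 * \sum_(i < n) f (v i))%:E)%E.
Proof.
move=> mf f0; have ni : 0 <= n%:R^-1 :> R by rewrite invr_ge0.
have mEf : measurable_fun setT (EFin \o f) by exact/measurable_EFinP.
rewrite (eq_measure_integral (mscale (NngNum ni) (msum dirs n))); last first.
  by move=> A mA _; apply: etrans (muleC _ _); exact: emp_msum.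
rewrite ge0_integral_mscale//; last by move=> x _; rewrite lee_fin.
rewrite ge0_integral_measure_sum//; last by move=> x _; rewrite lee_fin.
rewrite EFinM -sumEFin; congr (_ * _)%E; apply: eq_bigr => i _.
by rewrite dirsE integral_dirac// diracE in_setT mul1e.
Qed.

Lemma rint_emp (f : WX W X -> R) : mbf f -> \int[emp v]_p f p = n%:R^-1 * \sum_(i < n) f (v i).
Proof.
move=> bf; have [mf [K hK]] := bf.
have fK0 p : 0 <= f p + `|K|.
  by have := hK p; rewrite ler_norml; have := ler_norm K; lra.
have bfK : mbf (fun p => f p + `|K|) by apply: mbfD => //; exact: mbf_cst.
have := ge0_int_emp bfK.1 fK0.
rewrite mbf_integral// => -[]; rewrite mbf_intD//; last exact: mbf_cst.
rewrite Rintegral_prob_cst big_split/= sumr_const card_ord mulrDr -[`|K| *+ n]mulr_natl.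
by rewrite mulKf// => /addIr.
Qed.

End empirical.

(** * Quasi-equilibria *)

Section quasi_equilibria.
Context {R : realType} {W X : pseudoPMetricType R}.
Notation PMs := (PM W X).
Variables (bW : nat -> set W) (bX : nat -> set X).
Hypotheses (hbW : cbase bW) (hbX : cbase bX).
Variables (C : W -> set X) (F : PMs -> W -> X -> R).
Hypotheses (hC : corr_cont C) (hF : F_bcont F).

Lemma bcont_mbf (f : W * X -> R) : bcont f -> mbf (f : WX W X -> R).
Proof. by move=> [cf bf]; split => //; exact: (cont_measurable_WX hbW hbX). Qed.

(** Total variation distance tested on continuous functions; moving one atom out of n costs 2 /
    n. *)
Definition close_integ (d : R) (m m' : PMs) := forall (f : W * X -> R) (M : R),
  bcont f -> (forall p, `|f p| <= M) -> `|rint m' f - rint m f| <= d * M.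

(** The measure m' may vary with the deviation y. The set of such points is not known to be
    measurable, so [quasi_eq] tests the measurable sets that miss it. *)
Definition quasi_opt (d : R) (m : PMs) (p : W * X) := C p.1 p.2 /\
  forall y, C p.1 y -> exists2 m', close_integ d m m' & F m p.1 p.2 <= F m' p.1 y.

(* In an n-player equilibrium a deviation moves the empirical measure by at most 2/n,
   so empirical measures of equilibria satisfy [quasi_eq (2/n)]; unlike the equilibrium
   condition itself, this one passes to the limit as d tends to 0. *)
Definition quasi_eq (d : R) (m : PMs) := forall V : set (WX W X), measurable V ->
  (forall p, V p -> ~ quasi_opt d m p) -> m V = 0%E.

Definition in_M (m : PMs) := {ae m, forall p : WX W X, C p.1 p.2 /\
     (F m p.1 p.2)%:E = ereal_inf [set (F m p.1 y)%:E | y in C p.1]}.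

Lemma opt_infE (m : PMs) (G : X -> R) w x : C w x ->
  ((G x)%:E = ereal_inf [set (G y)%:E | y in C w]) <-> (forall y, C w y -> G x <= G y).
Proof.
move=> Cx; split => [h y Cy|h].
  by rewrite -lee_fin h; apply: ereal_inf_lbound; exists y.
apply/eqP; rewrite eq_le; apply/andP; split.
  by apply: le_ereal_inf_tmp => _ [y Cy <-]; rewrite lee_fin h.
by apply: ereal_inf_lbound; exists x.
Qed.

(** Allows [quasi_limit] to prove that M is closed as well. *)
Lemma in_M_quasi m : in_M m -> quasi_eq 0 m.
Proof.
move=> [N [mN N0 hN]] V mV hV.
apply/eqP; rewrite eq_le measure_ge0 andbT -N0 le_measure ?inE// => p Vp.
apply: hN => /= -[Cp hp]; apply: (hV p Vp); split => // y Cy; exists m.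
  by move=> f M _ _; rewrite subrr normr0 mul0r.
by have /(@opt_infE m (F m p.1) p.1 p.2 Cp) := hp; apply.
Qed.

(** Neighbourhood form of the sequential continuity of C: a failure at every radius 1 / (n + 1)
    would give a sequence without approximating points. *)
Lemma corr_lhc w y (e : R) : C w y -> 0 < e -> exists2 d : R, 0 < d &
  forall w', ball w d w' -> exists2 y', C w' y' & ball y e y'.
Proof.
move=> Cy e0; apply: contrapT => nh.
have h n : exists w', ball w (n.+1%:R^-1 : R) w' /\ forall y', C w' y' -> ~ ball y e y'.
  apply: contrapT => nw; apply: nh; exists n.+1%:R^-1 => // w' ww'.
  apply: contrapT => ny; apply: nw; exists w'; split => // y' Cy' yy'.
  by apply: ny; exists y'.
have [ws hws] := choice h.
have cws : ws @ \oo --> w.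
  apply/cvg_ballP => d d0; near=> n; have [+ _] := hws n; apply: le_ball.
  rewrite -[leRHS]invrK lef_pV2 ?posrE ?invr_gt0//.
  apply: (@le_trans _ _ (Num.truncn d^-1).+1%:R); first by rewrite ltW// truncnS_gt.
  by rewrite ler_nat ltnW// ltnS; near: n; exact: nbhs_infty_ge.
have [_ _ /(_ ws w y cws Cy)[phi [xs [phih Cxs cxs]]]] := hC.
have /cvg_ballP/(_ e e0)[k _ /(_ k (leqnn k)) /=] := cxs.
by have [_ + ] := hws (phi k); apply; exact: Cxs.
Unshelve. all: by end_near. Qed.

Let mW V : open V -> measurable (V : set (WX W X)).
Proof. exact: (open_measurable_WX hbW hbX). Qed.

(** The mass of an open set is lower semicontinuous: if m V were positive, some bump below V would
    have positive integral under m, hence under all measures near m. *)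
Lemma weak_open_null (m : PMs) (V : set (W * X)) (U : set PMs) : open V ->
  weak_open U -> U m -> (forall U', weak_open U' -> U' m -> exists2 m', (U `&` U') m' & m' (V : set (WX W X)) = 0%E) ->
  m (V : set (WX W X)) = 0%E.
Proof.
move=> oV oU Um h.
have b0 k : rint m (bump V k) = 0.
  apply/eqP; rewrite eq_le; apply/andP; split; last first.
    by apply: Rintegral_ge0 => p _; exact: bump_ge0.
  apply/ler_addgt0Pr => e e0; rewrite add0r leNgt; apply/negP => he.
  have bb : bcont (bump V k : W * X -> R) by exact: bcf_bump.
  have [m' [_ /= hm'] mV0] := h _ (weak_open_rint_gt hbW hbX (t := e) bb) he.
  have : rint m' (bump V k) <= \int[m']_p (\1_V p).
    apply: mbf_int_le; first exact: bcont_mbf.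
      by apply: mbf_indic; exact: mW.
    by move=> p; exact: bump_le_indic.
  rewrite mbf_int_indic; last exact: mW.
  by rewrite mV0 /= leNgt (lt_trans e0 hm').
have : rint m (bump V k) @[k --> \oo] --> \int[m]_p (\1_V p : R).
  apply: (@bounded_cvg_int _ _ _ m _ _ 1).
  - by move=> k; have [] := bcont_mbf (bcf_bump V k).
  - by move=> k p; rewrite ger0_norm ?bump_le1// bump_ge0.
  - by have [] := mbf_indic (R := R) (mW oV).
  - by move=> p; exact: bump_cvg.
under eq_fun do rewrite b0.
rewrite mbf_int_indic; last exact: mW.
move=> /(cvg_unique (@Rhausdorff R) (cvg_cst 0)) /esym h0.
by rewrite -[LHS]fineK ?h0// fin_num_measure//; exact: mW.
Qed.

(** Around a point p from which a deviation y strictly gains, continuity of F and of C gives a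
    neighbourhood in which no point is quasi-optimal for any measure near m. By [key] such a
    neighbourhood is null for m, and a countable base collects all of them in one null set. *)
Lemma quasi_limit (m : PMs) :
  (forall U d, weak_open U -> U m -> 0 < d -> exists m' d', [/\ U m', 0 <= d' <= d & quasi_eq d' m']) ->
  in_M m.
Proof.
move=> hm.
have key (V : set (W * X)) U d0 : open V -> weak_open U -> U m -> 0 < d0 ->
    (forall m' d', U m' -> 0 <= d' <= d0 -> forall p, V p -> ~ quasi_opt d' m' p) ->
    m (V : set (WX W X)) = 0%E.
  move=> oV oU Um d00 hV; apply: (weak_open_null oV oU Um) => U' oU' U'm.
  have [m' [d' [[Um' U'm'] hd' qm']]] := hm _ _ (weak_openI oU oU') (conj Um U'm) d00.
  exists m' => //; apply: qm'; first exact: mW.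
  by move=> p Vp; exact: (hV m' d').
have [hCc hG _] := hC.
have mGr : m ([set p | ~ C p.1 p.2] : set (WX W X)) = 0%E.
  apply: (@key _ setT 1) => //.
  - by have := closed_openC hG.
  - exact: weak_openT.
  - by move=> m' d' _ _ p nC [Cp _].
have bad p y : C p.1 p.2 -> C p.1 y -> F m p.1 y < F m p.1 p.2 ->
    exists2 V : set (W * X), open V /\ V p & m (V : set (WX W X)) = 0%E.
  move=> Cp Cy gap.
  (* Half the gain, so that errors below g on both sides still contradict quasi-optimality. *)
  pose g := (F m p.1 p.2 - F m p.1 y) / 2.
  have g0 : 0 < g by rewrite divr_gt0// subr_gt0.
  have [_ hFc] := hF.
  have [k1 [fs1 [bf1 [d1 d10 h1]]]] := hFc m p.1 p.2 g g0.
  have [k2 [fs2 [bf2 [d2 d20 h2]]]] := hFc m p.1 y g g0.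
  have [dw dw0 hw] := corr_lhc Cy d20.
  have [M hM] : exists M : R, forall i q, `|fs2 i q| <= M.
    have hM i : exists M : R, forall q, `|fs2 i q| <= M by have [_] := bf2 i.
    have [Ms hMs] := choice hM.
    exists (\sum_(i < k2) `|Ms i|) => i q; rewrite (le_trans (hMs i q))//.
    rewrite (bigD1 i)//= ler_wpDr ?ler_norm//; exact: sumr_ge0.
  pose U := wnbhd m fs1 d1 `&` wnbhd m fs2 (d2 / 2).
  have d220 : 0 < d2 / 2 by rewrite divr_gt0.
  have oU : weak_open U by apply: weak_openI; exact: (weak_open_wnbhd hbW hbX).
  have Um : U m.
    split; rewrite (wnbhdE hbW hbX)// => i; by rewrite subrr normr0.
  pose dmin := Num.min d1 (Num.min d2 dw).
  have dmin0 : 0 < dmin by rewrite !lt_min d10 d20.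
  (* With this, m'' differs from m' by less than d2 / 2 on each fs2; the other d2 / 2 is the
     distance of m' to m. *)
  pose d0 := d2 / 2 / (2 * (`|M| + 1)).
  have M1 : 0 < `|M| + 1 by rewrite ltr_wpDl.
  have d00 : 0 < d0 by rewrite divr_gt0// mulr_gt0.
  exists ((ball p dmin)°); first by split; [exact: open_interior|exact: nbhsx_ballx].
  apply: (@key _ U d0) => //; first exact: open_interior.
  move=> m' d' [U1 U2] /andP[d'0 d'd0] q /interior_subset [qw qx] [Cq hq].
  have [y' Cy' yy'] : exists2 y', C q.1 y' & ball y d2 y'.
    by apply: hw; apply: le_ball qw; rewrite /dmin !ge_min lexx !orbT.
  have [m'' cm'' Fq] := hq y' Cy'.
  have F1 : `|F m' q.1 q.2 - F m p.1 p.2| < g.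
    apply: h1 => //; [apply: le_ball qw|apply: le_ball qx]; by rewrite /dmin !ge_min lexx.
  have F2 : `|F m'' q.1 y' - F m p.1 y| < g.
    apply: h2 => //; last by apply: le_ball qw; rewrite /dmin !ge_min lexx orbT.
    rewrite (wnbhdE hbW hbX)// => i.
    have a1 := cm'' (fs2 i) M (bf2 i) (hM i).
    have a2 : d' * M < d2 / 2.
      apply: (@le_lt_trans _ _ (d0 * (`|M| + 1))).
        apply: (@le_trans _ _ (d' * (`|M| + 1))); last by rewrite ler_wpM2r// ltW.
        by rewrite ler_wpM2l// (le_trans (ler_norm M))// lerDl.
      rewrite /d0 invfM mulrA mulfVK ?gt_eqF// ltr_pdivrMr//; lra.
    have a3 : `|rint m' (fs2 i) - rint m (fs2 i)| < d2 / 2.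
      by move: U2; rewrite (wnbhdE hbW hbX)//; apply.
    have := ler_distD (rint m' (fs2 i)) (rint m'' (fs2 i)) (rint m (fs2 i)).
    by move: a1 a2 a3; lra.
  move: F1 F2 Fq; rewrite !ltr_norml /g; lra.
have hb := cbase_prod hbW hbX.
set b := (fun n : nat => _) in hb.
(* An open null set is a union of base sets that are null themselves, so countably many null sets
   suffice. *)
pose N : set (WX W X) := [set p | ~ C p.1 p.2] `|` \bigcup_(i in [set i | m (b i : set (WX W X)) = 0%E]) b i.
have mb i : measurable (b i : set (WX W X)) by apply: mW; case: hb => + _; apply.
have mGrm : measurable ([set p | ~ C p.1 p.2] : set (WX W X)).
  by apply: mW; exact: (closed_openC hG).
exists N; split.
- by apply: measurableU => //; apply: bigcup_measurable.
- apply/eqP; rewrite eq_le measure_ge0 andbT.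
  apply: le_trans (measureU2 _ _ _) _ => //; first by apply: bigcup_measurable.
  apply: (@le_trans _ _ (0 + 0)%E); last by rewrite adde0.
  apply: leeD; first by rewrite le_eqVlt; apply/orP; left; apply/eqP; exact: mGr.
  have -> : \bigcup_(i in [set i | m (b i : set (WX W X)) = 0%E]) b i =
      \bigcup_i (if pselect (m (b i : set (WX W X)) = 0%E) then b i else set0).
    apply/seteqP; split => [q [i /= mi bq]|q [i _]]; first by exists i => //; case: pselect.
    by case: pselect => // mi bq; exists i.
  apply: (le_trans (@measure_sigma_subadditive _ _ _ m _
    (fun i => if pselect (m (b i : set (WX W X)) = 0%E) then b i else set0) _ _ (@subset_refl _ _))).
  - by move=> i; case: pselect => /= _; [exact: mb|exact: measurable0].
  - by apply: bigcup_measurable => i _; case: pselect => /= _; [exact: mb|exact: measurable0].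
  - by rewrite eseries0// => i _ _; case: pselect => //= _; rewrite measure0.
move=> p /= np; have [Cp|nCp] := pselect (C p.1 p.2); last by left.
right; have [y Cy gap] : exists2 y, C p.1 y & F m p.1 y < F m p.1 p.2.
  apply: contrapT => ny; apply: np; split => //; apply/(@opt_infE m (F m p.1) p.1 p.2 Cp) => y Cy.
  by rewrite leNgt; apply/negP => h; apply: ny; exists y.
have [V [oV Vp] mV0] := bad p y Cp Cy gap.
have [_ hb2] := hb; have [i bip biV] := hb2 _ _ oV Vp; exists i => //=.
by apply/eqP; rewrite eq_le measure_ge0 andbT -mV0 le_measure// inE//; exact: mW.
Qed.

Lemma nash_quasi n (w : 'I_n -> W) (x : 'I_n -> X) : (0 < n)%N -> nash F C w x ->
  quasi_eq (2 / n%:R) (emp (prof w x)).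
Proof.
move=> n0 hN V mV hV; rewrite empE// big1 ?mulr0// => i _.
rewrite indicE memNset// => Vi; apply: (hV _ Vi); have [Ci hi] := hN i; split => // y Cy.
exists (emp (prof w (upd x i y))).
  move=> f M bf hM; rewrite /rint !rint_emp//; try exact: bcont_mbf.
  rewrite -mulrBr -sumrB (bigD1 i)//= big1 ?addr0; last first.
    by move=> j ji; rewrite /prof /upd (negbTE ji) subrr.
  rewrite normrM ger0_norm ?invr_ge0// mulrC mulrAC ler_wpM2r ?invr_ge0//.
  rewrite (le_trans (ler_normB _ _))//.
  by rewrite mulr_natl mulr2n lerD.
by rewrite -lee_fin hi; apply: ereal_inf_lbound; exists y.
Qed.

End quasi_equilibria.

(** * Independent types and exponential bounds *)

Section density_measure.
Context {R : realType} d {S : measurableType d} (P : {measure set S -> \bar R}) (q : S -> R).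

Definition dens_measure (mq : measurable_fun setT q) (q0 : forall o, 0 <= q o) (G : set S) : \bar R :=
  (\int[P]_(o in G) (q o)%:E)%E.

Hypotheses (mq : measurable_fun setT q) (q0 : forall o, 0 <= q o).

Let dens_measure0 : dens_measure mq q0 set0 = 0%E. Proof. by rewrite /dens_measure integral_set0. Qed.

Let dens_measure_ge0 G : (0 <= dens_measure mq q0 G)%E.
Proof. by apply: integral_ge0 => o _; rewrite lee_fin. Qed.

Let dens_measure_sigma_additive : semi_sigma_additive (dens_measure mq q0).
Proof.
move=> F mF tF mUF.
have mqU : measurable_fun (\bigcup_n F n) (EFin \o q).
  by apply: measurable_funTS; exact/measurable_EFinP.
rewrite /dens_measure ge0_integral_bigcup//; last by move=> x _; rewrite lee_fin.
by apply: is_cvg_ereal_nneg_natsum_cond => n _ _; exact: dens_measure_ge0.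
Qed.

HB.instance Definition _ := isMeasure.Build _ _ _ (dens_measure mq q0) dens_measure0 dens_measure_ge0 dens_measure_sigma_additive.

End density_measure.

Lemma measurable_bigprod (R : realType) d (S : measurableType d) (I : Type) (s : seq I)
  (p : pred I) (h : I -> S -> R) : (forall i, measurable_fun setT (h i)) ->
  measurable_fun setT (fun x => \prod_(i <- s | p i) h i x).
Proof.
move=> mh; elim: s => [|i s ih]; first by under eq_fun do rewrite big_nil; exact: measurable_cst.
under eq_fun do rewrite big_cons.
by case: (p i) => //; exact: measurable_funM.
Qed.

Section independence.
Context {R : realType} {W : pseudoPMetricType R}.
Context dO {Om : measurableType dO} (P : probability Om R).
Variables (Ws : nat -> Om -> borel W) (l0 : probability (borel W) R).
Hypothesis hiid : iid P Ws l0.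

Let mWs i : measurable_fun setT (Ws i). Proof. by case: hiid. Qed.

Lemma iid_prod_indic n (B : 'I_n -> set (borel W)) : (forall i, measurable (B i)) ->
  (\int[P]_o (\prod_(i < n) \1_(B i) (Ws i o))%:E = (\prod_(i < n) fine (l0 (B i)))%:E)%E.
Proof.
move=> mB; have [_ hl hind] := hiid.
have mI : measurable (\bigcap_i (Ws (val (i : 'I_n)) @^-1` B i)).
  apply: fin_bigcap_measurable => // i _.
  by rewrite -[X in measurable X]setTI; exact: mWs.
transitivity (\int[P]_o (\1_(\bigcap_i (Ws (val (i : 'I_n)) @^-1` B i)) o)%:E)%E.
  apply: eq_integral => o _; congr EFin; rewrite indicE.
  have [h|h] := boolP (o \in _).
    by rewrite big1// => i _; rewrite indicE mem_set//; move/set_mem: h => /(_ i I).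
  have [i nB] : exists i : 'I_n, ~ B i (Ws i o).
    apply: contrapT => nh; move/negP: h; apply; apply/mem_set => i _.
    by apply: contrapT => nB; apply: nh; exists i.
  by rewrite (bigD1 i)//= indicE memNset// mul0r.
rewrite integral_indic// setIT; apply: (etrans (hind n (fun i : 'I_n => val i) B val_inj mB)).
rewrite -prodEFin; apply: eq_bigr => i _.
by rewrite fineK; [rewrite hl|rewrite fin_num_measure].
Qed.

(** [iid] speaks of rectangles only, that is, of products of indicators. The factors are freed one
    at a time. *)
Lemma iid_prod n (h : 'I_n -> borel W -> R) (c : 'I_n -> R) :
  (forall i, measurable_fun setT (h i)) -> (forall i w, 0 <= h i w) ->
  (forall i, \int[l0]_w (h i w)%:E = (c i)%:E)%E ->
  (\int[P]_o (\prod_(i < n) h i (Ws i o))%:E = (\prod_(i < n) c i)%:E)%E.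
Proof.
move=> mh h0 hc.
(* Induction on k, the number of leading factors that may be arbitrary. *)
suff H k : forall (h : 'I_n -> borel W -> R) (c : 'I_n -> R),
  (forall i, measurable_fun setT (h i)) -> (forall i w, 0 <= h i w) ->
  (forall i, \int[l0]_w (h i w)%:E = (c i)%:E)%E ->
  (forall i : 'I_n, (k <= i)%N -> exists2 B, measurable B & h i = \1_B) ->
  (\int[P]_o (\prod_(i < n) h i (Ws i o))%:E = (\prod_(i < n) c i)%:E)%E.
  by apply: (H n) => // i; rewrite leqNgt ltn_ord.
elim: k {h c mh h0 hc} => [|k ih] h c mh h0 hc hB.
  have /choice[B hB2] : forall i, exists B, measurable B /\ h i = \1_B.
    by move=> i; have [B mB hi] := hB i (leq0n i); exists B.
  under eq_integral do under eq_bigr do rewrite (hB2 _).2.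
  rewrite iid_prod_indic; last by move=> i; case: (hB2 i).
  congr EFin; apply: eq_bigr => i _.
  have := hc i; rewrite (hB2 i).2 integral_indic//; last by case: (hB2 i).
  by rewrite setIT => ->.
have [kn|nk] := ltnP k n; last first.
  by apply: ih => // i ki; apply: hB; move: (leq_trans nk ki); rewrite leqNgt ltn_ord.
pose k' := Ordinal kn.
have c0 i : 0 <= c i.
  by rewrite -lee_fin -hc integral_ge0// => w _; rewrite lee_fin.
pose Y o := \prod_(i < n | i != k') h i (Ws i o).
have mhW i : measurable_fun setT (fun o => h i (Ws i o)) by exact: measurableT_comp.
have mY : measurable_fun setT Y by exact: measurable_bigprod.
have Y0 o : 0 <= Y o by apply: prodr_ge0.
have C0 : 0 <= \prod_(i < n | i != k') c i by apply: prodr_ge0.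
under eq_integral do rewrite (bigD1 k')//= mulrC -/(Y _).
(* The other factors form the weight [Y]; under it the type k has law [l0] scaled by the product of
   the other constants. *)
rewrite (@integral_transfer _ _ _ Om (borel W) P (mscale (NngNum C0) l0) (Ws k) Y)//.
  rewrite ge0_integral_mscale//; last 2 first.
  - exact/measurable_EFinP.
  - by move=> w _; rewrite lee_fin.
  by rewrite hc -EFinM [in RHS](bigD1 k')//=; congr EFin; exact: mulrC.
move=> B mB.
pose h' i := if i == k' then \1_B else h i.
pose c' i := if i == k' then fine (l0 B) else c i.
transitivity (\int[P]_o (\prod_(i < n) h' i (Ws i o))%:E)%E.
  apply: eq_integral => o _; congr EFin; rewrite (bigD1 k')//= {1}/h' eqxx mulrC.
  by congr (_ * _); apply: eq_bigr => i ik; rewrite /h' (negbTE ik).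
rewrite (ih h' c').
- rewrite (bigD1 k')//= {1}/c' eqxx EFinM muleC fineK ?fin_num_measure//; congr (_ * _)%E.
  by congr EFin; apply: eq_bigr => i ik; rewrite /c' (negbTE ik).
- by move=> i; rewrite /h'; case: eqP.
- by move=> i w; rewrite /h'; case: eqP => // _; rewrite indicE.
- move=> i; rewrite /h' /c'; case: eqP => // _.
  by rewrite integral_indic// setIT fineK// fin_num_measure.
- move=> i ki; rewrite /h'; case: eqP => [_|/eqP ik]; first by exists B.
  apply: hB; rewrite ltn_neqAle ki andbT; apply: contra ik => /eqP e.
  by apply/eqP; apply: val_inj.
Qed.

End independence.

(** * Measurability of events about the empirical measure *)

Section events.
Context {R : realType} {W X : pseudoPMetricType R}.
Notation PMs := (PM W X).
Variables (bW : nat -> set W) (bX : nat -> set X).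
Hypotheses (hbW : cbase bW) (hbX : cbase bX).
Context dO {Om : measurableType dO} (P : probability Om R).
Variables (Ws : nat -> Om -> borel W).
Hypothesis mWs : forall i, measurable_fun setT (Ws i).
Variable (xhat : forall n : nat, ('I_n -> W) -> 'I_n -> X).
Hypothesis hxm : forall n (i : 'I_n) (B : set (borel X)), measurable B ->
  prodn_sigma (W:=W) (n:=n) ((fun v : 'I_n -> borel W => xhat v i) @^-1` B).

Lemma measurable_types n (D : set ('I_n -> borel W)) : prodn_sigma D ->
  measurable [set o | D (fun j : 'I_n => Ws j o)].
Proof.
move: D; apply: smallest_sub.
  split.
  - by rewrite (_ : mkset _ = set0)//.
  - move=> D mD; rewrite setTD (_ : mkset _ = ~` [set o | D (fun j : 'I_n => Ws j o)])//.
    exact: measurableC.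
  - move=> F mF; rewrite (_ : mkset _ = \bigcup_i [set o | F i (fun j : 'I_n => Ws j o)]).
      exact: bigcup_measurable.
    by apply/seteqP; split => o [i]; exists i.
move=> D [i _ [B mB <-]] /=.
have := mWs i measurableT mB; rewrite setTI.
by congr measurable; apply/seteqP; split => o //= [].
Qed.

Definition vec n (o : Om) : 'I_n -> WX W X :=
  prof (fun i : 'I_n => Ws i o) (xhat (fun j : 'I_n => Ws j o)).

Lemma measurable_vec n (i : 'I_n) : measurable_fun setT (fun o => vec o i).
Proof.
apply/measurable_fun_pairP; split; first exact: mWs.
move=> _ B mB; rewrite setTI.
exact: (measurable_types (hxm i mB)).
Qed.

(** Reduces membership of the empirical measure in an open set to a choice of one basic rectangle
    per atom. The choice is a finite function into nat, so there are countably many of them. *)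
Lemma emp_open n (U : set PMs) (v : 'I_n -> WX W X) : (0 < n)%N -> weak_open U -> U (emp v) ->
  let b := fun k => if unpickle k is Some (i, j) then bW i `*` bX j else set0 in
  exists2 B : {ffun 'I_n -> nat}, (forall i, b (B i) (v i)) &
    forall v' : 'I_n -> WX W X, (forall i, b (B i) (v' i)) -> U (emp v').
Proof.
move=> n0 oU Uv b; have hb : cbase b := cbase_prod hbW hbX.
have [k [fs [bf [e e0 h]]]] := oU _ Uv.
have hi (i : 'I_n) : exists j, b j (v i) /\ forall p, b j p -> forall l, `|fs l p - fs l (v i)| < e / 2.
  move: (v i : W * X)%type => q.
  have : nbhs q [set p | forall l, `|fs l p - fs l q| < e / 2].
    apply: (@filter_forall _ _ (fun l p => `|fs l p - fs l q| < e / 2) (nbhs q)) => l; have [cf _] := bf l.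
    have e20 : 0 < e / 2 by rewrite divr_gt0.
    have /cvgrPdist_lt/(_ _ e20) := cf q.
    by apply: filterS => p; rewrite distrC.
  rewrite nbhsE => -[V [oV Vv] VA]; have [j bj bV] := hb.2 _ _ oV Vv.
  by exists j; split => // p /bV /VA.
have [B hB] := choice hi.
exists [ffun i => B i]; first by move=> i; rewrite ffunE; case: (hB i).
move=> v' hv'; apply: h; rewrite (wnbhdE hbW hbX)// => l.
have bml : mbf (fs l : WX W X -> R).
  by have [cf bbf] := bf l; split => //; exact: (cont_measurable_WX hbW hbX).
rewrite /rint !rint_emp// -mulrBr -sumrB normrM ger0_norm ?invr_ge0//.
apply: (@le_lt_trans _ _ (e / 2)); last by rewrite ltr_pdivrMr//; lra.
rewrite mulrC ler_pdivrMr ?ltr0n//.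
rewrite (le_trans (ler_norm_sum _ _ _))//.
apply: (@le_trans _ _ (\sum_(i < n) (e / 2))).
  apply: ler_sum => i _; apply/ltW; have [_] := hB i; apply.
  by have := hv' i; rewrite ffunE.
by rewrite sumr_const card_ord -[leLHS]mulr_natr.
Qed.

Lemma measurable_mu n (A : set PMs) : (0 < n)%N -> weak_borel A ->
  measurable [set o | A (mu_n Ws xhat n o)].
Proof.
move=> n0; move: A; apply: smallest_sub.
  split.
  - by rewrite (_ : mkset _ = set0)//.
  - move=> D mD; rewrite setTD (_ : mkset _ = ~` [set o | D (mu_n Ws xhat n o)])//.
    exact: measurableC.
  - move=> F mF; rewrite (_ : mkset _ = \bigcup_i [set o | F i (mu_n Ws xhat n o)]).
      exact: bigcup_measurable.
    by apply/seteqP; split => o [i]; exists i.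
move=> U oU.
pose b := fun k => if unpickle k is Some (i, j) then bW i `*` bX j else set0.
have mb k : measurable (b k : set (WX W X)).
  by apply: (open_measurable_WX hbW hbX); case: (cbase_prod hbW hbX) => + _; apply.
pose D := [set B : {ffun 'I_n -> nat} | forall v' : 'I_n -> WX W X, (forall i, b (B i) (v' i)) -> U (emp v')].
pose FB (B : {ffun 'I_n -> nat}) :=
  if pselect (D B) then \bigcap_(i in [set: 'I_n]) [set o | b (B i) (vec o i)] else set0.
rewrite /= (_ : mkset _ = \bigcup_B FB B); last first.
  apply/seteqP; split => o /=.
    move=> /(emp_open n0 oU)[B h1 h2]; exists B => //; rewrite /FB; case: pselect => // _ i _.
    exact: h1.
  move=> [B _]; rewrite /FB; case: pselect => //= DB h.
  by apply: DB => i; exact: h.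
apply: countable_bigcupT_measurable; first exact: countableP.
move=> B; rewrite /FB; case: pselect => //= _; apply: fin_bigcap_measurable => // i _.
by have := measurable_vec i measurableT (mb (B i)); rewrite setTI.
Qed.

End events.

(** * Chernoff's bound under the tilted law *)

Section chernoff.
Context {R : realType} {W : pseudoPMetricType R}.
Context dO {Om : measurableType dO} (P : probability Om R).
Variables (Ws : nat -> Om -> borel W) (l0 l : probability (borel W) R).
Hypothesis hiid : iid P Ws l0.
Variable f : borel W -> R.
Hypothesis df : density l l0 f.

Let mWs i : measurable_fun setT (Ws i). Proof. by case: hiid. Qed.
Let mf : measurable_fun setT f. Proof. by case: df. Qed.
Let f0 w : 0 <= f w. Proof. by case: df. Qed.

Definition lik n o := \prod_(i < n) f (Ws i o).

Lemma measurable_lik n : measurable_fun setT (lik n).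
Proof. by apply: measurable_bigprod => i; exact: measurableT_comp. Qed.

Lemma lik_ge0 n o : 0 <= lik n o.
Proof. by apply: prodr_ge0 => i _. Qed.

(* The law under which the first n types are i.i.d. with law l. *)
Definition tilt n := dens_measure P (measurable_lik n) (lik_ge0 n).

(** The likelihood merges with the exponential moment: each factor f exp(g) integrates to Z under
    [l0], so the expectation is Z^n. The summand ln Z in the threshold cancels it and leaves exactly
    the rate r. *)
Lemma chernoff n (g : borel W -> R) (r : R) : mbf g ->
  (tilt n [set o | (n%:R * (r + ln (\int[l]_w expR (g w))) <= \sum_(i < n) g (Ws i o))%R] <=
    (expR (- (r * n%:R)))%:E)%E.
Proof.
move=> bg; have [mg _] := bg.
set Z := \int[l]_w expR (g w); have Z0 : 0 < Z by exact: int_exp_gt0.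
set c := n%:R * (r + ln Z).
have mgW i : measurable_fun setT (fun o => g (Ws i o)) by exact: measurableT_comp.
have mS : measurable_fun setT (fun o => \sum_(i < n) g (Ws i o)) by exact: measurable_sum.
set G := [set o | _].
have mG : measurable G.
  have := mS measurableT _ (measurable_itv `[c, +oo[); rewrite setTI.
  by congr measurable; apply/seteqP; split => o; rewrite /G /= in_itv/= andbT.
pose h (i : 'I_n) w := f w * expR (g w).
have mh i : measurable_fun setT (h i) by apply: measurable_funM => //; case: (mbf_exp bg).
have h0 i w : 0 <= h i w by rewrite mulr_ge0// expR_ge0.
have hE i : (\int[l0]_w (h i w)%:E = Z%:E)%E.
  by rewrite (density_mbf df (mbf_exp bg))// => w; exact: expR_ge0.
have := iid_prod hiid mh h0 hE.
rewrite prodr_const card_ord => HE.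
have mP : measurable_fun setT (fun o => \prod_(i < n) h i (Ws i o)).
  by apply: measurable_bigprod => i; exact: measurableT_comp.
apply: (@le_trans _ _ (\int[P]_(o in G) ((expR (- c))%:E * (\prod_(i < n) h i (Ws i o))%:E))%E).
  apply: ge0_le_integral => //.
  - by move=> o _; rewrite lee_fin lik_ge0.
  - by apply: measurable_funTS; apply/measurable_EFinP; exact: measurable_lik.
  - by apply: measurable_funTS; apply/measurable_EFinP; exact: measurable_funM.
  move=> o Go; rewrite -EFinM lee_fin big_split/= -expR_sum mulrCA -/(lik n o) -expRD.
  by rewrite ler_peMr ?lik_ge0// -expR0 ler_expR addrC subr_ge0.
apply: (@le_trans _ _ (\int[P]_o ((expR (- c))%:E * (\prod_(i < n) h i (Ws i o))%:E))%E).
  apply: ge0_subset_integral => //.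
  - by apply/measurable_EFinP; exact: measurable_funM.
  - by move=> o _; rewrite -EFinM lee_fin mulr_ge0 ?expR_ge0//; apply: prodr_ge0 => i _.
have mEP : measurable_fun setT (fun o => (\prod_(i < n) h i (Ws i o))%:E).
  exact/measurable_EFinP.
rewrite ge0_integralZl//; last by move=> o _; rewrite lee_fin; apply: prodr_ge0 => i _.
rewrite HE -EFinM lee_fin /c mulrDr opprD expRD -mulrA [r * _]mulrC.
have -> : expR (- (n%:R * ln Z)) * Z ^+ n = 1.
  by rewrite expRN expRM_natl lnK ?posrE// mulVf// gt_eqF// exprn_gt0.
by rewrite mulr1.
Qed.

Lemma tilt_setT n : tilt n setT = 1%E.
Proof.
have := iid_prod hiid (fun _ : 'I_n => mf) (fun _ : 'I_n => f0)
  (fun _ : 'I_n => density_int1 df : (_ = 1%:E)%E).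
by rewrite big1//; exact.
Qed.

End chernoff.

Section lyapunov.
Context {R : realType} {W : completePseudoMetricType R} {X : pseudoPMetricType R}.
Variables (bW : nat -> set W) (bX : nat -> set X).
Hypotheses (hbW : cbase bW) (hbX : cbase bX) (cX : compact [set: X]).
Variable u : nat -> W.
Hypothesis hu : forall x (e : R), 0 < e -> exists n, ball x e (u n).

Lemma mbf_fst (g : borel W -> R) : mbf g -> mbf (fun p : WX W X => g p.1).
Proof.
move=> [mg [K hK]]; split; last by exists K => p; exact: hK.
exact: (measurableT_comp mg (@measurable_fst _ _ (borel W) (borel X))).
Qed.

(* [Phi N] increases to j+1 off compacts K_j with l(~K_j) exponentially small. By the Donsker-Varadhan
   inequality, or by Chernoff's bound for empirical measures, this replaces exponential tightness. *)
Lemma exists_lyapunov (l : probability (borel W) R) : exists Phi : nat -> borel W -> R,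
  [/\ forall N, mbf (Phi N), forall N w, 0 <= Phi N w,
      forall w, {homo Phi ^~ w : m n / (m <= n)%N >-> m <= n},
      forall N, \int[l]_w expR (Phi N w) <= 2 &
      forall L : R, tight_set [set m : PM W X | forall N, \int[m]_p Phi N p.1 <= L]].
Proof.
(* The exponential offsets exp(a j) = exp(j + 1) off K_j, and the powers of 2 keep the sum below
   1. *)
pose e (j : nat) : R := expR (- j.+1%:R) / (2 ^ j.+1)%:R.
have e0 j : 0 < e j by rewrite divr_gt0 ?expR_gt0// ltr0n expn_gt0.
have hK j : exists K : set W, [/\ compact K, closed K & (l (~` K) <= (e j)%:E)%E].
  by have [K cK [clK lK]] := ulam_tight hu l (e0 j); exists K.
have [K hKs] := choice hK.
have mK j : measurable (~` K j : set (borel W)).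
  by apply: open_measurable_borel; rewrite openC; case: (hKs j).
pose a j (w : borel W) : R := j.+1%:R * \1_(~` K j) w.
pose Phi (N : nat) w := \big[Num.max/0]_(j < N) a j w.
have a0 j w : 0 <= a j w by rewrite mulr_ge0// indicE.
have ba j : mbf (a j) by apply: mbfZ; exact: mbf_indic.
have Phi0 N w : 0 <= Phi N w.
  by rewrite /Phi; elim/big_ind : _ => // x y x0 y0; rewrite le_max x0.
have bmax N (b : 'I_N -> borel W -> R) : (forall j, mbf (b j)) ->
    mbf (fun w => \big[Num.max/0]_(j < N) b j w).
  elim: N b => [|N ih] b bb; first by under eq_fun do rewrite big_ord0; exact: mbf_cst.
  under eq_fun do rewrite big_ord_recl.
  have [m1 [k1 h1]] := bb ord0.
  have [m2 [k2 h2]] := ih _ (fun j => bb (lift ord0 j)).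
  split; first exact: measurable_maxr.
  exists (Num.max k1 k2) => w; rewrite le_max.
  by case: (leP (b ord0 w) (\big[Num.max/0]_(i < N) b (lift ord0 i) w)) => _; rewrite ?h1 ?h2 ?orbT.
have bPhi N : mbf (Phi N) by apply: (bmax N (fun j => a j)) => j; exact: ba.
have aPhi j N w : (j < N)%N -> a j w <= Phi N w.
  by move=> jN; exact: (@le_bigmax _ _ _ _ (fun j : 'I_N => a j w) (Ordinal jN)).
exists Phi; split => //.
- move=> w m n mn; apply: bigmax_le => // i _.
  by apply: aPhi; exact: leq_trans mn.
- move=> N.
  have ptw w : expR (Phi N w) <= 1 + \sum_(j < N) expR j.+1%:R * \1_(~` K j) w.
    suff [] : expR (Phi N w) <= 1 + \sum_(j < N) expR j.+1%:R * \1_(~` K j) w /\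
        0 <= \sum_(j < N) expR j.+1%:R * \1_(~` K j) w :> R by [].
    rewrite /Phi; elim/big_ind2 : _ => [|x y x' y' [h1 h2] [h3 h4]|j _].
    - by rewrite expR0 addr0.
    - split; last by rewrite addr_ge0.
      by case: (leP y y') => _; [move: h2 h3|move: h1 h4]; lra.
    - split; last by rewrite mulr_ge0 ?expR_ge0// indicE.
      rewrite /a indicE; case: (_ \in _); first by rewrite !mulr1 lerDr.
      by rewrite !mulr0 expR0 addr0.
  have bs j : mbf (fun w : borel W => expR j.+1%:R * \1_(~` K j) w : R).
    by apply: mbfZ; exact: mbf_indic.
  have bS : mbf (fun w : borel W => \sum_(j < N) expR j.+1%:R * \1_(~` K j) w : R).
    by apply: mbf_sum => j; exact: bs.
  apply: (@le_trans _ _ (\int[l]_w (1 + \sum_(j < N) expR j.+1%:R * \1_(~` K j) w))).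
    by apply: mbf_int_le => //; [exact: mbf_exp|apply: mbfD => //; exact: mbf_cst].
  rewrite mbf_intD//; last exact: mbf_cst.
  rewrite Rintegral_prob_cst -[leRHS]/(1 + 1) lerD2l mbf_int_sum//.
  have geo n : \sum_(j < n) ((2 ^ j.+1)%:R^-1 : R) <= 1 - (2 ^ n)%:R^-1.
    elim: n => [|n ih]; first by rewrite big_ord0 expn0 invr1 subrr.
    rewrite big_ord_recr/=; apply: (le_trans (lerD ih (lexx _))).
    rewrite expnS natrM invfM; set t := (2 ^ n)%:R^-1; lra.
  apply: (@le_trans _ _ (\sum_(j < N) ((2 ^ j.+1)%:R^-1 : R))); last first.
    by apply: (le_trans (geo N)); rewrite lerBlDr lerDl invr_ge0.
  apply: ler_sum => j _; rewrite mbf_intZ; last exact: mbf_indic.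
  rewrite mbf_int_indic//.
  have [_ _ hl] := hKs j.
  have : fine (l (~` K j)) <= e j.
    by rewrite -lee_fin fineK// fin_num_measure.
  move=> /(ler_wpM2l (expR_ge0 j.+1%:R)) /le_trans; apply.
  by rewrite /e mulrA -expRD subrr expR0 mul1r.
- move=> L eps eps0.
  (* Markov's inequality: off K_j the function Phi is at least j + 1, so the mass there is at most
     |L| / (j + 1). *)
  have [j Lj] : exists j : nat, `|L| / j.+1%:R <= eps.
    exists (Num.truncn (`|L| / eps)); rewrite ler_pdivrMr// mulrC -ler_pdivrMr// ltW//.
    exact: truncnS_gt.
  have [cK clK _] := hKs j.
  exists (K j `*` setT); first exact: compact_setX.
  move=> m f mT bf f0 f1.
  have bfm := bcont_mbf hbW hbX bf.
  have b1 : mbf (fun p : WX W X => - j.+1%:R^-1 * Phi j.+1 p.1).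
    by apply: mbfZ; apply: mbf_fst; exact: bPhi.
  apply: (@le_trans _ _ (\int[m]_p (- j.+1%:R^-1 * Phi j.+1 p.1))).
    rewrite mbf_intZ; last by apply: mbf_fst; exact: bPhi.
    rewrite mulNr lerN2 (le_trans _ Lj)// mulrC ler_wpM2r ?invr_ge0//.
    by rewrite (le_trans (mT _))// ler_norm.
  apply: mbf_int_le => // p.
  have [Kp|nKp] := pselect (K j p.1).
    by rewrite (le_trans _ (f0 _ _))// mulNr oppr_le0 mulr_ge0 ?invr_ge0.
  rewrite (le_trans _ (f1 p))// mulNr lerN2 mulrC ler_pdivlMr// mul1r.
  rewrite (le_trans _ (aPhi j j.+1 p.1 (leqnn _)))//.
  by rewrite /a indicE mem_set// mulr1.
Qed.

End lyapunov.

Lemma bump_eq_prob (R : realType) (T : pseudoPMetricType R) (m1 m2 : probability (borel T) R) (U : set T) :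
  open U -> (forall k, \int[m1]_(x in [set: borel T]) bump U k x = \int[m2]_(x in [set: borel T]) bump U k x) ->
  m1 (U : set (borel T)) = m2 (U : set (borel T)).
Proof.
move=> oU h; have mU : measurable (U : set (borel T)) by exact: open_measurable_borel.
have cv (mu : probability (borel T) R) :
    \int[mu]_(x in [set: borel T]) bump U k x @[k --> \oo] --> fine (mu (U : set (borel T))).
  rewrite -(mbf_int_indic mu mU).
  apply: (@bounded_cvg_int _ _ _ mu _ _ 1).
  - by move=> k; have [] := bcf_mbf (bcf_bump U k).
  - by move=> k p; rewrite ger0_norm ?bump_le1// bump_ge0.
  - by have [] := mbf_indic (R := R) mU.
  - by move=> p; exact: bump_cvg.
have := cv m1; under eq_fun do rewrite h.
move=> /(cvg_unique (@Rhausdorff R) (cv m2)) e.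
by rewrite -[LHS]fineK ?fin_num_measure// -e fineK// fin_num_measure.
Qed.

Lemma bcf_eq_prob (R : realType) (T : pseudoPMetricType R) (m1 m2 : probability (borel T) R) :
  (forall g, bcf g -> \int[m1]_(x in [set: borel T]) g x = \int[m2]_(x in [set: borel T]) g x) ->
  forall B : set (borel T), measurable B -> m1 B = m2 B.
Proof.
move=> h.
have hU U : open U -> m1 (U : set (borel T)) = m2 (U : set (borel T)).
  by move=> oU; apply: bump_eq_prob => // k; apply: h; exact: bcf_bump.
apply: (@measure_unique _ R (borel T) (@open T) (fun=> setT)) => //.
- by move=> A B; exact: openI.
- by move=> _; exact: openT.
- by apply/seteqP; split => // x _; exists 0%N.
- by move=> k; rewrite ltey_eq fin_num_measure.
Qed.

(** * Marginals on the type space *)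

Section marginal.
Context {R : realType} {W X : pseudoPMetricType R}.
Notation PMs := (PM W X).

Definition marg (m : PMs) : probability (borel W) R := pushprob m (@measurable_fst _ _ (borel W) (borel X)).

Lemma marg_isP (m : PMs) : marg_is m (marg m).
Proof.
move=> B mB; rewrite /= /pushprob /pushforward; congr (m _).
by apply/seteqP; split => -[x y] //= [].
Qed.

Lemma marg_is_eq (m : PMs) l : marg_is m l <-> forall B, measurable B -> marg m B = l B.
Proof. by split => h B mB; [rewrite -marg_isP// h|rewrite marg_isP// h]. Qed.

Lemma Rintegral_marg (m : PMs) (g : borel W -> R) : mbf g -> \int[marg m]_w g w = \int[m]_p g p.1.
Proof. by move=> [mg bg]; rewrite Rintegral_pushprob. Qed.

(** If [DV] is nowhere positive, test it on g / (k + 1) and use ln z <= z - 1: dividing by the scale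
    and letting k grow gives the integral of g under the marginal at most that under l. Replacing g
    by -g yields equality. *)
Lemma not_marg_DV (m : PMs) (l : probability (borel W) R) : ~ marg_is m l ->
  exists2 g, bcf g & 0 < DV (marg m) l g.
Proof.
move=> nml; apply: contrapT => nh; apply: nml; apply/marg_is_eq.
have DV0 g : bcf g -> DV (marg m) l g <= 0.
  by move=> bg; rewrite leNgt; apply/negP => h; apply: nh; exists g.
have le_int g : bcf g -> \int[marg m]_(w in [set: borel W]) g w <= \int[l]_(w in [set: borel W]) g w.
  move=> bg; have [_ [K hK]] := bg; have bgm := bcf_mbf bg.
  (* From exp t - 1 <= t exp t; after division by the scale this dominates and tends to g. *)
  pose ge (k : nat) w := g w * expR (k.+1%:R^-1 * g w).
  have bZ (k : nat) : bcf (fun w => k.+1%:R^-1 * g w) by exact: bcfZ.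
  have h k : \int[marg m]_(w in [set: borel W]) g w <= \int[l]_(w in [set: borel W]) ge k w.
    have e0 : 0 < k.+1%:R^-1 :> R by rewrite invr_gt0.
    have bE := mbf_exp (bcf_mbf (bZ k)).
    have bge : mbf (ge k : borel W -> R) by apply: mbfM.
    have := DV0 _ (bZ k); rewrite /DV mbf_intZ// subr_le0 => h1.
    rewrite -(ler_pM2l e0); apply: (le_trans h1).
    apply: (@le_trans _ _ (\int[l]_w expR (k.+1%:R^-1 * g w) - 1)).
      set Z := \int[l]_x _; have Z0 : 0 < Z by apply: int_exp_gt0; exact: bcf_mbf.
      rewrite [X in ln X](_ : Z = 1 + (Z - 1)); last by ring.
      by rewrite le_ln1Dx//; move: Z0; lra.
    rewrite -[X in _ - X](Rintegral_prob_cst l) -mbf_intB//; last exact: mbf_cst.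
    rewrite -mbf_intZ//; apply: mbf_int_le.
    - by apply: mbfB => //; exact: mbf_cst.
    - exact: mbfZ.
    move=> w; rewrite /ge mulrA; set t := _ * g w.
    have := expR_ge1Dx (- t); rewrite expRN => h2.
    have := ler_wpM2r (expR_ge0 t) h2; rewrite mulVf ?gt_eqF ?expR_gt0//; lra.
  have cge : \int[l]_(w in [set: borel W]) ge k w @[k --> \oo] --> \int[l]_(w in [set: borel W]) g w.
    apply: (@bounded_cvg_int _ _ _ l _ _ (K * expR K)).
    - by move=> k; have [] := mbfM bgm (mbf_exp (bcf_mbf (bZ k))).
    - move=> k w; rewrite /ge normrM ler_pM// ger0_norm ?expR_ge0// ler_expR.
      apply: (le_trans (ler_norm _)); rewrite normrM ger0_norm ?invr_ge0//.
      by rewrite (le_trans _ (hK w))// ler_piMl// invf_le1// ler1n.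
    - by have [] := bgm.
    - move=> w; have -> : g w = g w * expR (0 * g w) by rewrite mul0r expR0 mulr1.
      apply: cvgM; first exact: cvg_cst.
      apply: continuous_cvg; first exact: continuous_expR.
      by apply: cvgM; [exact: cvg_harmonic|exact: cvg_cst].
  apply: (@closed_cvg _ _ \oo _ _ [set r | _ <= r] (@closed_ge _ _) _ _ cge).
  by apply: nearW => k; exact: h.
move=> B mB; apply: bcf_eq_prob mB => g bg.
apply/eqP; rewrite eq_le le_int//=.
have := le_int _ (bcfZ (-1) bg); rewrite !mbf_intZ ?mulN1r ?lerN2//; exact: bcf_mbf.
Qed.

End marginal.

Lemma measure_bigU_le d (T : measurableType d) (R : realType) (nu : {measure set T -> \bar R})
    k (E : 'I_k -> set T) : (forall j, measurable (E j)) ->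
  (nu (\big[setU/set0]_(j < k) E j) <= \sum_(j < k) nu (E j))%E.
Proof.
move=> mE; suff [] : measurable (\big[setU/set0]_(j < k) E j) /\
  (nu (\big[setU/set0]_(j < k) E j) <= \sum_(j < k) nu (E j))%E by [].
elim/big_rec2 : _ => [|j s D _ [mD leD]]; first by rewrite measure0; split.
split; first exact: measurableU.
apply: (@le_trans _ _ (nu (E j) + nu D)%E); last exact: leeD2l.
exact: measureU2.
Qed.

Section weak_borel.
Context {R : realType} {W X : pseudoPMetricType R}.

Lemma weak_borelC (U : set (PM W X)) : weak_borel U -> weak_borel (~` U).
Proof. by move=> bU; rewrite -setTD; apply: sigma_algebraCD. Qed.

Lemma weak_borelI (U V : set (PM W X)) : weak_borel U -> weak_borel V -> weak_borel (U `&` V).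
Proof.
move=> bU bV; rewrite -[U `&` V]setCK setCI; apply: weak_borelC.
rewrite -bigcup2E; apply: sigma_algebra_bigcup => -[|[|n]] /=.
- exact: weak_borelC.
- exact: weak_borelC.
- exact: sigma_algebra0.
Qed.

End weak_borel.

(** * The large deviation upper bound *)

Section large_deviations.
Context {R : realType} {W : completePseudoMetricType R} {X : pseudoPMetricType R}.
Notation PMs := (PM W X).
Variables (bW : nat -> set W) (bX : nat -> set X).
Hypotheses (hbW : cbase bW) (hbX : cbase bX) (cX : compact [set: X]).
Variable u : nat -> W.
Hypothesis hu : forall x (e : R), 0 < e -> exists n, ball x e (u n).
Variables (C : W -> set X) (F : PMs -> W -> X -> R).
Hypotheses (hC : corr_cont C) (hF : F_bcont F).
Context dO {Om : measurableType dO} (P : probability Om R).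
Variables (Ws : nat -> Om -> borel W) (l0 : probability (borel W) R).
Hypothesis hiid : iid P Ws l0.
Variable (xhat : forall n : nat, ('I_n -> W) -> 'I_n -> X).
Hypothesis hxm : forall n (i : 'I_n) (B : set (borel X)), measurable B ->
  prodn_sigma (W:=W) (n:=n) ((fun v : 'I_n -> borel W => xhat v i) @^-1` B).
Hypothesis hnash : forall n (w : 'I_n -> W), nash F C w (xhat w).

Let mu := mu_n Ws xhat.

Let mWs i : measurable_fun setT (Ws i). Proof. by case: hiid. Qed.

Let meas_mu n (A : set PMs) : (0 < n)%N -> weak_borel A -> measurable [set o | A (mu n o)].
Proof. exact: (measurable_mu hbW hbX mWs hxm). Qed.

Let weak_borel_open (U : set PMs) : weak_open U -> weak_borel U.
Proof. by move=> oU; exact: sub_sigma_algebra. Qed.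

Lemma nash_excluded m : ~ in_M C F m -> exists U N, [/\ weak_open U, U m &
  forall n o, (0 < n)%N -> (N <= n)%N -> ~ U (mu n o)].
Proof.
move=> nM; apply: contrapT => nU; apply: nM; apply: (quasi_limit hbW hbX hC hF).
move=> U d oU Um d0; apply: contrapT => nq; apply: nU.
exists U, (Num.truncn (2 / d)).+1; split => // n o n0 Nn Uo; apply: nq.
exists (mu n o), (2 / n%:R); split => //.
  rewrite divr_ge0//= ler_pdivrMr ?ltr0n// mulrC -ler_pdivrMr//.
  by rewrite (le_trans (ltW (truncnS_gt _)))// ler_nat.
exact: (nash_quasi hbW hbX n0 (hnash _)).
Qed.

Section tilted.
Variables (l : probability (borel W) R) (f : borel W -> R).
Hypothesis df : density l l0 f.

Let Q n := tilt hiid df n.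

Let mS (g : borel W -> R) n (c : R) : measurable_fun setT g ->
  measurable [set o | c <= \sum_(i < n) g (Ws i o)].
Proof.
move=> mg.
have mSg : measurable_fun setT (fun o => \sum_(i < n) g (Ws i o)).
  by apply: measurable_sum => i; exact: measurableT_comp.
have := mSg measurableT _ (measurable_itv `[c, +oo[); rewrite setTI.
by congr measurable; apply/seteqP; split => o; rewrite /= in_itv/= andbT.
Qed.

Let int_mu_fst n o (g : borel W -> R) : (0 < n)%N -> mbf g ->
  \int[mu n o]_p g p.1 = n%:R^-1 * \sum_(i < n) g (Ws i o).
Proof. by move=> n0 bg; rewrite /mu /mu_n rint_emp//; exact: mbf_fst. Qed.

(** Each neighbourhood of the finite cover has its own rate above r, so their minimum r2 is above r.
    The midpoint r' leaves room for the factor k + 1 that counts the events. *)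
Lemma ld_upper (B : set PMs) (r : R) : weak_open (~` B) -> 0 <= r ->
  (forall m, B m -> in_M C F m -> exists2 g, bcf g & r < DV (marg m) l g) ->
  exists2 r', r < r' & \forall n \near \oo, (Q n [set o | B (mu n o)] <= (expR (- (r' * n%:R)))%:E)%E.
Proof.
move=> cB r0 hB.
have bB : weak_borel B by rewrite -[B]setCK; apply: weak_borelC; exact: weak_borel_open.
have [Phi [bPhi Phi0 Phim PhiE Phit]] := exists_lyapunov hbW hbX cX hu l.
(* Since ln of the integral of exp(Phi N) is at most ln 2 <= 1, the event outside T has rate at
   least r + 1. *)
pose L := r + 2.
have tT := Phit L; set T := [set m | _] in tT.
pose G (U : set PMs) := weak_open U /\ exists r1, r < r1 /\ exists N, forall n, (0 < n)%N -> (N <= n)%N ->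
  (Q n [set o | (B `&` U) (mu n o)] <= (expR (- (r1 * n%:R)))%:E)%E.
have G0 (U : set PMs) N : weak_open U ->
    (forall n o, (0 < n)%N -> (N <= n)%N -> ~ (B `&` U) (mu n o)) -> G U.
  move=> oU h; split => //; exists (r + 1); split; first by rewrite ltrDl.
  exists N => n n0 Nn.
  have -> : [set o | (B `&` U) (mu n o)] = set0.
    by apply/seteqP; split => // o /= hh; exact: (h n o).
  have -> : Q n set0 = 0%E by exact: measure0.
  by rewrite lee_fin expR_ge0.
have Gcov m : exists2 U, G U & U m.
  have [Bm|nBm] := pselect (B m); last first.
    by exists (~` B) => //; apply: (@G0 _ 0%N) => // n o _ _ [].
  have [Mm|nMm] := pselect (in_M C F m); last first.
    have [U [N [oU Um hU]]] := nash_excluded nMm.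
    by exists U => //; apply: (@G0 _ N) => // n o n0 Nn [_]; exact: hU.
  have [g bg rg] := hB m Bm Mm; have bgm := bcf_mbf bg.
  have bg1 : bcont (fun p : W * X => g p.1).
    have [cg [K hK]] := bg; split; last by exists K => p; exact: hK.
    by move=> p; apply: continuous_comp; [exact: cvg_fst|exact: cg].
  set Z := ln (\int[l]_w expR (g w)).
  pose r1 := (r + DV (marg m) l g) / 2.
  exists [set m' | r1 + Z < rint m' (fun p => g p.1)]; last first.
    rewrite /= /rint -(Rintegral_marg m bgm).
    by move: rg; rewrite /r1 /DV -/Z; lra.
  split; first exact: (weak_open_rint_gt hbW hbX).
  exists r1; split; first by rewrite /r1; move: rg; lra.
  exists 0%N => n n0 _; apply: le_trans (chernoff hiid df n r1 bgm).
  apply: le_measure; rewrite ?inE.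
  - apply: meas_mu => //; apply: weak_borelI => //.
    by apply: weak_borel_open; exact: (weak_open_rint_gt hbW hbX).
  - by apply: mS; case: bgm.
  move=> o /= [_]; rewrite /rint int_mu_fst// mulrC ltr_pdivlMr ?ltr0n// => /ltW.
  by rewrite mulrC.
have [k [gs [Ggs Tgs]]] := tight_cover hbW hbX tT (fun U GU => proj1 GU) Gcov.
have [rs hrs] := choice (fun j => (Ggs j).2).
have [Ns hNs] := choice (fun j => (hrs j).2).
(* The initial value r + 1 is the rate of the event outside T. *)
pose r2 := \big[Num.min/(r + 1)]_(j < k) rs j.
have r2r : r < r2.
  rewrite /r2; elim/big_ind : _; first by rewrite ltrDl.
    by move=> x y rx ry; rewrite lt_min rx ry.
  by move=> j _; case: (hrs j).
pose N0 := \max_(j < k) Ns j.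
pose r' := (r + r2) / 2.
have r'r : r < r' by rewrite /r'; move: r2r; lra.
have r2r' : 0 < r2 - r' by rewrite /r'; move: r2r; lra.
exists r' => //.
have near1 : \forall n \near \oo, k.+1%:R <= expR ((r2 - r') * n%:R) :> R.
  near=> n; apply: (@le_trans _ _ ((r2 - r') * n%:R)); last first.
    by have := expR_ge1Dx ((r2 - r') * n%:R); lra.
  rewrite mulrC -ler_pdivrMr// (le_trans (ltW (truncnS_gt _)))// ler_nat.
  near: n; exact: nbhs_infty_ge.
near=> n.
have n0 : (0 < n)%N by near: n; exact: nbhs_infty_gt.
have nN0 : (N0 <= n)%N by near: n; exact: nbhs_infty_ge.
have kn : k.+1%:R <= expR ((r2 - r') * n%:R) :> R by near: n.
pose TC N := [set o | n%:R * L <= \sum_(i < n) Phi N (Ws i o)].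
have mTC N : measurable (TC N) by apply: mS; case: (bPhi N).
(* Leaving T means exceeding L for some N. These events increase with N and their bound is uniform,
   so continuity from below replaces a union bound. *)
have QT : (Q n (\bigcup_N TC N) <= (expR (- ((r + 1) * n%:R)))%:E)%E.
  have ndTC : nondecreasing_seq TC.
    move=> N M NM; apply/subsetPset => o TCo; apply: (le_trans TCo).
    by apply: ler_sum => i _; exact: Phim.
  have cv := @nondecreasing_cvg_mu _ _ _ (Q n) TC mTC (bigcup_measurable (fun N _ => mTC N)) ndTC.
  have eQ : (Q n (\bigcup_N TC N) <= limn (Q n \o TC))%E.
    by have -> : limn (Q n \o TC) = Q n (\bigcup_N TC N) by exact: cvg_lim cv.
  apply: (le_trans eQ).
  apply: lime_le; first by apply/cvg_ex; exists (Q n (\bigcup_N TC N)).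
  apply: nearW => N; have := chernoff hiid df n (L - ln (\int[l]_w expR (Phi N w))) (bPhi N).
  rewrite subrK => /le_trans; apply.
  rewrite lee_fin ler_expR lerN2 ler_wpM2r//.
  have : ln (\int[l]_w expR (Phi N w)) <= 1.
    apply: (@le_trans _ _ (ln 2)).
      by rewrite ler_ln ?posrE//; exact: int_exp_gt0.
    by have := @le_ln1Dx R 1; rewrite -[1 + 1]/2; apply; lra.
  by rewrite /L; lra.
pose EB j := [set o | (B `&` gs j) (mu n o)].
have mEB j : measurable (EB j).
  by apply: meas_mu => //; apply: weak_borelI => //; apply: weak_borel_open; case: (Ggs j).
have mEB' : measurable (\big[setU/set0]_(j < k) EB j) by apply: bigsetU_measurable => j _.
have sub : [set o | B (mu n o)] `<=` (\bigcup_N TC N) `|` \big[setU/set0]_(j < k) EB j.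
  move=> o /= Bo; have [To|nTo] := pselect (T (mu n o)).
    right; have [j _ gj] := Tgs _ To; by rewrite (bigD1 j)//=; left.
  left; move/existsNP: nTo => [N /negP]; rewrite -ltNge int_mu_fst// => h.
  exists N => //; rewrite /TC /= ltW//.
  by move: h; rewrite mulrC ltr_pdivlMr ?ltr0n// mulrC.
apply: (@le_trans _ _ (Q n ((\bigcup_N TC N) `|` \big[setU/set0]_(j < k) EB j))).
  apply: le_measure sub; rewrite ?inE; first exact: meas_mu.
  by apply: measurableU => //; exact: bigcup_measurable.
apply: le_trans (measureU2 _ _ _) _ => //; first exact: bigcup_measurable.
apply: (@le_trans _ _ ((expR (- (r2 * n%:R)))%:E + \sum_(j < k) (expR (- (r2 * n%:R)))%:E)%E).
  apply: leeD.
    apply: (le_trans QT); rewrite lee_fin ler_expR lerN2 ler_wpM2r//.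
    exact: bigmin_le_id.
  apply: le_trans (measure_bigU_le _ mEB) _.
  apply: lee_sum => j _.
  apply: (le_trans (hNs j n n0 _)).
    by apply: leq_trans nN0; exact: leq_bigmax.
  by rewrite lee_fin ler_expR lerN2 ler_wpM2r//; exact: bigmin_le.
rewrite sumEFin -EFinD lee_fin sumr_const card_ord -mulrS.
rewrite -[leLHS]mulr_natl.
apply: le_trans (ler_wpM2r (expR_ge0 _) kn) _.
by rewrite -expRD ler_expR; lra.
Unshelve. all: by end_near. Qed.

End tilted.
End large_deviations.

(** * Relative entropy of the tilted law *)

Section tilted_entropy.
Context {R : realType} {W : pseudoPMetricType R}.
Context dO {Om : measurableType dO} (P : probability Om R).
Variables (Ws : nat -> Om -> borel W) (l0 l : probability (borel W) R).
Hypothesis hiid : iid P Ws l0.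
Variable f : borel W -> R.
Hypothesis df : density l l0 f.

Let mWs i : measurable_fun setT (Ws i). Proof. by case: hiid. Qed.
Let mf : measurable_fun setT f. Proof. by case: df. Qed.
Let f0 w : 0 <= f w. Proof. by case: df. Qed.

Let rest n (i : 'I_n) o := \prod_(j < n | j != i) f (Ws j o).

Let rest0 n (i : 'I_n) o : 0 <= rest i o. Proof. exact: prodr_ge0. Qed.

Let mrest n (i : 'I_n) : measurable_fun setT (rest i).
Proof. by apply: measurable_bigprod => j; exact: measurableT_comp. Qed.

Let int_rest n (i : 'I_n) (h : borel W -> R) (c : R) : measurable_fun setT h ->
  (forall w, 0 <= h w) -> (\int[l0]_w (h w)%:E = c%:E)%E ->
  (\int[P]_o (rest i o * h (Ws i o))%:E = c%:E)%E.
Proof.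
move=> mh h0 hc.
have := @iid_prod _ _ _ _ _ _ _ hiid n (fun j => if j == i then h else f) (fun j => if j == i then c else 1).
rewrite [X in _ = X%:E](bigD1 i)//= eqxx big1 ?mulr1; last by move=> j /negbTE ->.
move=> <-.
- apply: eq_integral => o _; rewrite [in RHS](bigD1 i)//= eqxx mulrC; congr (_ * _)%:E.
  by apply: eq_bigr => j /negbTE ->.
- by move=> j; case: eqP.
- by move=> j w; case: eqP.
- by move=> j; case: eqP => // _; exact: density_int1 df.
Qed.

Let lik_rest n (i : 'I_n) o : lik Ws f n o = rest i o * f (Ws i o).
Proof. by rewrite /lik (bigD1 i)//= mulrC. Qed.

(** In this form each summand pairs a function of one type with a weight independent of it, which
    [int_rest] integrates. A vanishing likelihood makes both sides 0, so ln is split only over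
    positive factors. *)
Let lik_ln n o :
  lik Ws f n o * ln (lik Ws f n o) = \sum_(i < n) rest i o * (f (Ws i o) * ln (f (Ws i o))).
Proof.
under eq_bigr do rewrite mulrA -lik_rest.
rewrite -mulr_sumr; have [->|q0] := eqVneq (lik Ws f n o) 0; first by rewrite !mul0r.
congr (_ * _); rewrite /lik in q0 *.
have : forall i : 'I_n, 0 < f (Ws i o).
  by move=> i; rewrite lt_neqAle f0 eq_sym andbT; apply: contra q0; move=> /eqP fi; rewrite (bigD1 i)//= fi mul0r.
elim: {q0} n => [|n ih] fp; first by rewrite !big_ord0 ln1.
have pp : 0 < \prod_(i < n) f (Ws i o).
  by elim/big_ind : _ => // [x y|i _]; [exact: mulr_gt0|exact: fp (widen_ord (leqnSn n) i)].
rewrite !big_ord_recr/= lnM ?posrE//; last exact: fp ord_max.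
by rewrite ih// => i; exact: fp (widen_ord (leqnSn n) i).
Qed.

Lemma tilt_fin_num n (E : set Om) : measurable E -> tilt hiid df n E \is a fin_num.
Proof.
move=> mE; rewrite ge0_fin_numE; last exact: measure_ge0.
apply: (@le_lt_trans _ _ 1%E); last exact: ltry.
rewrite -(tilt_setT hiid df n); apply: le_measure; rewrite ?inE//; exact: measurableT.
Qed.

(* The Gibbs variational inequality for the n-fold tilted law, tested on [s * \1_E]. *)
Lemma tilt_entropy n (E : set Om) (H s : R) : measurable E -> 0 <= s ->
  (\int[l0]_w (f w * ln (f w))%:E = H%:E)%E ->
  s * fine (tilt hiid df n E) <= H * n%:R + ln (1 + (expR s - 1) * fine (P E)).
Proof.
move=> mE s0 hH.
(* Z is the integral of exp(s 1_E) under P. *)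
set p := fine (P E); set Z := 1 + _.
have p0 : 0 <= p by exact: fine_ge0.
have es : 1 <= expR s by have := expR_ge1Dx s; lra.
have Z1 : 1 <= Z by rewrite /Z lerDl mulr_ge0// subr_ge0.
have Z0 : 0 < Z by lra.
have lZ : 0 <= ln Z by rewrite ln_ge0.
pose q := lik Ws f n.
have mq : measurable_fun setT q := measurable_lik hiid df n.
have q0 o : 0 <= q o := lik_ge0 Ws df n o.
have m1 : measurable_fun setT (\1_E : Om -> R) by exact: measurable_indic.
have i0 o : 0 <= \1_E o :> R by rewrite indicE.
(* Shifting each of the n entropy terms by 1 adds the sum of the [rest i], of integral n, to both
   sides and keeps all integrands nonnegative. *)
pose h w := f w * ln (f w) + 1.
have mh : measurable_fun setT h.
  by apply: measurable_funD => //; apply: measurable_funM => //; exact: measurableT_comp.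
have h0 w : 0 <= h w by exact: xlnx_geN1.
have ih : (\int[l0]_w (h w)%:E = (H + 1)%:E)%E.
  rewrite int_shift1 ?hH//.
  by apply: measurable_funM => //; exact: measurableT_comp.
have int1 : (\int[P]_o (q o)%:E = 1)%E by exact: (tilt_setT hiid df n).
have int2 : (\int[P]_o (s * (q o * \1_E o))%:E = (s * fine (tilt hiid df n E))%:E)%E.
  under eq_integral do rewrite EFinM; rewrite ge0_integralZl//; last 2 first.
  - by apply/measurable_EFinP; exact: measurable_funM.
  - by move=> o _; rewrite lee_fin mulr_ge0.
  have <- : tilt hiid df n E = (\int[P]_o (q o * \1_E o)%:E)%E.
    rewrite /tilt /dens_measure integral_mkcond; apply: eq_integral => o _.
    by rewrite patchE indicE; case: (o \in E); rewrite ?mulr1 ?mulr0.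
  by rewrite EFinM fineK//; exact: tilt_fin_num.
have int3 : (\int[P]_o (\sum_(i < n) rest i o)%:E = n%:R%:E)%E.
  under eq_integral do rewrite -sumEFin.
  rewrite ge0_integral_sum//; last 2 first.
  - by move=> i; exact/measurable_EFinP.
  - by move=> i o _; rewrite lee_fin.
  rewrite (eq_bigr (fun=> 1%:E)); first by rewrite sumEFin sumr_const card_ord.
  move=> i _; have := @int_rest n i (cst 1) 1 (measurable_cst _) (fun=> ler01) (prob_int_cst _ _).
  by move=> <-; apply: eq_integral => o _; rewrite mulr1.
have int4 : (\int[P]_o (\sum_(i < n) rest i o * h (Ws i o))%:E = (n%:R * (H + 1))%:E)%E.
  under eq_integral do rewrite -sumEFin.
  rewrite ge0_integral_sum//; last 2 first.
  - by move=> i; apply/measurable_EFinP; apply: measurable_funM => //; exact: measurableT_comp.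
  - by move=> i o _; rewrite lee_fin mulr_ge0.
  rewrite (eq_bigr (fun=> (H + 1)%:E)); first by rewrite sumEFin sumr_const card_ord mulr_natl.
  by move=> i _; exact: int_rest.
have int5 : (\int[P]_o (q o * ln Z)%:E = (ln Z)%:E)%E.
  under eq_integral do rewrite mulrC EFinM.
  rewrite ge0_integralZl//; [by rewrite int1 mule1|exact/measurable_EFinP|].
  by move=> o _; rewrite lee_fin.
have bE : mbf (fun o => expR (s * \1_E o)) by apply: mbf_exp; apply: mbfZ; exact: mbf_indic.
have int6 : (\int[P]_o (expR (s * \1_E o) / Z)%:E = 1%:E)%E.
  have -> : (fun o => (expR (s * \1_E o) / Z)%:E) = (fun o => (Z^-1 * (1 + (expR s - 1) * \1_E o))%:E).
    apply/funext => o; rewrite indicE mulrC; congr (_ * _)%:E.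
    by case: (o \in E); rewrite ?mulr1 ?mulr0 ?expR0; ring.
  have bi : mbf (fun o => (expR s - 1) * \1_E o) by apply: mbfZ; exact: mbf_indic.
  rewrite mbf_integral; last by apply: mbfZ; apply: mbfD => //; exact: mbf_cst.
  rewrite mbf_intZ; last by apply: mbfD => //; exact: mbf_cst.
  rewrite (mbf_intD P (mbf_cst 1) bi) mbf_intZ; last exact: mbf_indic.
  by rewrite Rintegral_prob_cst mbf_int_indic// -/p -/Z mulVf// gt_eqF.
have ms1 : measurable_fun setT (fun o => s * (q o * \1_E o)).
  by apply: measurable_funM => //; exact: measurable_funM.
have mr : measurable_fun setT (fun o => \sum_(i < n) rest i o) by exact: measurable_sum.
have mrh : measurable_fun setT (fun o => \sum_(i < n) rest i o * h (Ws i o)).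
  by apply: measurable_sum => i; apply: measurable_funM => //; exact: measurableT_comp.
have mqZ : measurable_fun setT (fun o => q o * ln Z) by exact: measurable_funM.
have meZ : measurable_fun setT (fun o => expR (s * \1_E o) / Z).
  by apply: measurable_funM => //; case: bE.
have s10 o : 0 <= s * (q o * \1_E o) by rewrite !mulr_ge0.
have r0 o : 0 <= \sum_(i < n) rest i o by exact: sumr_ge0.
have rh0 o : 0 <= \sum_(i < n) rest i o * h (Ws i o) by apply: sumr_ge0 => i _; exact: mulr_ge0.
have qZ0 o : 0 <= q o * ln Z by exact: mulr_ge0.
have eZ0 o : 0 <= expR (s * \1_E o) / Z by rewrite divr_ge0 ?expR_ge0// ltW.
have young o : s * (q o * \1_E o) + q o + \sum_(i < n) rest i o <=
    \sum_(i < n) rest i o * h (Ws i o) + q o * ln Z + expR (s * \1_E o) / Z.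
  have -> : \sum_(i < n) rest i o * h (Ws i o) = q o * ln (q o) + \sum_(i < n) rest i o.
    by rewrite lik_ln -big_split/=; apply: eq_bigr => i _; rewrite mulrDr mulr1.
  have := young_entropy (s * \1_E o - ln Z) (q0 o).
  rewrite expRD expRN lnK ?posrE// mulrBr; lra.
have : (\int[P]_o (s * (q o * \1_E o) + q o + \sum_(i < n) rest i o)%:E <=
    \int[P]_o (\sum_(i < n) rest i o * h (Ws i o) + q o * ln Z + expR (s * \1_E o) / Z)%:E)%E.
  apply: ge0_le_integral => //.
  - by move=> o _; rewrite lee_fin !addr_ge0.
  - by apply/measurable_EFinP; do 2?apply: measurable_funD.
  - by apply/measurable_EFinP; do 2?apply: measurable_funD.
  - by move=> o _; rewrite lee_fin.
rewrite !ge0_prob_intD// ?int1 ?int2 ?int3 ?int4 ?int5 ?int6;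
  (try by move=> o; rewrite ?addr_ge0); (try exact: measurable_funD).
by rewrite -!EFinD lee_fin; lra.
Qed.
End tilted_entropy.

(** * The large deviation lower bound *)

Section lower_bound.
Context {R : realType} {W : completePseudoMetricType R} {X : pseudoPMetricType R}.
Notation PMs := (PM W X).
Variables (bW : nat -> set W) (bX : nat -> set X).
Hypotheses (hbW : cbase bW) (hbX : cbase bX) (cX : compact [set: X]).
Variable u : nat -> W.
Hypothesis hu : forall x (e : R), 0 < e -> exists n, ball x e (u n).
Variables (C : W -> set X) (F : PMs -> W -> X -> R).
Hypotheses (hC : corr_cont C) (hF : F_bcont F).
Context dO {Om : measurableType dO} (P : probability Om R).
Variables (Ws : nat -> Om -> borel W) (l0 : probability (borel W) R).
Hypothesis hiid : iid P Ws l0.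
Variable (xhat : forall n : nat, ('I_n -> W) -> 'I_n -> X).
Hypothesis hxm : forall n (i : 'I_n) (B : set (borel X)), measurable B ->
  prodn_sigma (W:=W) (n:=n) ((fun v : 'I_n -> borel W => xhat v i) @^-1` B).
Hypothesis hnash : forall n (w : 'I_n -> W), nash F C w (xhat w).

Let mu := mu_n Ws xhat.

(** With s = (H + d) n, a probability below exp(-s) would make the logarithm in [tilt_entropy] at
    most ln 2, so that (H + d) n Q_n(E) <= H n + 1. This fails for large n because Q_n(E) tends to 1
    by the upper bound with r = 0. *)
Lemma ld_lower (U : set PMs) (l : probability (borel W) R) (H d : R) : weak_open U ->
  relent l l0 = H%:E -> (forall m, Mset F C l m -> U m) -> 0 < d ->
  \forall n \near \oo, expR (- ((H + d) * n%:R)) <= fine (P [set o | U (mu n o)]).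
Proof.
move=> oU lH hU d0.
have [[f df fH]|[]] := relent_cases l l0; last by rewrite lH.
have H0 : 0 <= H by rewrite -lee_fin -lH relent_ge0.
have oU' : weak_open (~` (~` U)) by rewrite setCK.
have [|r' r'0 hr'] := ld_upper hbW hbX cX hu hC hF hiid hxm hnash df oU' (lexx 0).
  move=> m nUm Mm; apply: not_marg_DV => ml; apply: nUm; exact: hU.
near=> n.
have QC0 : (tilt hiid df n [set o | (~` U) (mu n o)] <= (expR (- (r' * n%:R)))%:E)%E by near: n.
have n0 : (0 < n)%N by near: n; exact: nbhs_infty_gt.
pose E := [set o | U (mu n o)].
have mE : measurable E.
  have mWs i : measurable_fun setT (Ws i) by case: hiid.
  by apply: (measurable_mu hbW hbX mWs hxm) => //; exact: sub_sigma_algebra.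
rewrite leNgt; apply/negP => PE.
have hs : 0 <= (H + d) * n%:R by rewrite mulr_ge0// addr_ge0// ltW.
have := tilt_entropy hiid df n mE hs (etrans (esym fH) lH).
have : ln (1 + (expR ((H + d) * n%:R) - 1) * fine (P E)) <= 1.
  apply: (@le_trans _ _ (ln 2)).
    have p0 : 0 <= fine (P E) by exact: fine_ge0.
    rewrite ler_ln ?posrE//; last first.
      rewrite ltr_pwDl// mulr_ge0// subr_ge0 -[leLHS]expR0 ler_expR//.
    have : expR ((H + d) * n%:R) * fine (P E) <= 1.
      by rewrite -[leRHS](mulfV (lt0r_neq0 (expR_gt0 ((H + d) * n%:R)))) ler_wpM2l ?expR_ge0// -expRN ltW.
    lra.
  by have := @le_ln1Dx R 1; rewrite -[1 + 1]/2; apply; lra.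
have QE : 1 - expR (- (r' * n%:R)) <= fine (tilt hiid df n E).
  have QC : (tilt hiid df n (~` E) <= (expR (- (r' * n%:R)))%:E)%E by exact: QC0.
  have QD : (tilt hiid df n E + tilt hiid df n (~` E) = 1)%E.
    rewrite -(tilt_setT hiid df n) -[in RHS](setUv E).
    by apply: esym; apply: measureU => //; [exact: measurableC|exact: setICr].
  have fC : tilt hiid df n (~` E) \is a fin_num by apply: tilt_fin_num; exact: measurableC.
  move: QC QD; rewrite -(fineK fC) -(fineK (tilt_fin_num hiid df n mE)) lee_fin -EFinD => QC [].
  lra.
(* Of the surplus d n, at most half is lost to 1 - Q_n(E), by [e1]; the rest exceeds 1. *)
have n1 : 2 < d * n%:R.
  by rewrite mulrC -ltr_pdivrMr// (lt_le_trans (truncnS_gt _))// ler_nat; near: n; exact: nbhs_infty_ge.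
have e1 : (H + d) * expR (- (r' * n%:R)) <= d / 2.
  have n2 : 2 * (H + d) / (d * r') <= n%:R.
    by rewrite (le_trans (ltW (truncnS_gt _)))// ler_nat; near: n; exact: nbhs_infty_ge.
  rewrite expRN ler_pdivrMr ?expR_gt0//.
  have : r' * n%:R <= expR (r' * n%:R) by have := expR_ge1Dx (r' * n%:R); lra.
  move=> /(ler_wpM2l (divr_ge0 (ltW d0) (ler0n R 2))); apply: le_trans.
  by move: n2; rewrite ler_pdivrMr ?mulr_gt0//; lra.
move=> lZ; apply/negP; rewrite -ltNge.
have /(ler_wpM2l hs) := QE.
have /(ler_wpM2l (ler0n R n)) := e1.
lra.
Unshelve. all: by end_near. Qed.
End lower_bound.

(** * The rate function *)

Lemma eq_relent (R : realType) (W : pseudoPMetricType R) (l l' l0 : probability (borel W) R) :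
  (forall B, measurable B -> l B = l' B) -> relent l l0 = relent l' l0.
Proof.
move=> ll'; have e : density l l0 = density l' l0.
  apply/funext => f; apply/propext; split => -[mf f0 h]; split => // B mB.
    by rewrite -h// ll'.
  by rewrite ll'// h.
by rewrite /relent e.
Qed.

Section measure_equality.
Context {R : realType} {W X : pseudoPMetricType R}.
Notation PMs := (PM W X).
Variables (bW : nat -> set W) (bX : nat -> set X).
Hypotheses (hbW : cbase bW) (hbX : cbase bX).

Lemma meq_rint (m m' : PMs) f : meq m m' -> rint m f = rint m' f.
Proof. by move=> e; congr fine; apply: eq_measure_integral => B mB _; exact: e. Qed.

Lemma meq_wnbhd (m m' : PMs) k (fs : 'I_k -> W * X -> R) (e : R) : 0 < e ->
  (forall i, bcont (fs i)) -> meq m m' -> wnbhd m fs e m'.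
Proof.
move=> e0 bf mm; rewrite (wnbhdE hbW hbX)// => i.
by rewrite (meq_rint _ mm) subrr normr0.
Qed.

Lemma meq_weak_open (U : set PMs) m m' : weak_open U -> meq m m' -> U m -> U m'.
Proof.
by move=> oU mm /oU[k [fs [bf [e e0]]]]; apply; exact: meq_wnbhd.
Qed.

Lemma meq_weak_interior (A : set PMs) m m' : meq m m' -> weak_interior A m -> weak_interior A m'.
Proof. by move=> mm [U [oU Um UA]]; exists U; split => //; exact: meq_weak_open mm Um. Qed.

Lemma meq_weak_cont (G : PMs -> R) m m' : weak_cont G -> meq m m' -> G m = G m'.
Proof.
move=> cG mm; apply/eqP; rewrite eq_sym -subr_eq0 -normr_eq0 eq_le normr_ge0 andbT.
apply/ler_addgt0Pr => e e0; rewrite add0r.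
have [k [fs [bf [d d0 h]]]] := cG m e e0.
by apply: ltW; apply: h; exact: meq_wnbhd.
Qed.

End measure_equality.

Section rate_function.
Context {R : realType} {W : completePseudoMetricType R} {X : pseudoPMetricType R}.
Notation PMs := (PM W X).
Variables (bW : nat -> set W) (bX : nat -> set X).
Hypotheses (hbW : cbase bW) (hbX : cbase bX) (cX : compact [set: X]).
Variable u : nat -> W.
Hypothesis hu : forall x (e : R), 0 < e -> exists n, ball x e (u n).
Variables (C : W -> set X) (F : PMs -> W -> X -> R).
Hypotheses (hC : corr_cont C) (hF : F_bcont F).
Variable l0 : probability (borel W) R.

(** [Mset] determines l only on Borel sets; [marg] makes the rate a function of m. *)
Definition mrelent (m : PMs) : \bar R := relent (marg m) l0.

Lemma Mset_in_M l m : Mset F C l m -> in_M C F m. Proof. by case. Qed.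

Lemma Mset_marg m : in_M C F m -> Mset F C (marg m) m.
Proof. by move=> Mm; split => //; exact: marg_isP. Qed.

Lemma Mset_relent l m : Mset F C l m -> relent l l0 = mrelent m.
Proof. by move=> [/marg_is_eq ml _]; apply: eq_relent => B mB; rewrite ml. Qed.

Lemma weak_openU (U V : set PMs) : weak_open U -> weak_open V -> weak_open (U `|` V).
Proof.
move=> oU oV; rewrite -bigcup2E; apply: weak_open_bigcup => -[|[|n]] //= _.
by move=> ? [].
Qed.

Lemma weak_open_notM : weak_open (~` in_M C F).
Proof.
suff -> : ~` in_M C F = \bigcup_(U in [set U | weak_open U /\ U `<=` ~` in_M C F]) U.
  by apply: weak_open_bigcup => U [].
apply/seteqP; split => [m nMm|m [U [_]]]; last exact.
apply: contrapT => nU; apply: nMm; apply: (quasi_limit hbW hbX hC hF) => U d oU Um d0.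
apply: contrapT => h; apply: nU; exists U => //; split => // m' Um' Mm'; apply: h.
by exists m', 0; split => //; [rewrite lexx ltW|exact: in_M_quasi].
Qed.

Lemma weak_open_nclosure (A : set PMs) : weak_open (~` weak_closure A).
Proof.
suff -> : ~` weak_closure A = \bigcup_(U in [set U | weak_open U /\ U `<=` ~` weak_closure A]) U.
  by apply: weak_open_bigcup => U [].
apply/seteqP; split => [m nAm|m [U [_]]]; last exact.
have [U [oU Um UA]] : exists U, [/\ weak_open U, U m & ~ (U `&` A !=set0)].
  by apply: contrapT => h; apply: nAm => U oU Um; apply: contrapT => UA; apply: h; exists U.
by exists U => //; split => // m' Um' /(_ U oU Um').
Qed.

(** For a fixed continuous g, [DV] is weakly continuous in m and bounds the entropy from below; a g
    that witnesses the inequality at m therefore does so nearby. *)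
Lemma weak_open_mrelent_gt (r : R) : weak_open [set m | (r%:E < mrelent m)%E].
Proof.
suff -> : [set m | (r%:E < mrelent m)%E] =
    \bigcup_(U in [set U | weak_open U /\ U `<=` [set m | (r%:E < mrelent m)%E]]) U.
  by apply: weak_open_bigcup => U [].
apply/seteqP; split => [m /= rm|m [U [_]]]; last exact.
have [g bg rg] := relent_gt_bcf rm; have bgm := bcf_mbf bg.
have bg1 : bcont (fun p : W * X => g p.1).
  have [cg [K hK]] := bg; split; last by exists K => p; exact: hK.
  by move=> p; apply: continuous_comp; [exact: cvg_fst|exact: cg].
set Z := ln (\int[l0]_w expR (g w)).
exists [set m' | r + Z < rint m' (fun p => g p.1)]; last first.
  by rewrite /= /rint -(Rintegral_marg m bgm); move: rg; rewrite /DV -/Z; lra.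
split; first exact: (weak_open_rint_gt hbW hbX).
move=> m' /=; rewrite /rint -(Rintegral_marg m' bgm) => h.
apply: lt_le_trans (relent_ge_DV _ _ bgm); rewrite lte_fin /DV -/Z; lra.
Qed.

Lemma tight_mrelent (a : R) : tight_set [set m | (mrelent m <= a%:E)%E].
Proof.
have [Phi [bPhi _ _ PhiE Phit]] := exists_lyapunov hbW hbX cX hu l0.
move=> e e0; have [K cK hK] := Phit (a + ln 2) e e0; exists K => // m f am; apply: hK => N.
rewrite -(Rintegral_marg m (bPhi N)).
have : ln (\int[l0]_w expR (Phi N w)) <= ln 2.
  by rewrite ler_ln ?posrE//; exact: int_exp_gt0.
have := le_trans (relent_ge_DV (marg m) l0 (bPhi N)) am.
rewrite lee_fin /DV; lra.
Qed.

(** [tight_cover] wants a family covering every measure, so the open complement of B is added to the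
    cover and discarded from the finite subfamily. *)
Lemma tight_weak_compact (B : set PMs) : weak_open (~` B) -> tight_set B -> weak_compact B.
Proof.
move=> cB tB G oG BG.
have [[m0 Bm0]|B0] := pselect (B !=set0); last first.
  by exists 0%N, (fun=> set0); split => [[]//|m Bm]; case: B0; exists m.
have [U0 GU0 _] := BG m0 Bm0.
pose G' := G `|` [set ~` B].
have [U|m|k [g [Gg Bg]]] := tight_cover hbW hbX (G := G') tB.
- by move=> [/oG//|->].
- have [Bm|nBm] := pselect (B m); last by exists (~` B) => //; right.
  by have [U GU Um] := BG m Bm; exists U => //; left.
exists k, (fun j => if pselect (G (g j)) then g j else U0); split => [j|m Bm].
  by case: pselect.
have [j _ gjm] := Bg m Bm; exists j => //; case: pselect => // nG.
have [//|e] := Gg j; have nBm : (~` B) m by rewrite -e.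
by case: nBm.
Qed.

Variable A : set PMs.
Notation I := (Irate F C l0 A).
Notation S := (Sset F C l0 A).

Lemma Irate_le m : weak_closure A m -> in_M C F m -> (I <= mrelent m)%E.
Proof.
move=> Am Mm; have [mfin|] := ltP (mrelent m) +oo%E; last by move=> h; exact: le_trans (leey _) h.
apply: ereal_inf_lbound; exists (marg m) => //; split; first exact: relent_fin_dominates.
by exists m; split => //; exact: Mset_marg.
Qed.

Lemma SsetP m : S m <-> [/\ weak_closure A m, in_M C F m & mrelent m = I].
Proof.
split=> [[Am [l [Mm rl]]]|[Am Mm rm]].
  by split => //; [exact: Mset_in_M Mm|rewrite -rl (Mset_relent Mm)].
by split => //; exists (marg m); split => //; exact: Mset_marg.
Qed.

Lemma Irate_ge0 : (0 <= I)%E.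
Proof. by apply: le_ereal_inf_tmp => _ [l _ <-]; exact: relent_ge0. Qed.

Lemma Sset_gt m : weak_closure A m -> in_M C F m -> ~ S m -> (I < mrelent m)%E.
Proof.
move=> Am Mm nSm; rewrite lt_neqAle Irate_le// andbT; apply/eqP => e; apply: nSm.
exact/SsetP.
Qed.

Hypothesis Ifin : (I < +oo)%E.

Let i := fine I.

Lemma Irate_fine : I = i%:E.
Proof. by rewrite /i fineK// ge0_fin_numE// Irate_ge0. Qed.

Lemma weak_open_nS : weak_open (~` S).
Proof.
suff -> : ~` S = ~` weak_closure A `|` (~` in_M C F `|` [set m | (i%:E < mrelent m)%E]).
  apply: weak_openU; first exact: weak_open_nclosure.
  by apply: weak_openU; [exact: weak_open_notM|exact: weak_open_mrelent_gt].
apply/seteqP; split => m.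
  move=> nSm; have [Am|] := pselect (weak_closure A m); last by left.
  have [Mm|] := pselect (in_M C F m); last by right; left.
  by right; right; rewrite /= -Irate_fine; exact: Sset_gt.
by move=> h /SsetP[Am Mm rm]; case: h => [//|[//|]]; rewrite /= -Irate_fine rm ltxx.
Qed.

Lemma sub_tight_set (T T' : set PMs) : T `<=` T' -> tight_set T' -> tight_set T.
Proof. by move=> TT tT e /tT[K cK h]; exists K => // m f /TT; exact: h. Qed.

Lemma weak_compact_S : weak_compact S.
Proof.
apply: tight_weak_compact weak_open_nS _; apply: sub_tight_set (tight_mrelent i) => m.
by move=> /SsetP[_ _]; rewrite /= -Irate_fine => ->.
Qed.

(** If the infimum were not attained, the open sets where the rate exceeds I + 1 / (n + 1) would
    cover the compact K. A finite subcover would bound the rate away from I on K, while off K it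
    exceeds I + 1. *)
Lemma Sset_nonempty : S !=set0.
Proof.
apply: contrapT => nS.
have gtI m : weak_closure A m -> in_M C F m -> (I < mrelent m)%E.
  by move=> Am Mm; apply: Sset_gt => // Sm; apply: nS; exists m.
pose K := weak_closure A `&` (in_M C F `&` [set m | (mrelent m <= (i + 1)%:E)%E]).
have cK : weak_compact K.
  apply: tight_weak_compact; last first.
    by apply: sub_tight_set (tight_mrelent (i + 1)) => m [_ []].
  rewrite !setCI; apply: weak_openU; first exact: weak_open_nclosure.
  apply: weak_openU; first exact: weak_open_notM.
  rewrite (_ : ~` _ = [set m | ((i + 1)%:E < mrelent m)%E]); first exact: weak_open_mrelent_gt.
  by apply/seteqP; split => m /=; [move=> /negP; rewrite -ltNge|rewrite ltNge => /negP].
pose V (n : nat) := [set m | ((i + n.+1%:R^-1)%:E < mrelent m)%E].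
have [U [n _ <-]|m [Am [Mm _]]|k [g [hg Kg]]] := cK (range V).
- exact: weak_open_mrelent_gt.
- have := gtI m Am Mm; rewrite Irate_fine => im.
  suff [n hn] : exists n : nat, ((i + n.+1%:R^-1)%:E < mrelent m)%E by exists (V n) => //; exists n.
  case: (mrelent m) im => [r| |//]; last by exists 0%N; rewrite ltry.
  rewrite lte_fin => ir; exists (Num.truncn (r - i)^-1); rewrite lte_fin -ltrBrDl.
  rewrite -[ltRHS]invrK ltf_pV2 ?posrE ?ltr0n ?invr_gt0 ?subr_gt0//; exact: truncnS_gt.
have /choice[ns hns] : forall j, exists n, V n = g j by move=> j; have [n _ <-] := hg j; exists n.
pose N := \max_(j < k) ns j.
have : ((i + N.+1%:R^-1)%:E <= I)%E.
  apply: le_ereal_inf_tmp => _ [l [_ [m [Am Mm]]] <-].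
  rewrite (Mset_relent Mm); have [h|/ltW h] := leP (mrelent m) (i + 1)%:E; last first.
    by apply: le_trans h; rewrite lee_fin lerD2l invf_le1// ler1n.
  have [j _ gjm] : (\bigcup_j g j) m by apply: Kg; split => //; split => //; exact: Mset_in_M Mm.
  move: gjm; rewrite -hns => /ltW; apply: le_trans.
  rewrite lee_fin lerD2l lef_pV2 ?posrE// ler_nat ltnS.
  exact: (@leq_bigmax _ (fun j => ns j)).
by rewrite Irate_fine lee_fin; apply/negP; rewrite -ltNge ltrDl.
Qed.

End rate_function.

(** * Conditional laws *)

Section separation.
Context {R : realType} {T : pseudoPMetricType R}.
Variable b : nat -> set T.
Hypothesis hb : cbase b.

(** Finite intersections turn the base into a pi-system that is still countable and generates the
    Borel sets. *)
Definition fin_meet (s : seq nat) : set T := foldr (fun i U => b i `&` U) setT s.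

Lemma fin_meet_open s : open (fin_meet s).
Proof. by elim: s => [|i s ih]; [exact: openT|apply: openI => //; case: hb]. Qed.

Lemma fin_meet_cat s t : fin_meet (s ++ t) = fin_meet s `&` fin_meet t.
Proof. by elim: s => [|i s ih] /=; [rewrite setTI|rewrite ih setIA]. Qed.

Lemma countable_bump_eq (m1 m2 : probability (borel T) R) :
  (forall s k, \int[m1]_(x in [set: borel T]) bump (fin_meet s) k x =
               \int[m2]_(x in [set: borel T]) bump (fin_meet s) k x) ->
  forall B : set (borel T), measurable B -> m1 B = m2 B.
Proof.
move=> h B mB; have hs s : m1 (fin_meet s : set (borel T)) = m2 (fin_meet s : set (borel T)).
  by apply: bump_eq_prob; [exact: fin_meet_open|exact: h].
apply: (@measure_unique _ R (borel T) (range fin_meet) (fun=> setT)) => //.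
- apply/seteqP; split; apply: smallest_sub; try exact: smallest_sigma_algebra.
    move=> U oU; rewrite (cbase_bigcup hb oU) bigcup_mkcond.
    apply: sigma_algebra_bigcup => i /=; case: ifP => _; last exact: sigma_algebra0.
    by apply: sub_sigma_algebra; exists [:: i] => //=; rewrite setIT.
  by move=> _ [s _ <-]; apply: open_measurable_borel; exact: fin_meet_open.
- by move=> _ _ [s _ <-] [t _ <-]; exists (s ++ t) => //; rewrite fin_meet_cat.
- by move=> _; exists [::].
- by apply/seteqP; split => // x _; exists 0%N.
- by move=> _ [s _ <-]; exact: hs.
- by move=> k; rewrite ltey_eq fin_num_measure.
Qed.

End separation.

Section separation_prod.
Context {R : realType} {W X : pseudoPMetricType R}.
Notation PMs := (PM W X).
Variables (bW : nat -> set W) (bX : nat -> set X).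
Hypotheses (hbW : cbase bW) (hbX : cbase bX).

Let b n : set (pprod W X) := if unpickle n is Some (i, j) then bW i `*` bX j else set0.

Let hb : cbase b. Proof. exact: cbase_prod. Qed.

Definition test (c : seq nat * nat) : W * X -> R := bump (fin_meet b c.1 : set (W * X)%type) c.2.

Lemma test_bcont c : bcont (test c).
Proof. exact: bcf_bump. Qed.

Let mid : measurable_fun [set: WX W X] (id : WX W X -> borel (pprod W X)).
Proof.
apply: (@measurability _ _ (WX W X) (borel (pprod W X)) setT id (@open (pprod W X))) => //= _ [U oU <-].
by rewrite setTI; exact: (open_measurable_WX hbW hbX).
Qed.

Lemma test_separates (m m' : PMs) : (forall c, rint m (test c) = rint m' (test c)) -> meq m m'.
Proof.
move=> h B mB; apply: (@countable_bump_eq _ _ _ hb (pushprob m mid) (pushprob m' mid)).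
  move=> s k; have [mt bt] := bcf_mbf (bcf_bump (fin_meet b s) k).
  by rewrite !Rintegral_pushprob//; exact: (h (s, k)).
by have := @pprod_id_measurable R W X measurableT B mB; rewrite setTI.
Qed.

End separation_prod.

Section weak_continuity.
Context {R : realType} {W X : pseudoPMetricType R}.
Notation PMs := (PM W X).
Variables (bW : nat -> set W) (bX : nat -> set X).
Hypotheses (hbW : cbase bW) (hbX : cbase bX).

Lemma weak_contP (G : PMs -> R) : (forall m (e : R), 0 < e ->
    exists2 U, weak_open U & U m /\ forall m', U m' -> `|G m' - G m| < e) -> weak_cont G.
Proof.
move=> h m e /(h m e)[U oU [Um hU]]; have [k [fs [bf [d d0 sU]]]] := oU m Um.
by exists k, fs; split => //; exists d => // m' /sU; exact: hU.
Qed.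

Lemma weak_cont_ball (G : PMs -> R) m (e : R) : weak_cont G ->
  weak_open [set m' | `|G m' - G m| < e].
Proof.
move=> cG; have := weak_cont_open cG (@ball_open _ R^o (G m) e).
by congr weak_open; apply/seteqP; split => m' /=; rewrite /ball/= distrC.
Qed.

Lemma weak_cont_comp (G : PMs -> R) (h : R -> R) : weak_cont G -> continuous h ->
  weak_cont (fun m => h (G m)).
Proof.
move=> cG ch; apply: weak_contP => m e e0.
exists (G @^-1` [set t | `|h t - h (G m)| < e]).
  apply: weak_cont_open => //.
  rewrite (_ : [set t | _] = h @^-1` (ball (h (G m)) e)).
    by apply: open_comp => [t _|]; [exact: ch|exact: ball_open].
  by apply/seteqP; split => t /=; rewrite /ball/= distrC.
by split => //=; rewrite subrr normr0.
Qed.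

Lemma weak_cont_min (G H : PMs -> R) : weak_cont G -> weak_cont H ->
  weak_cont (fun m => Num.min (G m) (H m)).
Proof.
move=> cG cH; apply: weak_contP => m e e0.
exists ([set m' | `|G m' - G m| < e] `&` [set m' | `|H m' - H m| < e]).
  by apply: weak_openI; exact: weak_cont_ball.
split; first by split; rewrite /= subrr normr0.
move=> m' /= []; rewrite /Num.min !ltr_norml => /andP[h1 h2] /andP[h3 h4].
by case: (ltP (G m') (H m')) => h5; case: (ltP (G m) (H m)) => h6; apply/andP; split; lra.
Qed.

Lemma weak_cont_cst (c : R) : weak_cont (fun _ : PMs => c).
Proof.
apply: weak_contP => m e e0; exists setT; first exact: weak_openT.
by split => // m' _; rewrite subrr normr0.
Qed.

Lemma weak_cont_measurable (G : PMs -> R) : weak_cont G -> measurable_fun [set: PMb W X] G.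
Proof.
move=> cG; apply: open_measurable_fun => U oU; apply: sub_sigma_algebra.
exact: weak_cont_open.
Qed.

End weak_continuity.

Section separating_functions.
Context {R : realType} {W X : pseudoPMetricType R}.
Notation PMs := (PM W X).
Variables (bW : nat -> set W) (bX : nat -> set X).
Hypotheses (hbW : cbase bW) (hbX : cbase bX).

Definition tent (N : nat) (t : R) : R := Num.max 0 (1 - N.+1%:R * `|t|).

Lemma tent_continuous N : continuous (tent N).
Proof.
move=> t; apply: (@continuous_max R R^o (cst 0) (fun t => 1 - N.+1%:R * `|t|)); first exact: cvg_cst.
apply: cvgB; first exact: cvg_cst.
by apply: cvgM; [exact: cvg_cst|exact: norm_continuous].
Qed.

(* Test functions with rational target values, and a precision: countably many codes, whose
   functions separate every compact set from every measure outside it. *)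
Definition code : Type := (seq ((seq nat * nat) * rat) * nat)%type.

Definition code_fun (c : code) (m : PMs) : R :=
  foldr (fun a r => Num.min (tent c.2 (rint m (test bW bX a.1) - ratr a.2)) r) 1 c.1.

Lemma code_fun_ge0 c m : 0 <= code_fun c m.
Proof.
by rewrite /code_fun; elim: c.1 => [|a s ih]//=; rewrite le_min ih andbT le_max lexx.
Qed.

Lemma code_fun_le1 c m : code_fun c m <= 1.
Proof. by rewrite /code_fun; elim: c.1 => [|a s ih]//=; rewrite ge_min ih orbT. Qed.

Lemma code_fun_cont c : weak_cont (code_fun c).
Proof.
rewrite /code_fun; elim: c.1 => [|a s ih] /=; first exact: weak_cont_cst.
apply: weak_cont_min => //.
apply: (@weak_cont_comp _ _ _ (fun m => rint m (test bW bX a.1)) (fun t => tent c.2 (t - ratr a.2))).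
  by apply: weak_cont_rint hbW hbX _ _; exact: test_bcont.
move=> t; apply: (@continuous_comp _ _ _ (fun t : R => t - ratr a.2) (tent c.2)).
  by apply: cvgB; [exact: cvg_id|exact: cvg_cst].
exact: tent_continuous.
Qed.

(** Compactness gives finitely many test integrals of which at least one differs by more than 2 / (N
    + 1) between m and any s in S. Tents of width 1 / (N + 1), centred at rationals within half that
    width of the values at m, exceed 1/2 at m, and their minimum vanishes on a neighbourhood of S,
    as is needed where only neighbourhoods of S are controlled. *)
Lemma code_separates (S : set PMs) m : weak_compact S ->
  (forall s, S s -> ~ meq m s) ->
  exists2 c, 2^-1 < code_fun c m &
    exists2 U, weak_open U & S `<=` U /\ forall m', U m' -> code_fun c m' = 0.
Proof.
move=> cS nS.
pose f a m' := rint m' (test bW bX a).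
pose V (p : (seq nat * nat) * nat) := [set m' | 2 / p.2.+1%:R < `|f p.1 m' - f p.1 m|].
have cf a : weak_cont (f a) by apply: weak_cont_rint hbW hbX _ _; exact: test_bcont.
have far a (q t : R) : weak_open [set m' | t < `|f a m' - q|].
  have cn : continuous (fun x : R => `|x - q|).
    move=> x; apply: (@continuous_comp _ _ _ (fun t : R => t - q) Num.norm).
      by apply: cvgB; [exact: cvg_id|exact: cvg_cst].
    exact: norm_continuous.
  exact: (weak_cont_open (weak_cont_comp (cf a) cn) (@open_gt R t)).
have [U [p _ <-]|s Ss|k [g [hg Sg]]] := cS (range V).
- exact: far.
- have [a na] : exists a, f a m != f a s.
    apply: contrapT => h; apply: (nS s Ss); apply: (test_separates hbW hbX) => a.
    by apply/eqP; apply: contrapT => /negP na; apply: h; exists a.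
  have d0 : 0 < `|f a s - f a m| / 2 by rewrite divr_gt0// normr_gt0 subr_eq0 eq_sym.
  exists (V (a, Num.truncn (`|f a s - f a m| / 2)^-1)); first by eexists.
  rewrite /V/= ltr_pdivrMr//; set N := (Num.truncn _).+1.
  have : 1 < `|f a s - f a m| / 2 * N%:R by rewrite -ltr_pdivrMl// mulr1; exact: truncnS_gt.
  lra.
have /choice[ps hps] : forall j, exists p, V p = g j by move=> j; have [p _ <-] := hg j; exists p.
pose N := \max_(j < k) (ps j).2.
have N0 : 0 < N.+1%:R^-1 :> R by rewrite invr_gt0.
have /choice[qs hqs] : forall j, exists q : rat, `|f (ps j).1 m - ratr q| < N.+1%:R^-1 / 2.
  move=> j; set x := f _ m; set e := _ / 2; have e0 : 0 < e by rewrite divr_gt0.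
  have /rat_in_itvoo[q] : x - e < x + e by rewrite ltrBlDr -addrA ltrDl addr_gt0.
  by rewrite in_itv/= => /andP[q1 q2]; exists q; rewrite ltr_norml; apply/andP; split; lra.
exists ([seq ((ps j).1, qs j) | j <- enum 'I_k], N).
  rewrite /code_fun /=; elim: (enum _) => [|j s ih] /=; first by rewrite invf_lt1// ltr1n.
  rewrite lt_min ih andbT lt_max; apply/orP; right.
  have := hqs j; rewrite -/(f _ m) -(ltr_pM2l (ltr0Sn R N)) mulrA mulfV// mul1r; lra.
exists (\bigcup_j [set m' | N.+1%:R^-1 < `|f (ps j).1 m' - ratr (qs j)|]).
  by apply: weak_open_bigcup => j _; exact: far.
split => [s /Sg[j _]|m' [j _ /= h]].
  rewrite -hps /V /= => h; exists j => //=.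
  have jN : N.+1%:R^-1 <= (ps j).2.+1%:R^-1 :> R.
    by rewrite lef_pV2 ?posrE// ler_nat ltnS; exact: (@leq_bigmax _ (fun j => (ps j).2)).
  have := ler_distD (ratr (qs j)) (f (ps j).1 s) (f (ps j).1 m).
  have := hqs j; rewrite (distrC (f _ m)); move: h jN N0; set a := N.+1%:R^-1; set a' := (ps j).2.+1%:R^-1.
  lra.
apply/eqP; rewrite eq_le code_fun_ge0 andbT /code_fun /=.
have : j \in enum 'I_k by rewrite mem_enum.
elim: (enum _) => [//|j' s ih]; rewrite inE => /orP[/eqP <-|/ih] /=; rewrite ge_min; last by move=> ->; rewrite orbT.
apply/orP; left; rewrite /tent ge_max lexx/= subr_le0.
by rewrite -(ler_pM2l N0) mulrA mulVf// mul1r mulr1 ltW.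
Qed.

End separating_functions.

(** * Limits of the conditional laws *)

Section conditional_laws.
Context {R : realType} {W X : pseudoPMetricType R}.
Notation PMs := (PM W X).
Variables (bW : nat -> set W) (bX : nat -> set X).
Hypotheses (hbW : cbase bW) (hbX : cbase bX).
Context dO {Om : measurableType dO} (P : probability Om R).
Variables (Ws : nat -> Om -> borel W).
Hypothesis mWs : forall i, measurable_fun setT (Ws i).
Variable (xhat : forall n : nat, ('I_n -> W) -> 'I_n -> X).
Hypothesis hxm : forall n (i : 'I_n) (B : set (borel X)), measurable B ->
  prodn_sigma (W:=W) (n:=n) ((fun v : 'I_n -> borel W => xhat v i) @^-1` B).
Variable A : set PMs.
Hypothesis bA : weak_borel A.

Let mu := mu_n Ws xhat.
Let E n := [set o | A (mu n o)].

Definition escape (U : set PMs) n : R :=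
  fine (P (E n `&` [set o | ~ U (mu n o)])) / fine (P (E n)).

Let mE n : (0 < n)%N -> measurable (E n).
Proof. by move=> n0; exact: (measurable_mu hbW hbX mWs hxm). Qed.

Lemma measurable_escape U n : (0 < n)%N -> weak_open U -> measurable (E n `&` [set o | ~ U (mu n o)]).
Proof.
move=> n0 oU; apply: measurableI; first exact: mE.
apply: (measurable_mu hbW hbX mWs hxm n0 (A := ~` U)); apply: weak_borelC.
exact: sub_sigma_algebra.
Qed.

Lemma measurable_weak_cont_mu (G : PMs -> R) n : (0 < n)%N -> weak_cont G ->
  measurable_fun setT (fun o => G (mu n o)).
Proof.
move=> n0 cG; apply: open_measurable_fun => U oU.
apply: (measurable_mu hbW hbX mWs hxm n0 (A := G @^-1` U)); apply: sub_sigma_algebra.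
exact: weak_cont_open.
Qed.

Let mbf_EG (G : PMs -> R) n (M : R) : (0 < n)%N -> weak_cont G -> (forall m, `|G m| <= M) ->
  mbf (fun o => \1_(E n) o * G (mu n o)).
Proof.
move=> n0 cG hM; apply: mbfM; first by apply: mbf_indic; exact: mE.
by split; [exact: measurable_weak_cont_mu|exists M => o; exact: hM].
Qed.

Lemma condEE (G : PMs -> R) n :
  condE P mu A n G = (\int[P]_o (\1_(E n) o * G (mu n o))) / fine (P (E n)).
Proof.
rewrite /condE /Rintegral [in LHS]integral_mkcond; congr (fine _ / _); apply: eq_integral => o _.
by rewrite patchE indicE; case: (o \in _); rewrite ?mul1r ?mul0r.
Qed.

Lemma condE_sub_cst (G : PMs -> R) n (c M : R) : (0 < n)%N -> weak_cont G -> (forall m, `|G m| <= M) ->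
  (0 < P (E n))%E -> condE P mu A n (fun m => G m - c) = condE P mu A n G - c.
Proof.
move=> n0 cG hM PE; rewrite !condEE.
have p0 : fine (P (E n)) != 0.
  by rewrite gt_eqF// fine_gt0// PE ltey_eq fin_num_measure//; exact: mE.
have bI : mbf (\1_(E n) : Om -> R) by apply: mbf_indic; exact: mE.
have -> : \int[P]_o (\1_(E n) o * (G (mu n o) - c)) = \int[P]_o (\1_(E n) o * G (mu n o)) - c * fine (P (E n)).
  rewrite -(mbf_int_indic P (mE n0)) -(mbf_intZ P c bI) -(mbf_intB P (mbf_EG n0 cG hM) (mbfZ c bI)).
  by apply: eq_Rintegral => o _; ring.
by rewrite mulrBl mulfK.
Qed.

Lemma condE_bound (G : PMs -> R) n (M e : R) U : (0 < n)%N -> weak_cont G ->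
  (forall m, `|G m| <= M) -> weak_open U -> 0 <= e -> (forall m, U m -> `|G m| <= e) ->
  `|condE P mu A n G| <= e + M * escape U n.
Proof.
move=> n0 cG hM oU e0 hU; rewrite condEE /escape.
have M0 : 0 <= M by apply: le_trans (hM point); exact: normr_ge0.
set p := fine (P (E n)); have p0 : 0 <= p by exact: fine_ge0.
set E' := E n `&` _; have mE' : measurable E' by exact: measurable_escape.
have [->|pn0] := eqVneq p 0; first by rewrite invr0 !mulr0 normr0 addr0.
have {}p0 : 0 < p by rewrite lt_neqAle eq_sym pn0.
have bI : mbf (\1_(E n) : Om -> R) by apply: mbf_indic; exact: mE.
have bI' : mbf (\1_E' : Om -> R) by exact: mbf_indic.
rewrite normrM normfV (gtr0_norm p0) mulrA -{1}(mulfK pn0 e) -mulrDl ler_pM2r ?invr_gt0//.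
have bEG := mbf_EG n0 cG hM.
apply: (le_trans (mbf_norm_int P bEG)).
rewrite -[p](mbf_int_indic P (mE n0)) -(mbf_int_indic P mE') -(mbf_intZ P e bI) -(mbf_intZ P M bI').
rewrite -(mbf_intD P (mbfZ e bI) (mbfZ M bI')).
apply: mbf_int_le; first exact: mbf_norm; first by apply: mbfD; exact: mbfZ.
move=> o; rewrite normrM [\1_(E n) o]indicE; have [En|nEn] := boolP (o \in E n); last first.
  by rewrite normr0 mul0r mulr0 add0r mulr_ge0// indicE.
rewrite normr1 mul1r mulr1; have [Uo|nUo] := pselect (U (mu n o)).
  by rewrite (le_trans (hU _ Uo))// lerDl mulr_ge0// indicE.
rewrite indicE mem_set ?mulr1; first by rewrite (le_trans (hM _))// lerDr.
by split => //; exact: set_mem.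
Qed.

Variable S : set PMs.
Hypothesis cS : weak_compact S.
Hypothesis oS : weak_open (~` S).
Hypothesis escape0 : forall U, weak_open U -> S `<=` U -> escape U n @[n --> \oo] --> 0.

(** A code function that vanishes near S has conditional expectations tending to 0, hence integral 0
    under nu, and by Markov's inequality the set where it exceeds 1/2 is null. Countably many such
    sets cover the complement of S. *)
Lemma support_of_limit (nu : probability (PMb W X) R) (phi : nat -> nat) :
  {homo phi : a b / (a < b)%N} ->
  (forall G : PMs -> R, (exists M : R, forall m, `|G m| <= M) -> weak_cont G ->
     condE P mu A (phi k) G @[k --> \oo] --> fine (\int[nu]_m (G m)%:E)%E) ->
  nu S = 1%E.
Proof.
move=> hphi hnu.
have phik k : (k <= phi k)%N by elim: k => // k ih; exact: leq_ltn_trans ih (hphi _ _ (ltnSn k)).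
have cphi : phi k @[k --> \oo] --> \oo.
  by move=> Q [N _ hN]; exists N => // k /= Nk; apply: hN => /=; exact: leq_trans Nk (phik k).
(* Codes whose function vanishes on a neighbourhood of S. *)
pose bad c := exists2 U, weak_open U & S `<=` U /\ forall m, U m -> code_fun bW bX c m = 0.
have null c : bad c -> nu [set m | 2^-1 < code_fun bW bX c m] = 0%E.
  move=> [U oU [SU hU]]; set G := code_fun bW bX c.
  have cG : weak_cont G by exact: code_fun_cont.
  have G0 m : 0 <= G m by exact: code_fun_ge0.
  have G1 m : `|G m| <= 1 by rewrite ger0_norm// code_fun_le1.
  have mG := weak_cont_measurable cG.
  have bG : mbf (G : PMb W X -> R) by split => //; exists 1.
  have cv := hnu G (ex_intro _ 1 G1) cG.
  have cv0 : condE P mu A (phi k) G @[k --> \oo] --> 0.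
    apply/norm_cvg0P; apply: (@squeeze_cvgr _ _ _ _ (cst 0) (fun k => escape U (phi k))).
    - near=> k; rewrite normr_ge0/=.
      have k0 : (0 < phi k)%N by apply: leq_trans (phik k); near: k; exact: nbhs_infty_gt.
      have := condE_bound k0 cG G1 oU (lexx 0); rewrite add0r mul1r; apply => m Um.
      by rewrite /G hU// normr0.
    - exact: cvg_cst.
    - exact: (cvg_comp _ _ cphi (escape0 oU SU)).
  have int0 : \int[nu]_m G m = 0 := cvg_unique (@Rhausdorff R) cv cv0.
  have mV : measurable ([set m | 2^-1 < G m] : set (PMb W X)).
    by apply: sub_sigma_algebra; exact: (weak_cont_open cG (@open_gt R 2^-1)).
  have : 2^-1 * fine (nu [set m | 2^-1 < G m]) <= 0.
    rewrite -int0 -(mbf_int_indic nu mV) -(mbf_intZ nu _ (mbf_indic mV)).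
    apply: mbf_int_le => //; first by apply: mbfZ; exact: mbf_indic.
    move=> m; rewrite indicE; have [/set_mem/= /ltW Gm|_] := boolP (m \in _).
      by rewrite mulr1.
    by rewrite mulr0.
  rewrite pmulr_rle0// => h.
  rewrite -[LHS]fineK ?fin_num_measure//; apply/eqP; rewrite eqe eq_le h; exact: fine_ge0.
have mS : measurable (~` S : set (PMb W X)) by exact: sub_sigma_algebra.
have n0 : nu (~` S) = 0%E.
  apply/(negligibleP _ mS).
  pose D (n : nat) : set (PMb W X) := if @unpickle code n is Some c
    then (if pselect (bad c) then [set m | 2^-1 < code_fun bW bX c m] else set0) else set0.
  apply: (@negligibleS _ _ _ nu (\bigcup_n D n)).
    move=> m nSm.
    have [|c c2 bc] := @code_separates _ _ _ bW bX hbW hbX S m cS.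
      (* S is closed under [meq] because its complement is weakly open. *)
      move=> s Ss ms; suff : S m by [].
      apply: contrapT => /(meq_weak_open hbW hbX oS ms); exact.
    by exists (pickle c) => //; rewrite /D pickleK; case: pselect.
  apply: negligible_bigcup => n; rewrite /D; case: unpickle => [c|]; last exact: negligible_set0.
  case: (pselect (bad c)) => [bc|_] /=; last exact: negligible_set0.
  apply/negligibleP; last exact: null.
  by apply: sub_sigma_algebra; exact: (weak_cont_open (code_fun_cont hbW hbX c) (@open_gt R 2^-1)).
have := probability_setC nu mS; rewrite setCK => ->.
by rewrite n0 sube0.
Unshelve. all: by end_near. Qed.

End conditional_laws.

Lemma density_refl (R : realType) (W : pseudoPMetricType R) (l : probability (borel W) R) :
  density l l (cst 1).
Proof. by split => // B mB; have := integral_cst l mB 1%E; rewrite mul1e => <-. Qed.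

Section rates.
Context {R : realType} {W X : pseudoPMetricType R}.
Notation PMs := (PM W X).
Variables (C : W -> set X) (F : PMs -> W -> X -> R).
Variables (l0 : probability (borel W) R) (A : set PMs).

(** A marginal that is not absolutely continuous has infinite entropy, so constraining it leaves the
    infimum unchanged. *)
Lemma inf_closure_Irate : inf_closure F C l0 A = Irate F C l0 A.
Proof.
apply/eqP; rewrite eq_le; apply/andP; split.
  by apply: le_ereal_inf_tmp => _ [l [_ [m [Am Mm]]] <-]; apply: ereal_inf_lbound; exists m, l.
apply: le_ereal_inf_tmp => _ [m [l [Am Mm ->]]].
have [lfin|] := ltP (relent l l0) +oo%E; last by apply: le_trans; exact: leey.
apply: ereal_inf_lbound; exists l => //; split; first exact: relent_fin_dominates.
by exists m.
Qed.

(** When M(l) is a single measure up to [meq], meeting the interior of A and being contained in it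
    are the same, the interior being closed under [meq]. *)
Lemma inf_interior_Irate_int bW bX : @cbase W bW -> @cbase X bX ->
  (forall l : probability (borel W) R, l `<< l0 -> exists m0 : PMs, forall m, Mset F C l m <-> meq m m0) ->
  inf_interior F C l0 A = Irate_int F C l0 A.
Proof.
move=> hbW hbX uniqM; apply/eqP; rewrite eq_le; apply/andP; split.
  apply: le_ereal_inf_tmp => _ [l [ll0 hl] <-]; apply: ereal_inf_lbound.
  have [m0 hm0] := uniqM l ll0; have Mm0 : Mset F C l m0 by apply/hm0.
  by exists m0, l; split => //; exact: hl.
apply: le_ereal_inf_tmp => _ [m [l [Am Mm ->]]].
have [lfin|] := ltP (relent l l0) +oo%E; last by apply: le_trans; exact: leey.
have ll0 := relent_fin_dominates lfin.
apply: ereal_inf_lbound; exists l => //; split => // m' Mm'.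
have [m0 hm0] := uniqM l ll0.
apply: (meq_weak_interior hbW hbX _ Am) => B mB.
by have /hm0/(_ B mB) -> := Mm; have /hm0/(_ B mB) -> := Mm'.
Qed.

Lemma weak_open_interior : weak_open (weak_interior A).
Proof.
move=> m [U [oU Um UA]]; have [k [fs [bf [e e0 h]]]] := oU m Um.
by exists k, fs; split => //; exists e => // m' /h Um'; exists U.
Qed.

Lemma sub_weak_closure : A `<=` weak_closure A.
Proof. by move=> m Am U _ Um; exists m. Qed.

Lemma dist_weak_open (d : PMs -> PMs -> R) (S : set PMs) (e : R) : metrizes d ->
  weak_open [set m | (dist d m S < e%:E)%E].
Proof.
move=> [d0 dC dT _ dU]; apply/dU => m /= /ereal_inf_lt[_ [s Ss <-]]; rewrite lte_fin => ms.
exists (e - d m s); first by rewrite subr_gt0.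
move=> m' /= mm'; apply: (@le_lt_trans _ _ (d m' s)%:E); first by apply: ereal_inf_lbound; exists s.
rewrite lte_fin; apply: le_lt_trans (dT m' m s) _; rewrite dC -ltrBrDr//.
Qed.

End rates.

(** * Exponential decay of the conditional probabilities *)

Section conditional_exponent.
Context {R : realType} {W : completePseudoMetricType R} {X : pseudoPMetricType R}.
Notation PMs := (PM W X).
Variables (bW : nat -> set W) (bX : nat -> set X).
Hypotheses (hbW : cbase bW) (hbX : cbase bX) (cX : compact [set: X]).
Variable u : nat -> W.
Hypothesis hu : forall x (e : R), 0 < e -> exists n, ball x e (u n).
Variables (C : W -> set X) (F : PMs -> W -> X -> R).
Hypotheses (hC : corr_cont C) (hF : F_bcont F).
Context dO {Om : measurableType dO} (P : probability Om R).
Variables (Ws : nat -> Om -> borel W) (l0 : probability (borel W) R).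
Hypothesis hiid : iid P Ws l0.
Variable (xhat : forall n : nat, ('I_n -> W) -> 'I_n -> X).
Hypothesis hxm : forall n (i : 'I_n) (B : set (borel X)), measurable B ->
  prodn_sigma (W:=W) (n:=n) ((fun v : 'I_n -> borel W => xhat v i) @^-1` B).
Hypothesis hnash : forall n (w : 'I_n -> W), nash F C w (xhat w).
Variable A : set PMs.
Hypothesis bA : weak_borel A.
Hypothesis Ifin : (Irate F C l0 A < +oo)%E.
Hypothesis Iint : Irate F C l0 A = Irate_int F C l0 A.

Let mu := mu_n Ws xhat.
Let S := Sset F C l0 A.

(** The closure of A minus U contains no minimiser, so the upper bound, applied with density 1 where
    the tilted law is P, has a rate r' above I(A). The assumption on I(A) supplies some l with M(l)
    inside the interior of A and entropy close to I(A), which bounds the denominator from below. *)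
Lemma escape_exp U : weak_open U -> S `<=` U -> exists2 c : R, 0 < c &
  \forall n \near \oo, escape P Ws xhat A U n <= expR (- (c * n%:R)).
Proof.
move=> oU SU; have mWs i : measurable_fun setT (Ws i) by case: hiid.
have IE := Irate_fine Ifin; set i := fine _ in IE.
have i0 : 0 <= i by rewrite -lee_fin -IE Irate_ge0.
pose B := weak_closure A `&` ~` U.
have cB : weak_open (~` B).
  by rewrite setCI setCK; apply: weak_openU => //; exact: weak_open_nclosure.
have [|r' ir' hr'] := ld_upper hbW hbX cX hu hC hF hiid hxm hnash (density_refl l0) cB i0.
  move=> m [Am nUm] Mm; apply: relent_gt_bcf; rewrite -IE; apply: Sset_gt => // Sm.
  by apply: nUm; exact: SU.
(* The numerator has exponent r' = i + 4 d and the denominator H + d < i + 2 d, which leaves 2 d. *)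
pose d := (r' - i) / 4; have d0 : 0 < d by rewrite divr_gt0// subr_gt0.
have [H [l [ll0 hl lH]] Hi] : exists2 H : R, exists l : probability (borel W) R,
    [/\ l `<< l0, (forall m, Mset F C l m -> weak_interior A m) & relent l l0 = H%:E] & H < i + d.
  have : (Irate_int F C l0 A < (i + d)%:E)%E by rewrite -Iint IE lte_fin ltrDl.
  move=> /ereal_inf_lt[_ [l [ll0 hl] <-]] h.
  have lfin : relent l l0 \is a fin_num by rewrite ge0_fin_numE ?relent_ge0// (lt_trans h) ?ltry.
  by exists (fine (relent l l0)); [exists l; rewrite fineK|rewrite -lte_fin fineK].
have hlow := ld_lower hbW hbX cX hu hC hF hiid hxm hnash (weak_open_interior (A := A)) lH hl d0.
exists (2 * d); first by rewrite mulr_gt0.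
near=> n.
have n0 : (0 < n)%N by near: n; exact: nbhs_infty_gt.
have up : (tilt hiid (density_refl l0) n [set o | B (mu n o)] <= (expR (- (r' * n%:R)))%:E)%E by near: n.
have low : expR (- ((H + d) * n%:R)) <= fine (P [set o | weak_interior A (mu n o)]) by near: n.
have mA : measurable [set o | A (mu n o)] by exact: (measurable_mu hbW hbX mWs hxm).
have mI : measurable [set o | weak_interior A (mu n o)].
  by apply: (measurable_mu hbW hbX mWs hxm) => //; apply: sub_sigma_algebra; exact: weak_open_interior.
have mB : measurable [set o | B (mu n o)].
  apply: (measurable_mu hbW hbX mWs hxm) => //; rewrite -[B]setCK; apply: weak_borelC.
  exact: sub_sigma_algebra.
have mesc := measurable_escape hbW hbX mWs hxm bA n0 oU.
have low' : expR (- ((H + d) * n%:R)) <= fine (P [set o | A (mu n o)]).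
  apply: (le_trans low); rewrite fine_le ?fin_num_measure// le_measure ?inE//.
  by move=> o [V [_ Vm VA]]; exact: VA.
have up' : fine (P ([set o | A (mu n o)] `&` [set o | ~ U (mu n o)])) <= expR (- (r' * n%:R)).
  rewrite -lee_fin fineK ?fin_num_measure//.
  apply: le_trans up.
  have -> : tilt hiid (density_refl l0) n [set o | B (mu n o)] = P [set o | B (mu n o)].
    rewrite /tilt /dens_measure; under eq_integral do rewrite /lik big1//.
    by rewrite integral_cst// mul1e.
  rewrite le_measure ?inE// => o [Ao nUo]; split => //; exact: sub_weak_closure.
rewrite /escape ler_pdivrMr; last by apply: lt_le_trans low'; exact: expR_gt0.
apply: (le_trans up'); apply: le_trans (ler_wpM2l (expR_ge0 _) low').
rewrite -expRD ler_expR; have : 0 <= n%:R :> R by [].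
have : (H + d + 2 * d) * n%:R <= r' * n%:R by rewrite ler_wpM2r//; move: Hi; rewrite /d; lra.
lra.
Unshelve. all: by end_near. Qed.

Lemma escape_cvg0 U : weak_open U -> S `<=` U -> escape P Ws xhat A U n @[n --> \oo] --> 0.
Proof.
move=> oU SU; have [c c0 hc] := escape_exp oU SU.
have mWs i : measurable_fun setT (Ws i) by case: hiid.
apply: (@squeeze_cvgr _ _ _ _ (cst 0) (fun n => (c * n%:R)^-1)).
- near=> n; apply/andP; split; first by rewrite divr_ge0// fine_ge0.
  have n0 : (0 < n)%N by near: n; exact: nbhs_infty_gt.
  apply: (@le_trans _ _ (expR (- (c * n%:R)))); first by near: n.
  rewrite expRN lef_pV2 ?posrE ?expR_gt0 ?mulr_gt0 ?ltr0n//.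
  by have := expR_ge1Dx (c * n%:R); lra.
- exact: cvg_cst.
- apply/gtr0_cvgV0; first by near=> n; rewrite mulr_gt0// ltr0n; near: n; exact: nbhs_infty_gt.
  apply/cvgryPge => a; near=> n; rewrite mulrC -ler_pdivrMr//.
  rewrite (le_trans (ltW (truncnS_gt _)))// ler_nat; near: n; exact: nbhs_infty_ge.
Unshelve. all: by end_near. Qed.

Lemma condE_cvg (nu0 : PMs) (G : PMs -> R) :
  (\forall n \near \oo, (0 < P [set o | A (mu n o)])%E) -> (forall m, S m <-> meq m nu0) ->
  (exists M : R, forall m, `|G m| <= M) -> weak_cont G ->
  condE P mu A n G @[n --> \oo] --> G nu0.
Proof.
move=> hpos hS [M hM] cG; have mWs i : measurable_fun setT (Ws i) by case: hiid.
apply/cvgrPdist_lt => e e0.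
pose U := [set m | `|G m - G nu0| < e / 2].
have e20 : 0 < e / 2 by rewrite divr_gt0.
have oU : weak_open U by exact: weak_cont_ball.
have SU : S `<=` U.
  move=> m /hS mn; rewrite /U/= (meq_weak_cont hbW hbX cG mn) subrr normr0//.
(* Centred at its limit, G is below e / 2 on U, and off U it is at most 2 M, weighted by the escape
   probability. *)
pose G' m := G m - G nu0.
have cG' : weak_cont G'.
  apply: (weak_cont_comp (h := fun t => t - G nu0) cG) => t.
  by apply: cvgB; [exact: cvg_id|exact: cvg_cst].
have hG' m : `|G' m| <= M + M by rewrite (le_trans (ler_normB _ _))// lerD.
have M0 : 0 <= M by apply: le_trans (hM nu0); exact: normr_ge0.
have /cvgrPdist_lt/(_ (e / 2 / (M + M + 1))) esc := escape_cvg0 oU SU.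
near=> n.
have n0 : (0 < n)%N by near: n; exact: nbhs_infty_gt.
have Pn : (0 < P [set o | A (mu n o)])%E by near: n.
have := condE_bound hbW hbX P mWs hxm bA n0 cG' hG' oU (ltW e20) (fun m Um => ltW Um).
rewrite (condE_sub_cst hbW hbX mWs hxm bA _ n0 cG hM)// distrC => /le_lt_trans; apply.
have : `|0 - escape P Ws xhat A U n| < e / 2 / (M + M + 1).
  by near: n; apply: esc; rewrite divr_gt0//; lra.
rewrite sub0r normrN => /(le_lt_trans (ler_norm _)).
rewrite ltr_pdivlMr; last by lra.
have : 0 <= escape P Ws xhat A U n by rewrite divr_ge0// fine_ge0.
lra.
Unshelve. all: by end_near. Qed.

End conditional_exponent.

Theorem theorem2p5 (R : realType)
  (W : completePseudoMetricType R) (X : pseudoPMetricType R)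
  (hW : hausdorff_space W)
  (sepW : exists D : set W, countable D /\ closure D = [set: W])
  (hX : hausdorff_space X) (cX : compact [set: X])
  (C : W -> set X) (hC : corr_cont C)
  (F : PM W X -> W -> X -> R) (hF : F_bcont F)
  (l0 : probability (borel W) R)
  (dO : measure_display) (Om : measurableType dO) (P : probability Om R)
  (Ws : nat -> Om -> borel W) (hiid : iid P Ws l0)
  (xhat : forall n : nat, ('I_n -> W) -> 'I_n -> X)
  (hxm : forall n (i : 'I_n) (B : set (borel X)), measurable B ->
           prodn_sigma (W:=W) (n:=n) ((fun v : 'I_n -> borel W => xhat n v i) @^-1` B))
  (hnash : forall n (w : 'I_n -> W), nash F C w (xhat n w))
  (A : set (PM W X)) (hA : weak_borel A) :
  let I := Irate F C l0 A in
  let S := Sset F C l0 A in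
  let mu := mu_n Ws xhat in
  let E := fun n => [set o | A (mu n o)] in
  (I < +oo)%E ->
  [/\ S !=set0 /\ weak_compact S,
      I = Irate_int F C l0 A -> (\forall n \near \oo, (0 < P (E n))%E) ->
      [/\ forall d : PM W X -> PM W X -> R, metrizes d ->
            forall eps : R, 0 < eps -> exists2 c : R, 0 < c &
              \forall n \near \oo,
                fine (P (E n `&` [set o | (eps%:E <= dist d (mu n o) S)%E])) /
                fine (P (E n)) <= expR (- (c * n%:R)),
          forall (nu : probability (PMb W X) R) (phi : nat -> nat),
            {homo phi : a b / (a < b)%N} ->
            (forall G : PM W X -> R, (exists M : R, forall m, `|G m| <= M) ->
               weak_cont G ->
               condE P mu A (phi k) G @[k --> \oo] -->
                 fine (\int[nu]_m (G m)%:E)%E) ->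
            nu S = 1%E &
          forall nu0 : PM W X, (forall m, S m <-> meq m nu0) ->
            forall G : PM W X -> R, (exists M : R, forall m, `|G m| <= M) ->
              weak_cont G ->
              condE P mu A n G @[n --> \oo] --> G nu0] &
      (forall l : probability (borel W) R, l `<< l0 ->
         exists m0 : PM W X, forall m, Mset F C l m <-> meq m m0) ->
      (I = Irate_int F C l0 A <->
         I = inf_closure F C l0 A /\ I = inf_interior F C l0 A)].
Proof.
move=> I S mu E Ifin.
have [D [cD clD]] := sepW.
have [bW hbW] := cbase_separable cD clD.
have [bX hbX] := cbase_second_countable (compact_second_countable cX).
have [u hu] := separable_seq cD clD.
have mWs i : measurable_fun setT (Ws i) by case: hiid.
split.
- split; first exact: (Sset_nonempty hbW hbX cX hu hC hF).
  exact: (weak_compact_S hbW hbX cX hu hC hF).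
- move=> Iint hpos; split.
  + move=> d dm eps eps0; pose U := [set m | (dist d m S < eps%:E)%E].
    have oU : weak_open U by exact: dist_weak_open.
    have SU : S `<=` U.
      move=> m Sm; rewrite /U /=; apply: (@le_lt_trans _ _ 0%:E); last by rewrite lte_fin.
      by apply: ereal_inf_lbound; exists m => //; case: dm => ->.
    have [c c0 hc] := escape_exp hbW hbX cX hu hC hF hiid hxm hnash hA Ifin Iint oU SU.
    exists c => //; near=> n.
    suff -> : [set o | (eps%:E <= dist d (mu n o) S)%E] = [set o | ~ U (mu n o)] by near: n.
    by apply/seteqP; split => o /=; rewrite /U/= leNgt => /negP.
  + move=> nu phi hphi hnu.
    apply: (support_of_limit hbW hbX mWs hxm hA _ _ _ hphi hnu).
    * exact: (weak_compact_S hbW hbX cX hu hC hF).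
    * exact: (weak_open_nS hbW hbX hC hF).
    * exact: (escape_cvg0 hbW hbX cX hu hC hF hiid hxm hnash hA Ifin Iint).
  + move=> nu0 hS G bG cG.
    exact: (condE_cvg hbW hbX cX hu hC hF hiid hxm hnash hA Ifin Iint hpos hS bG cG).
- move=> uniqM; rewrite inf_closure_Irate (inf_interior_Irate_int A hbW hbX uniqM).
  by split => [|[_]].
Unshelve. all: by end_near. Qed.
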